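(* Let $H$ be a fixed connected planar graph with $e(H)\le |H|$ (where $e(H)$ is the number of edges and $|H|$ the number of vertices of $H$), let $c>0$ and $B<3$ be constants, and let $m(n)$ be integers with $m(n)\in[cn,Bn]$ for all $n$. Then there exist constants $\epsilon=\epsilon(H,c,B)>0$ and $N=N(H,c,B)$ such that \[ \mathbf{P}[P_{n,m}\text{ has a component isomorphic to } H]\ \ge\ \epsilon \quad\text{for all } n\ge N. \]
   Context: $\mathcal{P}(n,m)$ denotes the set of all (simple, labelled) planar graphs on the vertex set $\{1,2,\ldots,n\}$ with exactly $m$ edges, and $P_{n,m}$ denotes a graph chosen uniformly at random from $\mathcal{P}(n,m)$. *)

(* Defs.v *)
From HB Require Import structures.
From mathcomp Require Import all_boot all_order all_algebra.
From mathcomp Require Import all_classical all_reals topology normedtype.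
Set Implicit Arguments.
Unset Strict Implicit.
Unset Printing Implicit Defensive.
Import Order.TTheory GRing.Theory Num.Theory.
Import numFieldNormedType.Exports.

(* A graph on a vertex type T is given by its edge set, of type {set {set T}}. *)

Definition simple_graph (T : finType) (E : {set {set T}}) : bool :=
  [forall e in E, #|e| == 2].

Definition adj (T : finType) (E : {set {set T}}) : rel T :=
  fun x y => [set x; y] \in E.

(* The graph with no vertices is not connected. *)
Definition connected_graph (T : finType) (E : {set {set T}}) : bool :=
  (0 < #|T|) && [forall x, forall y, connect (adj E) x y].

Definition is_component (T : finType) (E : {set {set T}}) (C : {set T}) : bool :=
  [exists x, C == [set y | connect (adj E) x y]].

Definition induced_edges (T : finType) (E : {set {set T}}) (C : {set T}) :
    {set {set T}} :=
  [set e in E | e \subset C].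

(* The graph (V, F) is isomorphic to the graph (C, D), where C is a set of *)
(* elements of T and D is a set of edges on C. *)
Definition isomorphic_to (V T : finType) (F : {set {set V}})
    (C : {set T}) (D : {set {set T}}) : bool :=
  [exists f : {ffun V -> T},
    [&& injectiveb f, f @: [set: V] == C & [set f @: (e : {set V}) | e in F] == D]].

Definition has_component_iso (V T : finType) (F : {set {set V}})
    (E : {set {set T}}) : bool :=
  [exists C : {set T},
    is_component E C && isomorphic_to F C (induced_edges E C)].

Section Planarity.
Local Open Scope ring_scope.
Context (R : realType) (T : finType).

(* Vertices are drawn as distinct points p v of the plane R * R, and each *)
(* edge e as the simple arc a e, parametrised by [0, 1]. *)
Record plane_drawing (E : {set {set T}}) (p : T -> R * R)
    (a : {set T} -> R -> R * R) : Prop := PlaneDrawing {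
  drawing_vertex_inj : injective p;
  drawing_arc_continuous : forall e, e \in E ->
    {within `[0, 1], continuous (a e)}%classic;
  drawing_arc_inj : forall e, e \in E ->
    forall s t, 0 <= s <= 1 -> 0 <= t <= 1 -> a e s = a e t -> s = t;
  drawing_arc_ends : forall e, e \in E ->
    exists u v, [/\ e = [set u; v], a e 0 = p u & a e 1 = p v];
  drawing_arc_vertex : forall e, e \in E ->
    forall t v, 0 < t < 1 -> a e t <> p v;
  drawing_arc_disjoint : forall e e', e \in E -> e' \in E -> e != e' ->
    forall s t, 0 < s < 1 -> 0 < t < 1 -> a e s <> a e' t
}.

Definition planar (E : {set {set T}}) : Prop :=
  exists p a, plane_drawing E p a.

End Planarity.

(* The vertex set {1, ..., n} is represented by 'I_n. *)
Definition planar_graphs (R : realType) (n m : nat) : {set {set {set 'I_n}}} :=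
  [set E | [&& simple_graph E, #|E| == m & `[< planar R E >]]].

(* Probability that a uniformly random element of A satisfies Q; it is 0 by *)
(* convention when A is empty. *)
Definition uniform_probability (R : realType) (X : finType) (A : {set X})
    (Q : pred X) : R :=
  (#|[set x in A | Q x]|%:R / #|A|%:R)%R.

(* Main.v *)
Require Import Defs.
From mathcomp Require Import all_boot all_order all_algebra.
From mathcomp Require Import zify ring lra.
From mathcomp Require Import boolp.
Import Order.TTheory GRing.Theory Num.Theory.

Set Implicit Arguments.
Unset Strict Implicit.
Unset Printing Implicit Defensive.

(* A graph is planar exactly when it is a minor of a grid. Grid minors are    *)
(* closed under contraction, disjoint union and the addition of pendant       *)
(* edges, and the squares of the grid provide faces; hence Euler's            *)
(* inequality, and a planar graph on n vertices extends to one with 3n - 6    *)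
(* edges.                                                                     *)
(*                                                                            *)
(* By counting edges, a planar graph on n vertices has linearly many isolated *)
(* vertices, or linearly many vertices of bounded degree with a neighbour of  *)
(* bounded degree, or linearly many vertices of degree 1 or 2 having the same *)
(* neighbourhood as another vertex. From a graph without a component H we     *)
(* free |H| such vertices, by contracting an edge at each in the second case  *)
(* and by deleting the edges at them otherwise, and put a copy of H on them.  *)
(* This can be done in about n^|H| ways, and each outcome arises O(n^|H|)     *)
(* times, because a freed vertex is reinserted by pointing at one other       *)
(* vertex. In the last two cases at least |H| >= e(H) edges were lost, and    *)
(* the missing ones are added back, each at the cost of a constant factor     *)
(* since m <= Bn with B < 3. With isolated vertices nothing is lost, and      *)
(* removing e(H) surplus edges costs a factor O(n^e(H)), while the copy is    *)
(* planted without any choice to undo; as e(H) <= |H| this suffices.          *)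

(** * Minors of the grid *)

(** Write n for the number of vertices and h for |H|. Planar graphs with m edges are split into
    those with a component H and those without. By [without_copy_rate] the second class is at most K
    times as large as the first, with K independent of n, so 1/(K+1) serves as the lower bound.

    The comparison is a double count ([choice_count], in the form [absorb_count]). By
    [vertex_trichotomy] a graph G without the component has a positive proportion of vertices of one
    of three kinds, hence at least a constant times n^h ways to map H injectively into them. Freeing
    the chosen vertices gives a planar graph G1 with no edge at them, and H is planted there
    ([isolated_count], [light_count], [twinned_count]). Undoing is cheap for two reasons. The
    planted copy is one of boundedly many, since any other copy must touch a bounded set around the
    changes, or it would already be a component of G ([card_copies]). And G is recovered from G1 by
    naming one vertex per freed vertex, its contraction partner or its twin, and a bounded amount of
    further information. This costs a constant times n^h and cancels the gain.

    The number of edges is then corrected. As m stays away from 3n, linearly many edges can be added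
    off the copy, and an added edge is one of O(n), so each missing edge costs a constant factor
    ([copy_extend_iter]). With isolated vertices nothing has to be rebuilt, and the gain n^h pays
    for deleting e(H) <= h edges at a factor O(n) each ([copy_delete_iter]).

    The facts needed on planar graphs are linear edge bounds (also for bipartite graphs), closure
    under contraction and disjoint union, and extension to 3n - 6 edges. They are proved for minors
    of the grid. [planar_grid_minor] obtains such a minor by rounding a drawing to a fine grid;
    [grid_minor_planar] contracts the straight-line drawing of the grid edge by edge, allowing
    bends. For grid minors Euler's formula is linear algebra over F_2: by [faces_of_model] the face
    boundaries generate the cycle space and satisfy only the constant relation, and [euler_upper]
    and [maximal_grid_minor] are the resulting rank inequalities. [face_vertex] places a new vertex
    inside a face, which shows that faces of a maximal graph are small. *)

Definition cell := (nat * nat)%type.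

Definition gadj (p q : cell) : bool :=
  ((p.1 == q.1) && ((p.2.+1 == q.2) || (q.2.+1 == p.2))) ||
  ((p.2 == q.2) && ((p.1.+1 == q.1) || (q.1.+1 == p.1))).

Inductive walk (P : pred cell) : cell -> cell -> Prop :=
| walk_refl p : P p -> walk P p p
| walk_step p q r : P p -> gadj p q -> walk P q r -> walk P p r.

(* Cells carry vertices as labels. A vertex on no edge may label no cell. *)
Definition grid_minor (V : finType) (E : {set {set V}}) : Prop :=
  exists (f : cell -> option V) (N : nat),
  [/\ forall p, f p -> (0 < p.1 < N) && (0 < p.2 < N),
      forall a p q, f p = Some a -> f q = Some a ->
        walk (fun c => f c == Some a) p q &
      forall a b, a != b -> [set a; b] \in E ->
        exists p q, [/\ f p = Some a, f q = Some b & gadj p q]].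

Lemma gadjC p q : gadj p q = gadj q p.
Proof. rewrite /gadj; lia. Qed.

Lemma walk_trans P p q r : walk P p q -> walk P q r -> walk P p r.
Proof. by elim=> [//|p1 q1 r1 Pp a _ IH /IH]; exact: walk_step. Qed.

Lemma walk_start (P : pred cell) p q : walk P p q -> P p.
Proof. by case. Qed.

Lemma walk1 (P : pred cell) p q : P p -> P q -> gadj p q -> walk P p q.
Proof. by move=> Pp Pq a; apply: walk_step a _ => //; exact: walk_refl. Qed.

Lemma walk_sym P p q : walk P p q -> walk P q p.
Proof.
elim=> [p1 Pp|p1 q1 r1 Pp a w IH]; first exact: walk_refl.
apply: walk_trans IH _; apply: walk1 => //; last by rewrite gadjC.
exact: walk_start w.
Qed.

Lemma walk_sub (P Q : pred cell) p q :
  (forall c, P c -> Q c) -> walk P p q -> walk Q p q.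
Proof.
move=> sPQ; elim=> [p1 /sPQ|p1 q1 r1 /sPQ Pp a _]; first exact: walk_refl.
exact: walk_step.
Qed.

(** All passages to a minor go through this. The branch set of [c] is the union of those in its
    fibre under [g]; it is connected because each member of the fibre equals or is adjacent to one
    hub [h]. *)
Lemma grid_minor_map (V V' : finType) (E : {set {set V}}) (E' : {set {set V'}})
    (g : V -> option V') :
  (forall a b c, g a = Some c -> g b = Some c -> exists h,
     [/\ g h = Some c, a = h \/ [set a; h] \in E & b = h \/ [set b; h] \in E]) ->
  (forall a' b', a' != b' -> [set a'; b'] \in E' ->
     exists a b, [/\ g a = Some a', g b = Some b' & [set a; b] \in E]) ->
  grid_minor E -> grid_minor E'.
Proof.
move=> gfib gE [f [N [fN fC fE]]].
pose f' := fun p => obind g (f p).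
have fib p a : f p = Some a -> f' p = g a by rewrite /f' => ->.
have fib' p c : f' p = Some c -> exists2 a, f p = Some a & g a = Some c.
  by rewrite /f'; case: (f p) => //= a; exists a.
have sub a c : g a = Some c -> forall p, f p == Some a -> f' p == Some c.
  by move=> ga p /eqP/fib ->; rewrite ga.
have within a c p q : g a = Some c -> f p = Some a -> f q = Some a ->
    walk (fun x => f' x == Some c) p q.
  by move=> ga fp fq; apply: walk_sub (fC _ _ _ fp fq); exact: sub.
have to_hub a h c p : g a = Some c -> g h = Some c -> a = h \/ [set a; h] \in E ->
    f p = Some a -> exists2 q, f q = Some h & walk (fun x => f' x == Some c) p q.
  move=> ga gh ah fp; have [eah|nah] := eqVneq a h.
    by exists p; rewrite -?eah; [exact: fp|exact: (within _ _ _ _ ga fp fp)].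
  case: ah => [/eqP|ahE]; first by rewrite (negPf nah).
  have [p1 [q1 [fp1 fq1 adj]]] := fE _ _ nah ahE.
  exists q1 => //; apply: walk_trans (within _ _ _ _ ga fp fp1) _.
  by apply: walk1 => //; [rewrite (fib _ _ fp1) ga|rewrite (fib _ _ fq1) gh].
exists f', N; split.
- by move=> p fp; apply: fN; move: fp; rewrite /f'; case: (f p).
- move=> c p q /fib'[a fp ga] /fib'[b fq gb].
  have [h [gh ah bh]] := gfib _ _ _ ga gb.
  have [p' fp' wp] := to_hub _ _ _ _ ga gh ah fp.
  have [q' fq' wq] := to_hub _ _ _ _ gb gh bh fq.
  apply: walk_trans wp (walk_trans _ (walk_sym wq)).
  exact: within gh fp' fq'.
- move=> a' b' nab /gE - /(_ nab)[a [b [ga gb abE]]].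
  have nab' : a != b.
    by apply: contraNneq nab => eab; move: ga; rewrite eab gb => -[->].
  have [p [q [fp fq pq]]] := fE _ _ nab' abE.
  by exists p, q; split=> //; [rewrite (fib _ _ fp)|rewrite (fib _ _ fq)].
Qed.

Lemma grid_minor_sub (V : finType) (E E' : {set {set V}}) :
  E' \subset E -> grid_minor E -> grid_minor E'.
Proof.
move=> sEE; apply: (grid_minor_map (g := some)).
- by move=> a b c [->] [->]; exists c; split; auto.
- by move=> a b _ /(subsetP sEE); exists a, b.
Qed.

Lemma walk_shift (P Q : pred cell) M p q :
  (forall c, P c -> Q (c.1 + M, c.2)) -> walk P p q ->
  walk Q (p.1 + M, p.2) (q.1 + M, q.2).
Proof.
move=> PQ; elim=> [p1 /PQ|p1 q1 r1 /PQ Pp a _]; first exact: walk_refl.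
by apply: walk_step => //; move: a; rewrite /gadj /=; lia.
Qed.

(** The two models are put side by side, the second shifted by the width [N1] of the first. *)
Lemma grid_minor_union (V1 V2 : finType) (E1 : {set {set V1}})
    (E2 : {set {set V2}}) (E : {set {set V1 + V2}}) :
  (forall a b : V1 + V2, a != b -> [set a; b] \in E ->
     match a, b with
     | inl a, inl b => [set a; b] \in E1
     | inr a, inr b => [set a; b] \in E2
     | _, _ => false
     end) ->
  grid_minor E1 -> grid_minor E2 -> grid_minor E.
Proof.
move=> EP [f1 [N1 [fN1 fC1 fE1]]] [f2 [N2 [fN2 fC2 fE2]]].
pose f (p : cell) : option (V1 + V2) :=
  if p.1 < N1 then omap inl (f1 p) else omap inr (f2 (p.1 - N1, p.2)).
have fl p a : (f p == Some (inl a)) = (f1 p == Some a).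
  rewrite /f; case: ltnP => pN; first by case: (f1 p).
  case e1 : (f1 p) => [b|]; last by case: (f2 _).
  by have := fN1 p; rewrite e1 => /(_ isT); lia.
have fr p a : f2 p = Some a -> f (p.1 + N1, p.2) = Some (inr a).
  by rewrite /f /= ltnNge leq_addl /= addnK -surjective_pairing => ->.
have fr' p a : f p = Some (inr a) ->
    exists2 q, p = (q.1 + N1, q.2) & f2 q = Some a.
  rewrite /f; case: ltnP => pN; first by case: (f1 p).
  case e : (f2 _) => [b|//] [<-]; exists (p.1 - N1, p.2) => //=.
  by rewrite subnK // -surjective_pairing.
exists f, (N1 + N2); split.
- move=> p; rewrite /f; case: ltnP => pN.
    by case e : (f1 p) => [b|//] _; have := fN1 p; rewrite e => /(_ isT); lia.
  case e : (f2 _) => [b|//] _.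
  by have := fN2 (p.1 - N1, p.2); rewrite e /= => /(_ isT); lia.
- case=> a p q.
    move=> /eqP; rewrite fl => /eqP fp /eqP; rewrite fl => /eqP fq.
    by apply: walk_sub (fC1 _ _ _ fp fq) => c; rewrite fl.
  move=> /fr'[p' -> fp] /fr'[q' -> fq].
  apply: walk_shift (fC2 _ _ _ fp fq) => c /eqP fc.
  by apply/eqP; exact: fr.
- move=> a b nab /EP - /(_ nab); case: a b nab => [a|a] [b|b] nab // abE.
    have nab' : a != b by apply: contraNneq nab => ->.
    have [p [q [fp fq pq]]] := fE1 _ _ nab' abE.
    by exists p, q; split=> //; apply/eqP; rewrite fl; apply/eqP.
  have nab' : a != b by apply: contraNneq nab => ->.
  have [p [q [fp fq pq]]] := fE2 _ _ nab' abE.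
  exists (p.1 + N1, p.2), (q.1 + N1, q.2); split; try exact: fr.
  by move: pq; rewrite /gadj /=; lia.
Qed.

(** * Faces of a minor of the grid *)

Section GridComplex.
Local Open Scope ring_scope.
Context (N : nat).
Notation Q := ('I_N * 'I_N)%type.
Notation D := (bool * Q)%type.
Implicit Types (d : D) (q x y : Q) (w : cell) (S : {set D}) (Z : D -> 'F_2).

Definition cell_of (x : Q) : cell := (x.1 : nat, x.2 : nat).

(** Truncated at 0, so that an edge running along the left or lower border has the same square on
    both sides. *)
Definition ord_down (i : 'I_N) : 'I_N :=
  Ordinal (leq_ltn_trans (leq_pred i) (ltn_ord i)).

(* The edge (true, (i, j)) joins the cell (i, j) to (i + 1, j), and        *)
(* (false, (i, j)) joins it to (i, j + 1). The square (i, j) has (i, j) as *)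
(* its lower left corner.                                                  *)
Definition esrc (d : D) : cell := cell_of d.2.
Definition etgt (d : D) : cell :=
  if d.1 then ((d.2.1).+1, d.2.2 : nat) else (d.2.1 : nat, (d.2.2).+1).
Definition eleft (d : D) : Q := d.2.
Definition eright (d : D) : Q :=
  if d.1 then (d.2.1, ord_down d.2.2) else (ord_down d.2.1, d.2.2).

Definition boundary (Z : D -> 'F_2) (w : cell) : 'F_2 :=
  \sum_d Z d * ((esrc d == w)%:R + (etgt d == w)%:R).

Lemma addF2 (x : 'F_2) : x + x = 0.
Proof. by apply: addrr_pchar2; exact: pchar_Fp. Qed.

Lemma cell_of_inj : injective cell_of.
Proof. by case=> [a b] [c d] [/val_inj -> /val_inj ->]. Qed.

Lemma boundaryE Z (i j i' j' : 'I_N) : i = i'.+1 :> nat -> j = j'.+1 :> nat ->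
  boundary Z (i : nat, j : nat) =
  Z (true, (i, j)) + Z (false, (i, j)) + (Z (true, (i', j)) + Z (false, (i, j'))).
Proof.
move=> ii jj; rewrite /boundary.
under eq_bigr do rewrite mulrDr.
rewrite big_split /=; congr (_ + _).
  rewrite (bigD1 (true, (i, j))) //= (bigD1 (false, (i, j))) //= big1 ?addr0.
    by rewrite !eqxx !mulr1.
  move=> [b [a c]] /andP[n1 n2]; case: eqP => [[ea ec]|]; last by rewrite mulr0.
  have [eqa eqc] : a = i /\ c = j by split; apply: val_inj.
  by move: n1 n2; rewrite eqa eqc; case: b; rewrite eqxx.
rewrite (bigD1 (true, (i', j))) //= (bigD1 (false, (i, j'))) //= big1 ?addr0.
  by rewrite /etgt /= -ii -jj !eqxx !mulr1.
move=> [b [a c]] /andP[n1 n2]; case: eqP => [|]; last by rewrite mulr0.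
rewrite /etgt; case: b n1 n2 => /= n1 n2 [ea ec].
  have [eqa eqc] : a = i' /\ c = j by split; apply: val_inj => //=; lia.
  by move: n1; rewrite eqa eqc eqxx.
have [eqa eqc] : a = i /\ c = j' by split; apply: val_inj => //=; lia.
by move: n2; rewrite eqa eqc eqxx.
Qed.

Lemma boundaryD Z Z' w :
  boundary (fun d => Z d + Z' d) w = boundary Z w + boundary Z' w.
Proof. by rewrite -big_split; apply: eq_bigr => d _; rewrite mulrDl. Qed.

Lemma boundary_sum (I : finType) (P : pred I) (c : I -> 'F_2) (Z : I -> D -> 'F_2) w :
  boundary (fun d => \sum_(e | P e) c e * Z e d) w =
  \sum_(e | P e) c e * boundary (Z e) w.
Proof.
rewrite /boundary; under eq_bigr do rewrite mulr_suml.
rewrite exchange_big; apply: eq_bigr => e _.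
by rewrite mulr_sumr; apply: eq_bigr => d _; rewrite mulrA.
Qed.

Lemma boundary_delta d0 w :
  boundary (fun d => (d == d0)%:R) w = (esrc d0 == w)%:R + (etgt d0 == w)%:R.
Proof.
rewrite /boundary (bigD1 d0) //= eqxx mul1r big1 ?addr0 // => d /negPf ->.
by rewrite mul0r.
Qed.

(** Each of the four squares around an inner cell borders exactly two of the four edges at that
    cell. *)
Lemma coboundary_even (chi : Q -> 'F_2) (w : cell) :
  (0 < w.1 < N)%N && (0 < w.2 < N)%N ->
  boundary (fun d => chi (eleft d) + chi (eright d)) w = 0.
Proof.
case: w => i j /= /andP[/andP[i0 iN] /andP[j0 jN]].
have i'N : (i.-1 < N)%N by lia.
have j'N : (j.-1 < N)%N by lia.
rewrite (@boundaryE _ (Ordinal iN) (Ordinal jN) (Ordinal i'N) (Ordinal j'N));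
  [|by rewrite /=; lia..].
rewrite /eleft /eright /=.
have -> : ord_down (Ordinal iN) = Ordinal i'N by exact: val_inj.
have -> : ord_down (Ordinal jN) = Ordinal j'N by exact: val_inj.
set a := chi _; set b := chi _; set c := chi _; set e := chi _.
have -> : a + b + (a + c) + (c + e + (b + e)) =
  (a + a) + (b + b) + (c + c) + (e + e) by ring.
by rewrite !addF2 ?addr0.
Qed.

(* Colour a square by the parity of the vertical edges of Z to its left. *)
Lemma even_coboundary Z :
  (forall d, (d.2.1 == 0%N :> nat) || (d.2.2 == 0%N :> nat) -> Z d = 0) ->
  (forall w, (0 < w.1 < N)%N && (0 < w.2 < N)%N -> boundary Z w = 0) ->
  exists chi : Q -> 'F_2, forall d, Z d = chi (eleft d) + chi (eright d).
Proof.
move=> Z0 Zev.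
pose g (b : 'I_N) n := \sum_(k : 'I_N | (k <= n)%N) Z (false, (k, b)).
have gS b (a : 'I_N) n : a = n.+1 :> nat -> g b a = g b n + Z (false, (a, b)).
  move=> an; rewrite /g (bigD1 a) //= addrC; congr (_ + _); apply: eq_bigl => k.
  by rewrite -val_eqE /= an; lia.
have g0 b n : n = 0%N -> g b n = 0.
  by move=> ->; rewrite /g big1 // => k; rewrite leqn0 => k0; apply: Z0; rewrite k0.
exists (fun q => g q.2 q.1) => -[[] [a b]]; rewrite /eleft /eright /=; last first.
  case an : (a : nat) => [|n].
    by rewrite addF2; apply: Z0; rewrite /= an.
  by have := gS b a n an; rewrite an => ->; rewrite addrAC addF2 add0r.
case bn : (b : nat) => [|n].
  have -> : ord_down b = b by apply: val_inj; rewrite /= bn.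
  by rewrite addF2; apply: Z0; rewrite /= bn orbT.
set b' := ord_down b; have bb' : b = b'.+1 :> nat by rewrite /= bn.
(* Vertical edges fit the colouring by construction. For horizontal ones, evenness at the cell
   [(i, b)] carries the identity from one column to the next. *)
have main m : forall i : 'I_N, i = m :> nat ->
    Z (true, (i, b)) = g b m + g b' m.
  elim: m => [|m IH] i im.
    by rewrite !g0 // addr0; apply: Z0; rewrite /= im.
  have mN : (m < N)%N by have := ltn_ord i; lia.
  have := Zev (i : nat, b : nat); rewrite /= !ltn_ord im bn /= => /(_ isT).
  rewrite -im -bn (@boundaryE _ i b (Ordinal mN) b') //= (gS _ _ _ im) (gS _ _ _ im).
  rewrite (IH (Ordinal mN)) //.
  set t := Z _; set u := Z _; set v := Z _.
  move=> E; rewrite -[t]addr0 -E.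
  have -> : t + (t + u + (g b m + g b' m + v)) = (t + t) + (u + (g b m + g b' m + v)).
    by ring.
  rewrite addF2; ring.
exact: main.
Qed.

(** Steps to the left and downwards lead from every square to the one at the origin. *)
Lemma locally_const (chi : Q -> 'F_2) :
  (forall d, chi (eleft d) = chi (eright d)) -> forall q q', chi q = chi q'.
Proof.
move=> chiE.
have h1 m (i j k : 'I_N) : i = m :> nat -> k = 0%N :> nat -> chi (i, j) = chi (k, j).
  elim: m i => [|m IH] i im k0; first by congr (chi (_, _)); apply: val_inj; rewrite /= im k0.
  rewrite -(IH (ord_down i)) //= ?im //.
  exact: (chiE (false, (i, j))).
have h2 m (i j k : 'I_N) : j = m :> nat -> k = 0%N :> nat -> chi (i, j) = chi (i, k).
  elim: m j => [|m IH] j jm k0; first by congr (chi (_, _)); apply: val_inj; rewrite /= jm k0.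
  rewrite -(IH (ord_down j)) //= ?jm //.
  exact: (chiE (true, (i, j))).
move=> [i j] [i' j'].
have N0 : (0 < N)%N by have := ltn_ord i; lia.
pose o := Ordinal N0.
by rewrite (h1 i i j o) // (h1 i' i' j' o) // (h2 j o j o) // (h2 j' o j' o).
Qed.

Definition srel S : rel Q := fun x y => [exists d in S,
  (esrc d == cell_of x) && (etgt d == cell_of y) ||
  (esrc d == cell_of y) && (etgt d == cell_of x)].

Lemma srelC S : symmetric (srel S).
Proof. by move=> x y; apply: eq_existsb => d; rewrite orbC. Qed.

Lemma connect_srelC S : connect_sym (srel S).
Proof. exact: sym_connect_sym (@srelC S). Qed.

(** The classes of the equivalence generated by this relation are the faces of the grid subgraph
    [S]. *)
Definition drel S : rel Q := fun q q' => [exists d,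
  (d \notin S) && ((eleft d == q) && (eright d == q') ||
                   (eleft d == q') && (eright d == q))].

Lemma connect_drelC S : connect_sym (drel S).
Proof.
by apply: sym_connect_sym => q q'; apply: eq_existsb => d; rewrite orbC [in RHS]orbC orbC.
Qed.

Lemma connect_const (T : finType) (A : eqType) (e : rel T) (h : T -> A) :
  (forall s t, e s t -> h s = h t) -> forall s t, connect e s t -> h s = h t.
Proof.
move=> he s t /connectP[p + ->]; elim: p s => //= u p IH s /andP[/he -> /IH].
exact.
Qed.

Lemma sum_delta (A : {set Q}) (w : cell) :
  \sum_(x in A) (w == cell_of x)%:R = ([exists x in A, w == cell_of x])%:R :> 'F_2.
Proof.
case: existsP => [[x0 /andP[x0A /eqP ->]]|nex].
  rewrite (bigD1 x0) //= eqxx big1 ?addr0 // => x /andP[_ /negPf nx].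
  by case: eqP => // /cell_of_inj ex; rewrite ex eqxx in nx.
by rewrite big1 // => x xA; case: eqP => // wx; case: nex; exists x; rewrite xA wx eqxx.
Qed.

(** An edge with both ends in [A] cancels modulo 2, so in applications only the edges leaving [A]
    survive. *)
Lemma sum_boundary Z (A : {set Q}) :
  \sum_(x in A) boundary Z (cell_of x) =
  \sum_d Z d * (([exists x in A, esrc d == cell_of x])%:R +
                ([exists x in A, etgt d == cell_of x])%:R).
Proof.
rewrite exchange_big /=; apply: eq_bigr => d _.
by rewrite -mulr_sumr big_split /= !sum_delta.
Qed.

Lemma connect_chain S x y : connect (srel S) x y ->
  exists c : D -> 'F_2, (forall d, d \notin S -> c d = 0) /\
    forall w, boundary c w = (cell_of x == w)%:R + (cell_of y == w)%:R.
Proof.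
case/connectP=> p; elim: p x => [|z p IH] x /=.
  move=> _ ->; exists (fun => 0); split=> // w.
  by rewrite addF2 /boundary big1 // => d _; rewrite mul0r.
case/andP=> /existsP[d0 /andP[d0S xz]] zp /(IH z zp)[c [cS cb]].
exists (fun d => (d == d0)%:R + c d); split.
  by move=> d dS; rewrite cS // addr0; case: eqP dS => // ->; rewrite d0S.
move=> w; rewrite boundaryD boundary_delta cb.
case/orP: xz => /andP[/eqP -> /eqP ->].
  set a := (_ == _)%:R; set b := (_ == _)%:R; set e := (_ == _)%:R.
  by have -> : a + b + (b + e) = (b + b) + (a + e); [ring|rewrite addF2 add0r].
set a := (_ == _)%:R; set b := (_ == _)%:R; set e := (_ == _)%:R.
by have -> : a + b + (a + e) = (a + a) + (b + e); [ring|rewrite addF2 add0r].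
Qed.

End GridComplex.

(** * Planar duality over F_2 for a minor of the grid *)

Section GridModel.
Local Open Scope ring_scope.
Context (V : finType) (E : {set {set V}}) (N : nat) (f : cell -> option V).
Context (f_supp : forall p, f p -> (0 < p.1 < N)%N && (0 < p.2 < N)%N).
Context (f_conn : forall a p q, f p = Some a -> f q = Some a ->
  walk (fun c => f c == Some a) p q).
Notation Q := ('I_N * 'I_N)%type.
Notation D := (bool * Q)%type.
Implicit Types (S : {set D}) (Z : D -> 'F_2).

Definition inner_edges : {set D} :=
  [set d | f (esrc d) && (f (esrc d) == f (etgt d))].

Definition spans (S : {set D}) : bool :=
  [forall x : Q, forall y : Q, f (cell_of x) ==>
    (f (cell_of x) == f (cell_of y)) ==> connect (srel S) x y].

Lemma labelled_cell p : f p -> exists x : Q, cell_of x = p.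
Proof.
move/f_supp; case: p => i j /= /andP[/andP[_ iN] /andP[_ jN]].
by exists (Ordinal iN, Ordinal jN).
Qed.

Lemma gadj_edge (x y : Q) : gadj (cell_of x) (cell_of y) -> exists d : D,
  (esrc d == cell_of x) && (etgt d == cell_of y) ||
  (esrc d == cell_of y) && (etgt d == cell_of x).
Proof.
move: x y => [a b] [c e]; rewrite /gadj /cell_of /= => H.
have [ac|ac] := eqVneq (a : nat) c; have [be|be] := eqVneq (b : nat) e; try lia.
- have [bl|bl] := ltnP b e.
    by exists (false, (a, b)); rewrite /esrc /etgt /cell_of /= !xpair_eqE; lia.
  by exists (false, (c, e)); rewrite /esrc /etgt /cell_of /= !xpair_eqE; lia.
- have [al|al] := ltnP a c.
    by exists (true, (a, b)); rewrite /esrc /etgt /cell_of /= !xpair_eqE; lia.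
  by exists (true, (c, e)); rewrite /esrc /etgt /cell_of /= !xpair_eqE; lia.
Qed.

Lemma spans_inner : spans inner_edges.
Proof.
apply/forallP => x; apply/forallP => y; apply/implyP => fx; apply/implyP => /eqP fxy.
case fa : (f (cell_of x)) fx => [a|//] _.
move: (f_conn fa (etrans (esym fxy) fa)) => {fa fxy}.
move pE : (cell_of x) => p; move qE : (cell_of y) => q w.
elim: w x pE y qE => [p1 _|p1 q1 r1 /eqP fp1 adj w IH] x pE y qE.
  by rewrite (cell_of_inj (etrans pE (esym qE))) connect0.
have /eqP fq1 := walk_start w.
have [z zE] : exists z : Q, cell_of z = q1 by apply: labelled_cell; rewrite fq1.
apply: connect_trans (IH z zE y qE); apply: connect1.
have [d dE] : exists d : D, (esrc d == cell_of x) && (etgt d == cell_of z) ||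
    (esrc d == cell_of z) && (etgt d == cell_of x).
  by apply: gadj_edge; rewrite pE zE.
apply/existsP; exists d; rewrite dE andbT inE.
by case/orP: dE => /andP[/eqP -> /eqP ->]; rewrite ?pE ?zE fp1 fq1 /=.
Qed.

(** A minimal spanning set is a forest. If an even chain [Z] used the edge [d0], then by minimality
    [d0] would be the only edge of [S] between two pieces of a branch set, and summing the boundary
    of [Z] over one piece gives [Z d0 = 0]. *)
Lemma thin_span : exists S : {set D}, [/\ S \subset inner_edges, spans S &
  forall Z, (forall d, d \notin S -> Z d = 0) ->
    (forall x : Q, f (cell_of x) -> boundary Z (cell_of x) = 0) ->
    forall d, Z d = 0].
Proof.
have [S /minsetP[spS minS] sS] := minset_exists spans_inner.
exists S; split=> // Z ZS Zev d0; apply/eqP; apply/negPn/negP => Zd0.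
have d0S : d0 \in S by apply: contraNT Zd0 => /ZS ->.
have /[!inE] /andP[fs /eqP fst] := subsetP sS _ d0S.
have [x0 x0E] := labelled_cell fs.
have [y0 y0E] : exists y : Q, cell_of y = etgt d0.
  by apply: labelled_cell; rewrite -fst.
pose S' := S :\ d0.
have S'lab d : d \in S' -> f (esrc d) = f (etgt d).
  by rewrite !inE => /andP[_ dS]; have /[!inE] /andP[_ /eqP] := subsetP sS _ dS.
have ncon : ~~ connect (srel S') x0 y0.
  apply/negP => con.
  suff /minS : spans S' by move=> /(_ (subsetDl _ _)) SS; move: d0S; rewrite -SS !inE eqxx.
  apply/forallP => x; apply/forallP => y; apply/implyP => fx; apply/implyP => fxy.
  have /forallP/(_ x)/forallP/(_ y)/implyP/(_ fx)/implyP/(_ fxy) := spS.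
  suff sub : subrel (srel S) (connect (srel S')) by apply: connect_sub.
  move=> {fx fxy} {}x {}y /existsP[d /andP[dS dxy]].
  have [dd0|nd] := eqVneq d d0; last first.
    by apply: connect1; apply/existsP; exists d; rewrite dxy !inE nd dS.
  move: dxy; rewrite dd0 -x0E -y0E; case/orP=> /andP[/eqP/cell_of_inj <- /eqP/cell_of_inj <-] //.
  by rewrite connect_srelC.
pose A := [set x | connect (srel S') x0 x].
have Alab x : x \in A -> f (cell_of x).
  rewrite inE => con.
  suff <- : f (cell_of x0) = f (cell_of x) by rewrite x0E.
  apply: (connect_const (h := fun x => f (cell_of x))) con => {}x y /existsP[d /andP[/S'lab dl]].
  by case/orP=> /andP[/eqP <- /eqP <-].
have AS' d : d \in S' ->
    [exists x in A, esrc d == cell_of x] = [exists x in A, etgt d == cell_of x].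
  move=> dS'; have /[!inE] /andP[_ dS] := dS'.
  have /[!inE] /andP[fd /eqP fdd] := subsetP sS _ dS.
  have [x xE] := labelled_cell fd.
  have [y yE] : exists y : Q, cell_of y = etgt d by apply: labelled_cell; rewrite -fdd.
  have xy : connect (srel S') x y.
    by apply: connect1; apply/existsP; exists d; rewrite dS' xE yE !eqxx.
  apply/idP/idP => /existsP[z /andP[zA zE]]; apply/existsP.
    exists y; rewrite yE eqxx andbT inE; move: zE; rewrite -xE => /eqP/cell_of_inj zx.
    by move: zA; rewrite inE -zx => /connect_trans; apply.
  exists x; rewrite xE eqxx andbT inE; move: zE; rewrite -yE => /eqP/cell_of_inj zx.
  by move: zA; rewrite inE -zx => /connect_trans; apply; rewrite connect_srelC.
have := sum_boundary Z A.
rewrite big1 => [|x /Alab/Zev //]; rewrite (bigD1 d0) //= big1 => [|d dn]; last first.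
  have [dS|dS] := boolP (d \in S); last by rewrite ZS // mul0r.
  by rewrite AS' ?addF2 ?mulr0 // !inE dn dS.
have -> : [exists x in A, esrc d0 == cell_of x].
  by apply/existsP; exists x0; rewrite inE connect0 x0E eqxx.
have -> : [exists x in A, etgt d0 == cell_of x] = false.
  apply: contraNF ncon => /existsP[y /andP[yA /eqP ty]]; move: yA; rewrite inE.
  by rewrite -(cell_of_inj (etrans y0E ty)).
by rewrite !addr0 mulr1 => /esym/eqP; rewrite (negPf Zd0).
Qed.

Context (f_adj : forall a b, a != b -> [set a; b] \in E ->
  exists p q, [/\ f p = Some a, f q = Some b & gadj p q]).
Context (E_simple : forall e, e \in E -> #|e| == 2).

Definition connects (e : {set V}) (d : D) : Prop :=
  exists a b, [/\ e = [set a; b], a != b, f (esrc d) = Some a & f (etgt d) = Some b].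

Lemma connector_exists e : e \in E -> exists d, connects e d.
Proof.
move=> eE; have /cards2P[a [b [ab eab]]] := E_simple eE.
have [p [q [fp fq pq]]] : exists p q, [/\ f p = Some a, f q = Some b & gadj p q].
  by apply: f_adj => //; rewrite -eab.
have [x xE] : exists x : Q, cell_of x = p by apply: labelled_cell; rewrite fp.
have [y yE] : exists y : Q, cell_of y = q by apply: labelled_cell; rewrite fq.
have [d] : exists d : D, (esrc d == cell_of x) && (etgt d == cell_of y) ||
  (esrc d == cell_of y) && (etgt d == cell_of x) by apply: gadj_edge; rewrite xE yE.
rewrite xE yE; case/orP=> /andP[/eqP sE /eqP tE]; exists d.
  by exists a, b; rewrite sE tE.
by exists b, a; rewrite sE tE eq_sym setUC.
Qed.

Context (d00 : D).

(** The branch sets are thinned to forests [S] and one connecting grid edge [k e] is kept for each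
    edge; faces are the classes of squares left by these grid edges. The three claims: face
    boundaries are cycles; every cycle is a sum of face boundaries; the constants are the only
    relations among face boundaries. *)
Lemma faces_of_model : exists (S : {set D}) (k : {set V} -> D),
  [/\ S \subset inner_edges, spans S & forall e, e \in E -> connects e (k e)] /\
  (let rt q := fingraph.root (drel (S :|: k @: E)) q in
   let l e := rt (eleft (k e)) in let r e := rt (eright (k e)) in
   [/\ forall phi a, \sum_(e in E | a \in e) ((l e == phi)%:R + (r e == phi)%:R) = 0 :> 'F_2,
       forall Z : {set V} -> 'F_2, (forall a, \sum_(e in E | a \in e) Z e = 0) ->
         exists chi : Q -> 'F_2, forall e, e \in E -> Z e = chi (l e) + chi (r e) &
       forall chi : Q -> 'F_2, (forall e, e \in E -> chi (l e) = chi (r e)) ->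
         forall q q', chi (rt q) = chi (rt q')]).
Proof.
have [S [sS spS thinS]] := thin_span.
have [k kP] : exists k : {set V} -> D, forall e, e \in E -> connects e (k e).
  have H e : exists d, e \in E -> connects e d.
    have [eE|_] := boolP (e \in E); last by exists d00.
    by have [d dP] := connector_exists eE; exists d.
  by have [k kP] := fin_all_exists H; exists k.
exists S, k; split=> //.
set T := _ :|: _ => rt l r.
have kS e : e \in E -> k e \notin S.
  move=> /kP[a [b [_ ab fa fb]]]; apply/negP => /(subsetP sS) /[!inE].
  by rewrite fa fb => /eqP[abE]; rewrite abE eqxx in ab.
have k_inj : {in E &, injective k}.
  move=> e e' /kP[a [b [-> _ fa fb]]] /kP[c [g [-> _ fc fg]]] kk.
  by move: fa fb; rewrite kk fc fg => -[->] [->].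
have Tlab d : d \in T -> f (esrc d) && f (etgt d).
  rewrite inE; case/orP=> [/(subsetP sS)|/imsetP[e eE ->]].
    by rewrite inE => /andP[fs /eqP <-]; rewrite fs.
  by have [a [b [_ _ -> ->]]] := kP _ eE.
have rt_const (chi : Q -> 'F_2) d : d \notin T -> chi (rt (eleft d)) = chi (rt (eright d)).
  move=> dT; congr chi; apply/fingraph.rootP; first exact: connect_drelC.
  by apply: connect1; apply/existsP; exists d; rewrite dT !eqxx.
(* Summed over the branch set of [a], forest edges cancel and only the connectors of the edges at
   [a] remain. *)
have inc (Z : D -> 'F_2) a : (forall d, d \notin T -> Z d = 0) ->
    \sum_(x in [set x : Q | f (cell_of x) == Some a]) boundary Z (cell_of x) =
    \sum_(e in E | a \in e) Z (k e).
  move=> ZT; rewrite sum_boundary.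
  have inA p : [exists x in [set x : Q | f (cell_of x) == Some a], p == cell_of x] =
      (f p == Some a).
    apply/existsP/eqP => [[x /andP[/[!inE] /eqP <- /eqP ->]] //|fp].
    have [x xE] : exists x : Q, cell_of x = p by apply: labelled_cell; rewrite fp.
    by exists x; rewrite inE xE fp !eqxx.
  under eq_bigr do rewrite !inA.
  rewrite (bigID (mem T)) /= [X in _ + X]big1 ?addr0 => [|d dT]; last by rewrite ZT ?mul0r.
  rewrite (bigID (mem S)) /= big1 ?add0r => [|d /andP[_ /(subsetP sS)]]; last first.
    by rewrite inE => /andP[_ /eqP ->]; rewrite addF2 mulr0.
  rewrite (eq_bigl (mem (k @: E))) => [|d /=]; last first.
    rewrite /T in_setU; have [dS|dS] /= := boolP (d \in S); last by rewrite andbT.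
    by apply/esym/negP => /imsetP[e /kS kk dk]; rewrite -dk dS in kk.
  rewrite big_imset //= big_mkcondr; apply: eq_bigr => e eE.
  have [b [c [-> bc -> ->]]] := kP _ eE.
  rewrite !inE !(inj_eq Some_inj) eq_sym [c == a]eq_sym.
  have [ab|ab] := eqVneq a b; have [ac|ac] := eqVneq a c => /=;
    rewrite ?addr0 ?add0r ?mulr1 ?mulr0 //.
  by rewrite -ab -ac eqxx in bc.
have co_off (chi : Q -> 'F_2) d : d \notin T ->
    chi (rt (eleft d)) + chi (rt (eright d)) = 0.
  by move=> dT; rewrite (rt_const chi d dT) addF2.
split.
- move=> phi a.
  rewrite -(inc (fun d => (rt (eleft d) == phi)%:R + (rt (eright d) == phi)%:R)); last first.
    exact: (co_off (fun q => (q == phi)%:R)).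
  rewrite big1 // => x; rewrite inE => /eqP fx.
  apply: (coboundary_even (fun q => (rt q == phi)%:R)); apply: f_supp.
  by rewrite fx.
- move=> Z Zev.
  pose rS := fingraph.root (srel S).
  have [cc ccP] : exists cc : Q -> D -> 'F_2, forall x : Q,
      (forall d, d \notin S -> cc x d = 0) /\
      forall w, boundary (cc x) w = (cell_of x == w)%:R + (cell_of (rS x) == w)%:R.
    apply: (fin_all_exists (P := fun (x : Q) (c : D -> 'F_2) =>
      (forall d, d \notin S -> c d = 0) /\
      forall w, boundary c w = (cell_of x == w)%:R + (cell_of (rS x) == w)%:R)) => x.
    by apply: connect_chain; exact: connect_root.
  have [sx sxP] : exists sx : {set V} -> Q, forall e, e \in E -> cell_of (sx e) = esrc (k e).
    by exists (fun e => (k e).2).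
  have [tx txP] : exists tx : {set V} -> Q, forall e, e \in E -> cell_of (tx e) = etgt (k e).
    apply: (fin_all_exists (P := fun e x => e \in E -> cell_of x = etgt (k e))) => e.
    have [eE|_] := boolP (e \in E); last by exists d00.2.
    have [a [b [_ _ _ fb]]] := kP _ eE.
    by have [x xE] : exists x : Q, cell_of x = etgt (k e);
      [apply: labelled_cell; rewrite fb|exists x].
  (* Lift [Z] to grid edges: each connector is completed by forest paths from its ends to the roots
     of their trees. The boundary can then be nonzero only at a root, where it is the parity of [Z]
     at the vertex labelling it. *)
  pose Z' d := \sum_(e in E) Z e * ((d == k e)%:R + (cc (sx e) d + cc (tx e) d)).
  have Z'T d : d \notin T -> Z' d = 0.
    rewrite inE negb_or => /andP[dS dk]; apply: big1 => e eE.
    rewrite (ccP _).1 // (ccP _).1 //; case: eqP dk => [->|_ _]; last by rewrite !addr0 mulr0.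
    by rewrite imset_f.
  have Z'k e : e \in E -> Z' (k e) = Z e.
    move=> eE; rewrite /Z' (bigD1 e) //= eqxx (ccP _).1 ?kS // (ccP _).1 ?kS //.
    rewrite !addr0 mulr1 big1 ?addr0 // => e' /andP[e'E ne].
    rewrite (ccP _).1 ?kS // (ccP _).1 ?kS // !addr0.
    case: eqP => [/k_inj|]; last by rewrite mulr0.
    by move=> /(_ eE e'E) ee; rewrite ee eqxx in ne.
  have Z'b (x : Q) : boundary Z' (cell_of x) =
      \sum_(e in E) Z e * ((rS (sx e) == x)%:R + (rS (tx e) == x)%:R).
    rewrite /Z' boundary_sum; apply: eq_bigr => e eE; congr (_ * _).
    rewrite !boundaryD boundary_delta !(ccP _).2 -sxP // -txP //.
    rewrite !(inj_eq (@cell_of_inj _)).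
    set a := (_ == _)%:R; set b := (_ == _)%:R; set c := (_ == _)%:R; set g := (_ == _)%:R.
    have -> : a + b + (a + c + (b + g)) = (a + a) + (b + b) + (c + g) by ring.
    by rewrite !addF2 !add0r.
  have rSlab x y : rS x = y -> f (cell_of x) = f (cell_of y).
    move=> <-; apply: (connect_const (h := fun x => f (cell_of x))) (connect_root _ x) => {}x {}y /existsP[d /andP[]].
    move=> /(subsetP sS)/[!inE] /andP[_ /eqP dl].
    by case/orP=> /andP[/eqP <- /eqP <-].
  have Z'ev w : (0 < w.1 < N)%N && (0 < w.2 < N)%N -> boundary Z' w = 0.
    case: w => i j /= /andP[/andP[_ iN] /andP[_ jN]].
    pose x : Q := (Ordinal iN, Ordinal jN).
    rewrite -[(i, j)]/(cell_of x) Z'b.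
    have [rx|nrx] := eqVneq (rS x) x; last first.
      have nr y : (rS y == x) = false.
        apply/negP => /eqP ryx; move: nrx; rewrite -ryx.
        by rewrite /rS root_root ?eqxx //; exact: connect_srelC.
      by apply: big1 => e _; rewrite !nr addr0 mulr0.
    case fx : (f (cell_of x)) => [a|]; last first.
      apply: big1 => e eE; have [b [c [_ _ fb fc]]] := kP _ eE.
      case: eqP => [/rSlab|_]; first by rewrite sxP // fb fx.
      case: eqP => [/rSlab|_]; first by rewrite txP // fc fx.
      by rewrite addr0 mulr0.
    transitivity (\sum_(e in E | a \in e) Z e); last exact: Zev.
    rewrite [RHS]big_mkcondr; apply: eq_bigr => e eE.
    have [b [c [ee bc fb fc]]] := kP _ eE.
    have rSE y : (rS y == x) = (f (cell_of y) == Some a).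
      apply/eqP/eqP => [/rSlab ->//|fy]; rewrite -rx; apply/fingraph.rootP; first exact: connect_srelC.
      have /forallP/(_ y)/forallP/(_ x) := spS.
      by rewrite fy fx eqxx.
    rewrite (rSE (sx e)) (rSE (tx e)) (sxP _ eE) (txP _ eE) fb fc.
    have -> : (a \in e) = (a == b) || (a == c) by rewrite ee !inE.
    rewrite !(inj_eq Some_inj) eq_sym [c == a]eq_sym.
    have [ab|ab] := eqVneq a b; have [ac|ac] := eqVneq a c => /=;
      rewrite ?addr0 ?add0r ?mulr1 ?mulr0 //.
    by rewrite -ab -ac eqxx in bc.
  have Z'0 (d : D) : (d.2.1 == 0%N :> nat) || (d.2.2 == 0%N :> nat) -> Z' d = 0.
    move=> d0; apply: Z'T; apply/negP => /Tlab /andP[/f_supp] /=.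
    by case/orP: d0 => /eqP ->; rewrite ?ltnn ?andbF.
  have [chi chiE] := even_coboundary Z'0 Z'ev.
  exists chi => e eE.
  have chi_rt q : chi (rt q) = chi q.
    apply/esym; apply: (connect_const (h := chi)) (connect_root _ q) => {}q q' /existsP[d /andP[dT]].
    have := chiE d; rewrite Z'T // => /esym/eqP; rewrite addr_eq0.
    have oppF2 (u : 'F_2) : - u = u by apply/eqP; rewrite eq_sym -subr_eq0 opprK addF2.
    by rewrite oppF2 => /eqP dd /orP[] /andP[/eqP <- /eqP <-].
  by rewrite /l /r !chi_rt -chiE Z'k.
- move=> chi chiE.
  pose Z d := chi (rt (eleft d)) + chi (rt (eright d)).
  (* This coboundary is even and lives on the forest [S], hence vanishes; so [chi] does not change
     across any grid edge. *)
  have Z0 d : Z d = 0.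
    apply: thinS => [{}d dS|x fx]; last by apply: (coboundary_even (chi \o rt)); exact: f_supp.
    have [dT|dT] := boolP (d \in T); last exact: co_off.
    move: dT; rewrite inE (negPf dS) /= => /imsetP[e eE ->].
    by rewrite /Z [chi _]chiE // addF2.
  apply: (locally_const (chi := chi \o rt)) => d /=.
  have /eqP := Z0 d; rewrite /Z addr_eq0 => /eqP ->.
  by apply/eqP; rewrite eq_sym -subr_eq0 opprK addF2.
Qed.

End GridModel.

Lemma set2_inj (T : finType) (a b c d : T) : [set a; b] = [set c; d] ->
  (a = c /\ b = d) \/ (a = d /\ b = c).
Proof.
move=> eq2.
have ha : a \in [set c; d] by rewrite -eq2 !inE eqxx.
have hb : b \in [set c; d] by rewrite -eq2 !inE eqxx orbT.
have hc : c \in [set a; b] by rewrite eq2 !inE eqxx.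
have hd : d \in [set a; b] by rewrite eq2 !inE eqxx orbT.
case/set2P: ha => ea; case/set2P: hb => eb; case/set2P: hc => ec;
  case/set2P: hd => ed; subst; auto.
Qed.

(* The 1-subdivision of E, the vertex subdividing e being inr (Some e),  *)
(* together with an extra vertex inr None joined to the ends of the edges *)
(* of E that satisfy P.                                                   *)
Definition sd_plus (V : finType) (E : {set {set V}}) (P : pred {set V}) :
    {set {set V + option {set V}}} :=
  [set s | [exists a, [exists e in E, (a \in e) &&
     ((s == [set inl a; inr (Some e)]) || P e && (s == [set inl a; inr None]))]]].

(** * Refining the grid fourfold, to make room for a vertex inside a face *)

Section Refine.
Context (V : finType) (E : {set {set V}}) (N : nat) (f : cell -> option V).
Context (f_supp : forall p, f p -> (0 < p.1 < N) && (0 < p.2 < N)).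
Notation Q := ('I_N * 'I_N)%type.
Notation D := (bool * Q)%type.
Context (S : {set D}) (k : {set V} -> D).
Context (S_inner : S \subset inner_edges N f) (S_spans : spans f S).
Context (kP : forall e, e \in E -> connects f e (k e)).
Let T := S :|: k @: E.
Let rt q := fingraph.root (drel T) q.
Context (phi : Q).
Notation W := (V + option {set V})%type.
Let z : W := inr None.

Definition region (i j : nat) : bool :=
  [exists q : Q, (cell_of q == (i, j)) && (rt q == phi)].
Definition edge_in (A : {set D}) (b : bool) (i j : nat) : bool :=
  [exists d in A, (d.1 == b) && (esrc d == (i, j))].
Definition next (b : bool) (i j : nat) : cell := if b then (i.+1, j) else (i, j.+1).
Definition square_label (i j : nat) : option W := if region i j then Some z else None.
Definition middle_label (oa ob : option V) : option W :=
  if oa is Some a then if ob is Some b then Some (inr (Some [set a; b])) else None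
  else None.
(** A grid edge acquires three inner cells [u = 1, 2, 3]. On a connector the middle one subdivides
    the edge and the outer ones prolong the branch sets of its ends. A cell on an edge that is not
    drawn goes with the square on its left, which lies in the same face as the one on its right. *)
Definition edge_label (b : bool) (i j u : nat) : option W :=
  if edge_in S b i j then omap inl (f (i, j))
  else if edge_in (k @: E) b i j then
    if u == 1 then omap inl (f (i, j))
    else if u == 2 then middle_label (f (i, j)) (f (next b i j))
    else omap inl (f (next b i j))
  else square_label i j.
Definition base_label (i j : nat) : option W :=
  if f (i, j) is Some a then Some (inl a) else square_label i j.
Definition refined (p : cell) : option W :=
  if (0 < p.1) && (0 < p.2) then
    let i := p.1 %/ 4 in let j := p.2 %/ 4 in
    if p.2 %% 4 == 0 then
      if p.1 %% 4 == 0 then base_label i j else edge_label true i j (p.1 %% 4)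
    else if p.1 %% 4 == 0 then edge_label false i j (p.2 %% 4)
    else square_label i j
  else None.

Definition base (i j : nat) : cell := (4 * i, 4 * j).
Definition onedge (b : bool) (i j u : nat) : cell :=
  if b then (4 * i + u, 4 * j) else (4 * i, 4 * j + u).
Definition inside (b : bool) (i j u v : nat) : cell :=
  if b then (4 * i + u, 4 * j + v) else (4 * i + v, 4 * j + u).

Let divmod4 i u : u < 4 -> ((4 * i + u) %/ 4 = i) * ((4 * i + u) %% 4 = u).
Proof. by move=> u4; split; lia. Qed.

Lemma refined_base i j : 0 < i -> 0 < j -> refined (base i j) = base_label i j.
Proof.
move=> i0 j0; rewrite /refined /base /=.
by rewrite !muln_gt0 i0 j0 /= !modnMr !mulKn.
Qed.

Lemma refined_edge b i j u : 0 < u < 4 -> (if b then 0 < j else 0 < i) ->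
  refined (onedge b i j u) = edge_label b i j u.
Proof.
move=> u4 pos; have u4' : u < 4 by lia.
have nu : (u == 0) = false by lia.
rewrite /refined /onedge; case: b pos => pos /=.
  rewrite (divmod4 i u4') modnMr mulKn // (divmod4 i u4') eqxx nu.
  by rewrite ifT //; lia.
rewrite (divmod4 j u4') modnMr mulKn // (divmod4 j u4') eqxx nu.
by rewrite ifT //; lia.
Qed.

Lemma refined_inside b i j u v : 0 < u < 4 -> 0 < v < 4 ->
  refined (inside b i j u v) = square_label i j.
Proof.
move=> u4 v4; have u4' : u < 4 by lia.
have v4' : v < 4 by lia.
have nu : (u == 0) = false by lia.
have nv : (v == 0) = false by lia.
rewrite /refined /inside; case: b => /=.
  rewrite !(divmod4 i u4') !(divmod4 j v4') nu nv.
  by rewrite ifT //; lia.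
rewrite !(divmod4 i v4') !(divmod4 j u4') nu nv.
by rewrite ifT //; lia.
Qed.

Variant refined_spec (p : cell) (w : W) : Prop :=
| RefBase i j of p = base i j & base_label i j = Some w & 0 < i & 0 < j
| RefEdge b i j u of p = onedge b i j u & edge_label b i j u = Some w & 0 < u < 4
    & (if b then 0 < j else 0 < i)
| RefSquare i j u v of p = inside true i j u v & square_label i j = Some w &
    0 < u < 4 & 0 < v < 4.

Lemma refinedP p w : refined p = Some w -> refined_spec p w.
Proof.
rewrite /refined; case: ifP => // /andP[p1 p2].
have e1 := divn_eq p.1 4; have e2 := divn_eq p.2 4.
have m1 : p.1 %% 4 < 4 by rewrite ltn_mod.
have m2 : p.2 %% 4 < 4 by rewrite ltn_mod.
case: eqP => [v0|v0]; case: eqP => [u0|u0] H.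
- apply: RefBase H _ _; last 2 first; try lia.
  by rewrite [p]surjective_pairing /base; congr (_, _); lia.
- apply: RefEdge H _ _; last 2 first; try lia.
  by rewrite [p]surjective_pairing /onedge; congr (_, _); lia.
- apply: RefEdge H _ _; last 2 first; try lia.
  by rewrite [p]surjective_pairing /onedge; congr (_, _); lia.
- apply: (@RefSquare _ _ (p.1 %/ 4) (p.2 %/ 4) (p.1 %% 4) (p.2 %% 4)) => //; try lia.
  by rewrite [p]surjective_pairing /inside; congr (_, _); lia.
Qed.

Lemma S_labels b i j : edge_in S b i j ->
  exists2 a, f (i, j) = Some a & f (next b i j) = Some a.
Proof.
case/existsP=> d /andP[dS /andP[/eqP bE /eqP dE]].
have := subsetP S_inner _ dS; rewrite inE dE => /andP[].
case: (f (i, j)) => //= a _ /eqP fb; exists a => //.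
by rewrite fb -bE; case: dE => <- <-; rewrite /etgt /next; case: d.1.
Qed.

Lemma K_labels b i j : edge_in (k @: E) b i j ->
  exists a c, [/\ [set a; c] \in E, a != c, f (i, j) = Some a, f (next b i j) = Some c &
    esrc (k [set a; c]) = (i, j) /\ (k [set a; c]).1 = b].
Proof.
case/existsP=> d /andP[/imsetP[e eE ->] /andP[/eqP bE /eqP dE]].
have [a [c [ee ac fa fc]]] := kP eE.
exists a, c; rewrite -ee; split=> //; first by rewrite -dE.
by rewrite -fc -bE /etgt /next; case: dE => <- <-; case: (k e).1.
Qed.

Lemma K_notS e : e \in E -> edge_in S (k e).1 (k e).2.1 (k e).2.2 = false.
Proof.
move=> eE; apply/negbTE/negP => /S_labels[a fa fb].
have [b [c [_ bc fb' fc']]] := kP eE.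
move: fb' fc'; rewrite /esrc /cell_of fa /etgt => -[ab].
move: fb; rewrite /next; case: (k e).1 => -> -[ac]; by rewrite -ab -ac eqxx in bc.
Qed.

Lemma K_in e : e \in E -> edge_in (k @: E) (k e).1 (k e).2.1 (k e).2.2.
Proof.
by move=> eE; apply/existsP; exists (k e); rewrite imset_f //= /esrc /cell_of !eqxx.
Qed.

Lemma label_pos i j : f (i, j) -> 0 < i /\ 0 < j.
Proof. by move/f_supp => /=; lia. Qed.

Lemma regionP i j : region i j -> exists2 q : Q, cell_of q = (i, j) & rt q = phi.
Proof. by case/existsP=> q /andP[/eqP qE /eqP rq]; exists q. Qed.

Let onclass w := [pred c | refined c == Some w].

Lemma label_hub a p : refined p = Some (inl a) -> exists i j,
  f (i, j) = Some a /\ walk (onclass (inl a)) p (base i j).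
Proof.
have sqN i j : square_label i j = Some (inl a) -> False.
  by rewrite /square_label; case: ifP.
have baseP i j : f (i, j) = Some a -> onclass (inl a) (base i j).
  move=> fa; have [i0 j0] : 0 < i /\ 0 < j by apply: label_pos; rewrite fa.
  by rewrite /= refined_base // /base_label fa.
move=> rp; case: (refinedP rp) => [i j pE|b i j u pE|i j u v _ /sqN //].
  rewrite /base_label; case fa : (f (i, j)) => [a'|]; last by move/sqN.
  case=> aa _ _; rewrite -{}aa in rp *; exists i, j; split=> //.
  by rewrite pE; apply: walk_refl; rewrite /= -pE; apply/eqP.
move=> el u4 pos; have := el; rewrite /edge_label.
have [inS|notS] := boolP (edge_in S b i j).
  have [a' fa _] := S_labels inS; rewrite fa => -[aa].
  have {}fa : f (i, j) = Some a by rewrite fa aa.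
  exists i, j; split=> //; rewrite pE.
  have walku m : m < 4 -> walk (onclass (inl a)) (onedge b i j m) (base i j).
    elim: m => [|m IH] m4.
      have -> : onedge b i j 0 = base i j by case: (b); rewrite /onedge ?addn0.
      by apply: walk_refl; exact: baseP.
    apply: walk_step (IH _); last by lia.
      rewrite /= refined_edge //.
      by rewrite /edge_label inS fa.
    by rewrite /gadj /onedge; case: (b) => /=; lia.
  by apply: walku; lia.
have [inK|_] := boolP (edge_in (k @: E) b i j); last by move/sqN.
have [a1 [c [eE ac fa fc _]]] := K_labels inK.
rewrite fa fc /=; case: eqP => [u1 [aa]|u1].
  exists i, j; rewrite -aa; split=> //; rewrite pE; apply: walk1.
  - by rewrite /= -pE rp aa.
  - by rewrite -aa in baseP; exact: (baseP _ _ fa).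
  - by rewrite u1 /gadj /onedge /base; case: (b) => /=; lia.
case: eqP => // u2 [cc].
exists (next b i j).1, (next b i j).2; rewrite -surjective_pairing -cc.
split=> //; rewrite pE; apply: walk1.
- by rewrite /= -pE rp cc.
- by rewrite -cc in baseP; apply: baseP; rewrite -surjective_pairing.
- by have u3 : u = 3 by [lia]; rewrite u3 /gadj /onedge /base /next; case: (b) => /=; lia.
Qed.

(** By [label_hub] only coarse cells have to be joined; a path of forest edges between them refines
    to a walk, since all inner cells of an edge of [S] carry the label. *)
Lemma label_connected a p q : refined p = Some (inl a) -> refined q = Some (inl a) ->
  walk (onclass (inl a)) p q.
Proof.
move=> /label_hub[i [j [fa wp]]] /label_hub[i' [j' [fa' wq]]].
apply: walk_trans wp (walk_trans _ (walk_sym wq)).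
have cellP x y : f (x, y) = Some a -> exists s : Q, cell_of s = (x, y).
  by move=> fx; apply: (labelled_cell f_supp); rewrite fx.
have [x xE] := cellP _ _ fa; have [y yE] := cellP _ _ fa'.
have con : connect (srel S) x y.
  by have /forallP/(_ x)/forallP/(_ y) := S_spans; rewrite xE yE fa fa' eqxx.
have baseP i1 j1 : f (i1, j1) = Some a -> onclass (inl a) (base i1 j1).
  move=> fi; have [i0 j0] : 0 < i1 /\ 0 < j1 by apply: label_pos; rewrite fi.
  by rewrite /= refined_base // /base_label fi.
have edgeW b i1 j1 : edge_in S b i1 j1 -> f (i1, j1) = Some a ->
    walk (onclass (inl a)) (base i1 j1) (base (next b i1 j1).1 (next b i1 j1).2).
  move=> eS fi; have [a' fi' fn] := S_labels eS; rewrite fi in fi'; case: fi' => aa.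
  rewrite -aa in fn.
  have [i0 j0] : 0 < i1 /\ 0 < j1 by apply: label_pos; rewrite fi.
  have on u : 0 < u < 4 -> onclass (inl a) (onedge b i1 j1 u).
    move=> u4; rewrite /= refined_edge //; last by case: (b).
    by rewrite /edge_label eS fi.
  apply: (@walk_step _ _ (onedge b i1 j1 1)); first exact: baseP.
    by rewrite /gadj /onedge /base; case: (b) => /=; lia.
  apply: (@walk_step _ _ (onedge b i1 j1 2)); first exact: on.
    by rewrite /gadj /onedge /base; case: (b) => /=; lia.
  apply: (@walk_step _ _ (onedge b i1 j1 3)); first exact: on.
    by rewrite /gadj /onedge /base; case: (b) => /=; lia.
  apply: walk1; first exact: on.
    by apply: baseP; rewrite -surjective_pairing.
  by rewrite /gadj /onedge /base /next; case: (b) => /=; lia.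
have -> : base i j = base x.1 x.2 by case: xE => <- <-.
have -> : base i' j' = base y.1 y.2 by case: yE => <- <-.
have {}fa : f (cell_of x) = Some a by rewrite xE.
case/connectP: con => pt; elim: pt x fa {xE} => [|s pt IH] x fx.
  by move=> _ ->; apply: walk_refl; exact: baseP.
case/andP=> /existsP[d /andP[dS dxs]] spt yl.
have eS : edge_in S d.1 d.2.1 d.2.2.
  by apply/existsP; exists d; rewrite dS /esrc /cell_of !eqxx.
have nE : next d.1 d.2.1 d.2.2 = etgt d by [].
have [a' fs ft] := S_labels eS; rewrite nE in ft.
case/orP: dxs => /andP[/eqP sE /eqP tE].
  have {}fs : f (cell_of s) = Some a.
    by rewrite -tE ft -fs -[(_, _)]/(esrc d) sE.
  apply: walk_trans (IH s fs spt yl).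
  have := edgeW _ _ _ eS; rewrite nE tE -[((d.2).1 : nat, _)]/(esrc d) sE => /(_ fx).
  by rewrite /esrc in sE; rewrite (cell_of_inj sE).
have {}fs : f (cell_of s) = Some a.
  by rewrite -sE -[esrc d]/((d.2).1 : nat, (d.2).2 : nat) fs -ft tE.
apply: walk_trans (IH s fs spt yl); apply: walk_sym.
have := edgeW _ _ _ eS; rewrite nE tE -[((d.2).1 : nat, _)]/(esrc d) sE => /(_ fs).
by rewrite /esrc in sE; rewrite (cell_of_inj sE).
Qed.

(** The middle of the connector [k e] is the only cell with this label. *)
Lemma middle_connected e p q :
  refined p = Some (inr (Some e)) -> refined q = Some (inr (Some e)) -> p = q.
Proof.
have sqN i j : square_label i j = Some (inr (Some e)) -> False.
  by rewrite /square_label; case: ifP.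
have main r : refined r = Some (inr (Some e)) ->
    r = onedge (k e).1 (k e).2.1 (k e).2.2 2.
  move=> rr; case: (refinedP rr) => [i j _|b i j u rE|i j u v _ /sqN //].
    by rewrite /base_label; case: (f (i, j)) => // /sqN.
  move=> el u4 _; move: el; rewrite /edge_label.
  have [/S_labels[a -> _] //|_] := boolP (edge_in S b i j).
  have [inK|_] := boolP (edge_in (k @: E) b i j); last by move/sqN.
  have [a1 [c [eE ac fa fc [kE bE]]]] := K_labels inK.
  rewrite fa fc /=; do 2![case: eqP => // ?].
  move=> [ee]; rewrite -ee bE rE; case: kE => -> ->; congr onedge; lia.
by move=> /main -> /main ->.
Qed.

Lemma square_hub p : refined p = Some z -> exists i j,
  region i j /\ walk (onclass z) p (inside true i j 1 1).
Proof.
have sqP i j : square_label i j = Some z -> region i j.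
  by rewrite /square_label; case: ifP.
have insP b i j u v : region i j -> 0 < u < 4 -> 0 < v < 4 -> onclass z (inside b i j u v).
  by move=> rij u4 v4; rewrite /= refined_inside // /square_label rij.
have walkv i j u v : region i j -> 0 < u < 4 -> 0 < v < 4 ->
    walk (onclass z) (inside true i j u v) (inside true i j 1 1).
  move=> rij; elim: u v => [//|u IHu] v u4 v4.
  have [u0|u0] := posnP u; last first.
    apply: walk_step (IHu v _ _) => //; [exact: insP| |by lia].
    by rewrite /gadj /inside /=; lia.
  rewrite u0; elim: v v4 => [//|v IHv] v4.
  have [v0|v0] := posnP v; first by rewrite v0; apply: walk_refl; exact: insP.
  apply: walk_step (IHv _); [exact: insP| |by lia].
  by rewrite /gadj /inside /=; lia.
have edgeW b i j u : region i j -> refined (onedge b i j u) = Some z -> 0 < u < 4 ->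
    walk (onclass z) (onedge b i j u) (inside true i j 1 1).
  move=> rij rp u4; apply: (@walk_step _ _ (inside b i j u 1)); first by rewrite /= rp.
    by rewrite /gadj /onedge /inside; case: (b) => /=; lia.
  case: b {rp}; first exact: walkv.
  by rewrite -[inside false i j u 1]/(inside true i j 1 u); apply: walkv.
move=> rp; case: (refinedP rp) => [i j pE|b i j u pE|i j u v pE /sqP rij u4 v4].
- rewrite /base_label; case fij : (f (i, j)) => [//|] /sqP rij i0 j0.
  exists i, j; split=> //.
  have r1 : refined (onedge true i j 1) = Some z.
    rewrite refined_edge // /edge_label.
    case: ifP => [/S_labels[a]|_]; first by rewrite fij.
    case: ifP => [/K_labels[a [c [_ _]]]|_]; first by rewrite fij.
    by rewrite /square_label rij.
  apply: walk_step (edgeW _ _ _ _ rij r1 _) => //; first by rewrite /= rp.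
  by rewrite pE /gadj /onedge /base /=; lia.
- move=> el u4 pos; have rij : region i j.
    move: el; rewrite /edge_label.
    case: ifP => [/S_labels[a -> _] //|_].
    case: ifP => [/K_labels[a [c [_ _ -> -> _]]]|_]; last exact: sqP.
    by case: eqP => // _; case: eqP.
  by exists i, j; split=> //; rewrite pE; apply: edgeW => //; rewrite -pE.
- by exists i, j; split=> //; rewrite pE; exact: walkv.
Qed.

(** Neighbouring squares of the face are separated by a grid edge that is not drawn, and the walk
    passes through its first inner cell, which also belongs to the face. *)
Lemma square_connected p q : refined p = Some z -> refined q = Some z ->
  walk (onclass z) p q.
Proof.
move=> /square_hub[i [j [rij wp]]] /square_hub[i' [j' [rij' wq]]].
apply: walk_trans wp (walk_trans _ (walk_sym wq)).
have [x xE rx] := regionP rij; have [y yE ry] := regionP rij'.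
have -> : inside true i j 1 1 = inside true x.1 x.2 1 1 by case: xE => <- <-.
have -> : inside true i' j' 1 1 = inside true y.1 y.2 1 1 by case: yE => <- <-.
have regq s : rt s = phi -> region s.1 s.2.
  by move=> rs; apply/existsP; exists s; rewrite /cell_of !eqxx rs eqxx.
have insP b s u v : rt s = phi -> 0 < u < 4 -> 0 < v < 4 -> onclass z (inside b s.1 s.2 u v).
  by move=> /regq rs u4 v4; rewrite /= refined_inside // /square_label rs.
have con : connect (drel T) x y.
  by apply/(fingraph.rootP (@connect_drelC _ T)); rewrite -/(rt x) -/(rt y) rx ry.
have cross d : d \notin T -> rt (eleft d) = phi -> rt (eright d) = phi ->
    walk (onclass z) (inside true (eleft d).1 (eleft d).2 1 1)
                     (inside true (eright d).1 (eright d).2 1 1).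
  case: d => b [s t] dT rl rr.
  have [p0|p0] := boolP (if b then (t : nat) == 0 else (s : nat) == 0).
    have -> : eright (b, (s, t)) = eleft (b, (s, t)).
      rewrite /eleft /eright /=; case: (b) p0 => /eqP p0; congr (_, _);
        by apply: val_inj => /=; rewrite p0.
    by apply: walk_refl; exact: insP.
  have r1 : onclass z (onedge b s t 1).
    rewrite /= refined_edge //; last by case: (b) p0 => /=; lia.
    rewrite /edge_label.
    have notin (A : {set D}) : A \subset T -> edge_in A b s t = false.
      move=> AT; apply/negbTE/negP => /existsP[d /andP[dA /andP[/eqP db /eqP dE]]].
      have dst : d.2 = (s, t) by exact: cell_of_inj.
      move: dT; rewrite (_ : (b, (s, t)) = d) ?(subsetP AT) //.
      by rewrite (surjective_pairing d) db dst.
    rewrite !notin ?subsetUl ?subsetUr // /square_label.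
    by rewrite (_ : region s t) //; exact: (regq (s, t)).
  apply: (@walk_step _ _ (onedge b s t 1)); first exact: insP.
    by rewrite /gadj /onedge /inside /eleft; case: (b) => /=; lia.
  apply: (@walk_step _ _ (inside b (eright (b, (s, t))).1 (eright (b, (s, t))).2 1 3)) => //.
    by move: p0; rewrite /gadj /onedge /inside /eright; case: (b) => /=; lia.
  apply: (@walk_step _ _ (inside b (eright (b, (s, t))).1 (eright (b, (s, t))).2 1 2)).
  - exact: insP.
  - by rewrite /gadj /inside; case: (b) => /=; lia.
  apply: walk1; try exact: insP.
  by rewrite /gadj /inside; case: (b) => /=; lia.
case/connectP: con => pt; elim: pt x rx {xE} => [|s pt IH] x rx.
  by move=> _ ->; apply: walk_refl; exact: insP.
case/andP=> xs spt yl.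
have rs : rt s = phi.
  rewrite -rx; apply/esym/(fingraph.rootP (@connect_drelC _ T)); exact: connect1.
apply: walk_trans (IH s rs spt yl).
case/existsP: xs => d /andP[dT] /orP[] /andP[/eqP lE /eqP rE].
  by rewrite -lE -rE; apply: cross => //; rewrite ?lE ?rE.
by rewrite -lE -rE; apply: walk_sym; apply: cross => //; rewrite ?lE ?rE.
Qed.

Lemma refined_supp p : refined p -> (0 < p.1 < 4 * N) && (0 < p.2 < 4 * N).
Proof.
case rp : (refined p) => [w|//] _.
have pos : (0 < p.1) && (0 < p.2) by move: rp; rewrite /refined; case: ifP.
have regN i j : region i j -> i < N /\ j < N.
  by case/regionP=> -[s t] [<- <-] _; split; apply: ltn_ord.
have sqN i j w' : square_label i j = Some w' -> i < N /\ j < N.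
  by rewrite /square_label; case: ifP => // /regN.
have inN A b i j : edge_in A b i j -> i < N /\ j < N.
  by case/existsP=> -[b' [s t]] /andP[_ /andP[_ /eqP[<- <-]]]; split; apply: ltn_ord.
suff [i [j [iN jN]]] : exists i j, [/\ i < N, j < N, p.1 < 4 * i.+1 & p.2 < 4 * j.+1] by lia.
case: (refinedP rp) => [i j pE|b i j u pE|i j u v pE /sqN[iN jN] u4 v4].
- move=> bl i0 j0; exists i, j; rewrite pE /base /=.
  suff [iN jN] : i < N /\ j < N by split; lia.
  move: bl; rewrite /base_label; case fij : (f (i, j)) => [a|]; last by move/sqN.
  by have := f_supp (p := (i, j)); rewrite fij => /(_ isT) /=; lia.
- move=> el u4 _; exists i, j.
  suff [iN jN] : i < N /\ j < N by rewrite pE /onedge; case: (b) => /=; split; lia.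
  move: el; rewrite /edge_label; case: ifP => [/inN //|_].
  by case: ifP => [/inN //|_ /sqN].
- by exists i, j; rewrite pE /inside /=; split; lia.
Qed.

(** A connector on the border of the face has cells of the face next to both of its outer cells, so
    both ends of the edge become adjacent to the new vertex. *)
Lemma face_vertex :
  grid_minor (sd_plus E (fun e => (rt (eleft (k e)) == phi) || (rt (eright (k e)) == phi))).
Proof.
exists refined, (4 * N); split; first exact: refined_supp.
- move=> [a|[e|]] p q; [exact: label_connected| |exact: square_connected].
  by move=> rp rq; rewrite (middle_connected rp rq); apply: walk_refl; rewrite rq.
have main a e : e \in E -> a \in e -> exists p q,
    [/\ refined p = Some (inl a), refined q = Some (inr (Some e)) & gadj p q] /\
    ((rt (eleft (k e)) == phi) || (rt (eright (k e)) == phi) ->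
     exists2 r, refined r = Some z & gadj p r).
  move=> eE ae.
  have [b [c [ee bc fb fc]]] := kP eE.
  have nS := K_notS eE; have iK := K_in eE.
  case kE : (k e) fb fc nS iK => [d [i j]] fb fc nS iK; rewrite /= in nS iK.
  have {}fb : f (i : nat, j : nat) = Some b by [].
  have {}fc : f (next d i j) = Some c by [].
  have [i0 j0] : 0 < i /\ 0 < j by apply: label_pos; rewrite fb.
  have pos : if d then 0 < j else 0 < i by case: (d).
  have r1 : refined (onedge d i j 1) = Some (inl b).
    by rewrite refined_edge // /edge_label nS iK fb.
  have r2 : refined (onedge d i j 2) = Some (inr (Some e)).
    by rewrite refined_edge // /edge_label nS iK fb fc /= ee.
  have r3 : refined (onedge d i j 3) = Some (inl c).
    by rewrite refined_edge // /edge_label nS iK fc.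
  have rz (s : Q) (b' : bool) u v : 0 < u < 4 -> 0 < v < 4 -> rt s == phi ->
      refined (inside b' s.1 s.2 u v) = Some z.
    move=> u4 v4 rs; rewrite refined_inside // /square_label ifT //.
    by apply/existsP; exists s; rewrite /cell_of !eqxx.
  have side u : u = 1 \/ u = 3 ->
      (rt (eleft (d, (i, j))) == phi) || (rt (eright (d, (i, j))) == phi) ->
      exists2 r, refined r = Some z & gadj (onedge d i j u) r.
    move=> u13 /orP[] rr.
      exists (inside d (eleft (d, (i, j))).1 (eleft (d, (i, j))).2 u 1).
        by apply: rz => //; lia.
      by rewrite /gadj /onedge /inside /eleft; case: (d) => /=; lia.
    exists (inside d (eright (d, (i, j))).1 (eright (d, (i, j))).2 u 3).
      by apply: rz => //; lia.
    by rewrite /gadj /onedge /inside /eright; case: (d) => /=; lia.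
  move: ae; rewrite ee !inE => /orP[] /eqP ->.
    exists (onedge d i j 1), (onedge d i j 2); rewrite r1 -ee r2; split.
      by split=> //; rewrite /gadj /onedge; case: (d) => /=; lia.
    by apply: side; left.
  exists (onedge d i j 3), (onedge d i j 2); rewrite r3 -ee r2; split.
    by split=> //; rewrite /gadj /onedge; case: (d) => /=; lia.
  by apply: side; right.
move=> x y _; rewrite inE => /existsP[a /existsP[e /andP[eE /andP[ae H]]]].
have [p [q [[rp rq pq] side]]] := main a e eE ae.
case/orP: H => [/eqP/set2_inj[]|/andP[/side[r rr pr] /eqP/set2_inj[]]] [-> ->].
- by exists p, q.
- by exists q, p; rewrite gadjC.
- by exists p, r.
- by exists r, p; rewrite gadjC.
Qed.

End Refine.

(** * Euler's inequality *)

Section Faces.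
Local Open Scope ring_scope.

Lemma grid_minor_faces (V : finType) (E : {set {set V}}) :
  (forall e, e \in E -> #|e| == 2) -> grid_minor E ->
  exists (F : finType) (l r : {set V} -> F),
  [/\ forall phi a, \sum_(e in E | a \in e) ((l e == phi)%:R + (r e == phi)%:R) = 0 :> 'F_2,
      forall Z : {set V} -> 'F_2, (forall a, \sum_(e in E | a \in e) Z e = 0) ->
        exists chi : F -> 'F_2, forall e, e \in E -> Z e = chi (l e) + chi (r e),
      forall chi : F -> 'F_2, (forall e, e \in E -> chi (l e) = chi (r e)) ->
        forall phi psi, chi phi = chi psi &
      forall phi, grid_minor (sd_plus E (fun e => (l e == phi) || (r e == phi)))].
Proof.
move=> E2 [f [N0 [fN0 fC fE]]].
(* Enlarged so that ['I_N] is inhabited by [ord0]. *)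
pose N := N0.+1.
have fN p : f p -> (0 < p.1 < N)%N && (0 < p.2 < N)%N.
  by move=> /fN0 /andP[/andP[p1 pN] /andP[p2 qN]]; rewrite p1 p2 /= /N; lia.
have [S [k [[sS spS kP] [ev lift lconst]]]] :=
  @faces_of_model V E N f fN fC fE E2 (true, (ord0, ord0)).
set T := _ :|: _ in ev lift lconst; pose rt q := fingraph.root (drel T) q.
have rtK q : rt q \in [pred q | rt q == q] by rewrite inE /rt fingraph.root_root //; exact: connect_drelC.
pose F : finType := {q | q \in [pred q | rt q == q]}.
pose rF q : F := exist _ (rt q) (rtK q).
have valF (phi : F) : rt (val phi) = val phi by apply/eqP; have := valP phi; rewrite inE.
exists F, (fun e => rF (eleft (k e))), (fun e => rF (eright (k e))); split.
- by move=> phi a; rewrite -[RHS](ev (val phi) a).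
- move=> Z /lift[chi chiE]; exists (fun phi => chi (val phi)) => e eE.
  by rewrite chiE.
- move=> chi chiE phi psi.
  have /lconst H : forall e, e \in E -> (chi \o rF) (rt (eleft (k e))) = (chi \o rF) (rt (eright (k e))).
    move=> e eE /=.
    have rr q : rF (rt q) = rF q.
      by apply: val_inj; rewrite /= /rt fingraph.root_root //; exact: connect_drelC.
    by rewrite !rr chiE.
  have rv (xi : F) : rF (val xi) = xi by apply: val_inj; rewrite /= valF.
  have : chi (rF (rt (val phi))) = chi (rF (rt (val psi))) by exact: H.
  by rewrite !valF !rv.
- move=> phi.
  have := @face_vertex V E N f fN S k sS spS kP (val phi).
  by congr grid_minor.
Qed.

Lemma sum_odd (I : finType) (P : pred I) :
  \sum_(i | P i) (1 : 'F_2) = (odd #|P|)%:R.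
Proof.
rewrite sumr_const; elim: #|P| => [|n IH]; first by rewrite mulr0n.
rewrite mulrS IH /=; case: (odd n) => //=; last by rewrite addr0.
by rewrite addF2.
Qed.

Definition even_set (V : finType) (Z : {set {set V}}) : Prop :=
  forall a, ~~ odd #|[set e in Z | a \in e]|.

Lemma rank_sum_rows (F : fieldType) p q (M : 'M[F]_(p, q)) :
  (0 < p)%N -> (forall j, \sum_i M i j = 0) -> (\rank M < p)%N.
Proof.
move=> p0 sM; have : (const_mx 1 : 'rV_p) *m M == 0.
  apply/eqP/rowP => j; rewrite !mxE -[RHS](sM j); apply: eq_bigr => i _.
  by rewrite mxE mul1r.
move/eqP/sub_kermxP/mxrankS; rewrite mxrank_ker rank_rV.
suff -> : (const_mx 1 : 'rV[F]_p) != 0 by lia.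
by apply/eqP => /rowP/(_ (Ordinal p0)); rewrite !mxE => /eqP; rewrite oner_eq0.
Qed.

Lemma rank_const_kernel (F : fieldType) p q (M : 'M[F]_(p, q)) :
  (forall u : 'rV_p, u *m M = 0 -> forall i j, u 0 i = u 0 j) -> (p <= (\rank M).+1)%N.
Proof.
move=> H; have : (\rank (kermx M) <= 1)%N.
  apply: leq_trans (rank_leq_row (const_mx 1 : 'rV[F]_p)); apply: mxrankS.
  apply/row_subP => i; case: p M H i => [M H []//|p] M H i.
  have -> : row i (kermx M) = (row i (kermx M) 0 0) *: const_mx 1.
    apply/rowP => j; rewrite [in RHS]mxE [in X in _ * X]mxE mulr1; apply: H.
    by apply/sub_kermxP; exact: row_sub.
  exact: scalemx_sub.
rewrite mxrank_ker; lia.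
Qed.

Definition face_boundary (V F : finType) (E : {set {set V}}) (l r : {set V} -> F) phi :=
  [set e in E | (l e == phi) (+) (r e == phi)].

Lemma F2_addb (a b : bool) : (a (+) b)%:R = a%:R + b%:R :> 'F_2.
Proof. by case: a b => -[]; rewrite ?addr0 ?add0r // addF2. Qed.

Lemma face_boundary_even (V F : finType) (E : {set {set V}}) (l r : {set V} -> F) :
  (forall phi a, \sum_(e in E | a \in e) ((l e == phi)%:R + (r e == phi)%:R) = 0 :> 'F_2) ->
  forall phi, even_set (face_boundary E l r phi).
Proof.
move=> ev phi a; have := ev phi a.
under eq_bigr do rewrite -F2_addb.
under eq_bigr do rewrite mulrb.
rewrite -big_mkcondr /=.
rewrite (eq_bigl (mem [set e in face_boundary E l r phi | a \in e])); last first.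
  by move=> e; rewrite !inE -!andbA; congr (_ && _); rewrite andbC.
by rewrite sum_odd; case: odd => //= /eqP; rewrite oner_eq0.
Qed.


Lemma sum_face_boundary (V F : finType) (E : {set {set V}}) (l r : {set V} -> F) :
  (\sum_phi #|face_boundary E l r phi| = \sum_(e in E) (l e != r e).*2)%N.
Proof.
transitivity (\sum_phi \sum_(e in E) ((l e == phi) (+) (r e == phi)))%N.
  apply: eq_bigr => phi _; rewrite -sum1_card big_mkcond [RHS]big_mkcond.
  by apply: eq_bigr => e _; rewrite inE; case: (e \in E); case: (_ (+) _).
rewrite exchange_big /=; apply: eq_bigr => e _.
have [lr|lr] := eqVneq (l e) (r e).
  by rewrite big1 // => phi _; rewrite lr addbb.
have rl : r e != l e by rewrite eq_sym.
rewrite (bigD1 (l e)) //= (bigD1 (r e)) //= !eqxx (negPf lr) (negPf rl) /=.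
rewrite big1 // => phi /andP[n1 n2].
by rewrite eq_sym (negPf n1) eq_sym (negPf n2).
Qed.

Lemma sum_enum_val (I : finType) (A : {set I}) (G : I -> 'F_2) :
  \sum_(i < #|A|) G (enum_val i) = \sum_(x in A) G x.
Proof. by rewrite [RHS]big_enum_val. Qed.

(** The incidence matrix [A] has rank below |U|. Its left kernel, the cycle space, lies in the span
    of the nonempty face boundaries, and these have rank below |Fs| because they sum to zero; hence
    |E| + 2 <= |Fs| + |U|. Each boundary has at least [g] edges and each edge lies on at most two of
    them, so g|Fs| <= 2|E|. That |U| <= |E| makes the cycle space nonzero, so [Fs] is not empty. *)
Lemma euler_upper (V : finType) (E : {set {set V}}) (U : {set V}) (g : nat) :
  (forall e, e \in E -> #|e| == 2) -> (forall e, e \in E -> e \subset U) ->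
  grid_minor E -> (0 < #|E|)%N -> (#|U| <= #|E|)%N ->
  (forall Z : {set {set V}}, Z \subset E -> Z != set0 -> even_set Z -> (g <= #|Z|)%N) ->
  (g * (#|E| + 2) <= 2 * #|E| + g * #|U|)%N.
Proof.
move=> E2 EU gmE E0 UE Zg.
have [F [l [r [ev lift _ _]]]] := grid_minor_faces E2 gmE.
have bev := face_boundary_even ev.
pose Fs := [set phi | face_boundary E l r phi != set0].
have U0 : (0 < #|U|)%N.
  case/card_gt0P: E0 => e eE; have := EU e eE; move/subset_leq_card.
  by rewrite (eqP (E2 e eE)); lia.
pose eE (i : 'I_#|E|) : {set V} := enum_val i.
have eEP i : eE i \in E by exact: enum_valP.
pose A : 'M['F_2]_(#|E|, #|U|) := \matrix_(i, j) (enum_val j \in eE i)%:R.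
pose Dl : 'M['F_2]_(#|Fs|, #|E|) := \matrix_(i, j)
  ((l (eE j) == enum_val i)%:R + (r (eE j) == enum_val i)%:R).
have rA : (\rank A < #|U|)%N.
  rewrite -mxrank_tr; apply: rank_sum_rows => // j.
  under eq_bigr do rewrite !mxE.
  rewrite (sum_enum_val U (fun v => (v \in eE j)%:R)).
  under eq_bigr do rewrite mulrb.
  rewrite -big_mkcondr (eq_bigl (mem (eE j))) => [|v /=]; last first.
    by have [/(subsetP (EU _ (eEP j))) ->|_] := boolP (v \in eE j); rewrite ?andbF.
  by rewrite sum_odd (eqP (E2 _ (eEP j))).
have kerDl : (kermx A <= Dl)%MS.
  apply/row_subP => i; set u := row i _.
  have uA : u *m A = 0 by apply/sub_kermxP; exact: row_sub.
  pose Z e := if [pick j | eE j == e] is Some j then u 0 j else 0.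
  have ZE j : Z (eE j) = u 0 j.
    rewrite /Z; case: pickP => [j' /eqP/enum_val_inj -> //|/(_ j)].
    by rewrite eqxx.
  have [|chi chiE] := lift Z.
    move=> a; have [aU|aU] := boolP (a \in U); last first.
      rewrite big1 // => e /andP[/EU/subsetP eU /eU]; by rewrite (negPf aU).
    rewrite big_mkcondr -(sum_enum_val E (fun e => if a \in e then Z e else 0)).
    have /rowP/(_ (enum_rank_in aU a)) := uA; rewrite !mxE => uA0.
    rewrite -[RHS]uA0; apply: eq_bigr => j _.
    by rewrite ZE [A _ _]mxE enum_rankK_in // mulr_natr mulrb.
  have -> : u = (\row_i chi (enum_val i)) *m Dl.
    apply/rowP => j; rewrite -ZE chiE // mxE.
    pose t phi := chi phi * ((l (eE j) == phi)%:R + (r (eE j) == phi)%:R).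
    transitivity (\sum_(phi in Fs) t phi); last first.
      by rewrite -(sum_enum_val Fs t); apply: eq_bigr => i' _; rewrite !mxE.
    have [lr|lr] := eqVneq (l (eE j)) (r (eE j)).
      by rewrite lr addF2 big1 // => phi _; rewrite /t lr addF2 mulr0.
    have inFs phi : (l (eE j) == phi) (+) (r (eE j) == phi) -> phi \in Fs.
      by move=> x; rewrite inE; apply/set0Pn; exists (eE j); rewrite inE eEP.
    have rl : r (eE j) != l (eE j) by rewrite eq_sym.
    rewrite (bigD1 (l (eE j))) ?inFs ?eqxx ?(negPf rl) //=.
    rewrite (bigD1 (r (eE j))) ?inFs ?eqxx ?(negPf lr) ?rl //=.
    rewrite /t !eqxx (negPf lr) (negPf rl) addr0 add0r !mulr1 big1 ?addr0 //.
    move=> phi /andP[/andP[_ n1] n2].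
    by rewrite eq_sym (negPf n1) eq_sym (negPf n2) addr0 mulr0.
  exact: submxMl.
have kerA := mxrankS kerDl; rewrite mxrank_ker in kerA.
have Fs0 : (0 < #|Fs|)%N.
  rewrite lt0n; apply/negP => /eqP Fs0.
  by have rk := rank_leq_row Dl; lia.
have rD : (\rank Dl < #|Fs|)%N.
  apply: rank_sum_rows => // j.
  under eq_bigr do rewrite mxE -F2_addb mulrb.
  rewrite (sum_enum_val Fs (fun phi => if (l (eE j) == phi) (+) (r (eE j) == phi) then 1 else 0)).
  rewrite -big_mkcondr (eq_bigl (mem (if l (eE j) == r (eE j) then set0
    else [set l (eE j); r (eE j)]))) => [|phi /=].
    rewrite sum_odd; case: eqVneq => [lr|lr]; first by rewrite cards0.
    by rewrite cards2 lr.
  have [lr|lr] := eqVneq (l (eE j)) (r (eE j)).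
    by rewrite lr addbb andbF inE.
  have rl : r (eE j) != l (eE j) by rewrite eq_sym.
  rewrite in_set2; apply/andP/orP => [[_]|H].
    by have [<-|n1] /= := eqVneq (l (eE j)) phi; [left|move=> /eqP <-; right].
  have x : (l (eE j) == phi) (+) (r (eE j) == phi).
    by case: H => /eqP ->; rewrite eqxx ?(negPf lr) ?(negPf rl).
  by split=> //; rewrite inE; apply/set0Pn; exists (eE j); rewrite inE eEP.
have sumF : (g * #|Fs| <= 2 * #|E|)%N.
  apply: (@leq_trans (\sum_(phi in Fs) #|face_boundary E l r phi|)%N).
    rewrite mulnC -sum_nat_const; apply: leq_sum => phi.
    rewrite inE => n0; apply: Zg => //.
    by apply/subsetP => e; rewrite inE => /andP[].
  apply: (@leq_trans (\sum_phi #|face_boundary E l r phi|)%N).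
    by rewrite big_mkcond; apply: leq_sum => phi _; case: ifP.
  rewrite sum_face_boundary mulnC -sum_nat_const.
  by apply: leq_sum => e _; case: (_ == _).
have : (#|E| + 2 <= #|Fs| + #|U|)%N by lia.
move/(leq_mul (leqnn g)); rewrite mulnDr; lia.
Qed.

Lemma even_set_other (V : finType) (Z : {set {set V}}) a b : a != b ->
  (forall e, e \in Z -> #|e| == 2) -> even_set Z -> [set a; b] \in Z ->
  exists c, [/\ c != b, c != a & [set a; c] \in Z].
Proof.
move=> ab Z2 /(_ a) ev abZ.
have : (1 < #|[set e in Z | a \in e]|)%N.
  have : (0 < #|[set e in Z | a \in e]|)%N.
    by apply/card_gt0P; exists [set a; b]; rewrite !inE abZ eqxx.
  by move: ev; case: #|_| => [|[|]].
case/card_gt1P => e [e' []]; rewrite !inE => /andP[eZ ae] /andP[e'Z ae'] nee.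
wlog nab : e e' eZ ae e'Z ae' nee / e' != [set a; b].
  move=> W; have [e'ab|] := eqVneq e' [set a; b]; last exact: (W e e').
  by apply: (W e' e) => //; [rewrite eq_sym|rewrite -e'ab].
have /cards2P[x [y [xy e'E]]] := Z2 _ e'Z.
move: ae' nab e'Z; rewrite e'E !inE => /orP[] /eqP ax nab e'Z; subst.
  exists y; split=> //; last by rewrite eq_sym.
  by apply: contraNneq nab => ->.
exists x; split=> //; last by rewrite setUC.
by apply: contraNneq nab => ->; rewrite setUC.
Qed.

(** An edge ab of [Z] is continued by a second edge at a and a second edge at b. *)
Lemma even_set_ge3 (V : finType) (Z : {set {set V}}) :
  (forall e, e \in Z -> #|e| == 2) -> Z != set0 -> even_set Z -> (3 <= #|Z|)%N.
Proof.
move=> Z2 /set0Pn[e eZ] ev; have /cards2P[a [b [ab eE]]] := Z2 _ eZ.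
rewrite eE in eZ.
have [c [cb ca acZ]] := even_set_other ab Z2 ev eZ.
have [d [da db bdZ]] : exists d, [/\ d != a, d != b & [set b; d] \in Z].
  by apply: even_set_other => //; [rewrite eq_sym|rewrite setUC].
apply: (@leq_trans #|[set [set a; b]; [set a; c]; [set b; d]]|); last first.
  by apply/subset_leq_card/subsetP => x; rewrite !inE -orbA => /or3P[] /eqP ->.
rewrite setUC cardsU1 !inE cards2 negb_or.
have -> /= : [set a; b] != [set a; c].
  by apply/eqP => /set2_inj[[_ /eqP]|[/eqP]]; rewrite eq_sym ?(negPf cb) ?(negPf ca).
have -> /= : [set b; d] != [set a; b].
  apply/eqP => /set2_inj[[/eqP]|[_ /eqP]]; first by rewrite eq_sym (negPf ab).
  by rewrite (negPf da).
suff -> : [set b; d] != [set a; c] by [].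
apply/eqP => /set2_inj[[/eqP]|[/eqP]]; first by rewrite eq_sym (negPf ab).
by rewrite eq_sym (negPf cb).
Qed.

Definition complete_on (V : finType) (U : {set V}) : {set {set V}} :=
  [set e : {set V} | e \subset U & #|e| == 2].

(** Euler's inequality with [g = 3] would read 36 <= 35. *)
Lemma K5_not_grid_minor (V : finType) (U : {set V}) :
  #|U| = 5 -> ~ grid_minor (complete_on U).
Proof.
move=> U5 gm.
have cE : #|complete_on U| = 10 by rewrite cards_draws U5.
have : (3 * (#|complete_on U| + 2) <= 2 * #|complete_on U| + 3 * #|U|)%N.
  apply: euler_upper => //; rewrite ?cE ?U5 //.
  - by move=> e; rewrite inE => /andP[].
  - by move=> e; rewrite inE => /andP[].
  - move=> Z ZE; apply: even_set_ge3 => e /(subsetP ZE); by rewrite inE => /andP[].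
by rewrite cE U5.
Qed.

End Faces.

(** * Maximal planar graphs *)

Lemma sd_plus_end (V : finType) (E : {set {set V}}) (P : pred {set V}) a e :
  e \in E -> a \in e -> [set inl a; inr (Some e)] \in sd_plus E P.
Proof.
move=> eE ae; rewrite inE; apply/existsP; exists a; apply/existsP; exists e.
by rewrite eE ae eqxx.
Qed.

Lemma sd_plus_apex (V : finType) (E : {set {set V}}) (P : pred {set V}) a e :
  e \in E -> a \in e -> P e -> [set inl a; inr None] \in sd_plus E P.
Proof.
move=> eE ae Pe; rewrite inE; apply/existsP; exists a; apply/existsP; exists e.
by rewrite eE ae Pe eqxx orbT.
Qed.

(** This is how a vertex in a face gets used. Each subdividing vertex is contracted into an end of
    its edge that is kept. The new vertex is dropped, becomes a fresh vertex, or is merged into a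
    vertex of the face, according to [gz]. *)
Lemma sd_plus_map (V V' : finType) (E : {set {set V}}) (P : pred {set V})
    (E' : {set {set V'}}) (g : V -> option V') (gz : option V') :
  (forall u v c, g u = Some c -> g v = Some c -> u = v) ->
  (forall u c, gz = Some c -> g u = Some c -> exists e, [/\ e \in E, u \in e & P e]) ->
  (forall a' b', a' != b' -> [set a'; b'] \in E' ->
     (exists a b, [/\ g a = Some a', g b = Some b' & [set a; b] \in E]) \/
     (exists a e, [/\ e \in E, a \in e, P e &
        (g a = Some a' /\ gz = Some b') \/ (g a = Some b' /\ gz = Some a')])) ->
  grid_minor (sd_plus E P) -> grid_minor E'.
Proof.
move=> g_inj gzP gE.
pose G (w : V + option {set V}) := match w with
  | inl v => g v
  | inr (Some e) => if e \in E then obind g [pick x in e | g x] else None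
  | inr None => gz end.
have GeP e c : G (inr (Some e)) = Some c -> exists x, [/\ e \in E, x \in e & g x = Some c].
  by rewrite /G; case: ifP => // eE; case: pickP => //= x /andP[xe _] gx; exists x.
apply: (grid_minor_map (g := G)).
- move=> x y c Gx Gy.
  have [v /eqP gv|nov] := pickP (fun v => g v == Some c).
    have hub w : G w = Some c -> w = inl v \/ [set w; inl v] \in sd_plus E P.
      case: w => [u gu|[e|gw]]; first by left; rewrite (g_inj _ _ _ gu gv).
        case/GeP=> u [eE ue gu]; right; rewrite setUC.
        by apply: sd_plus_end => //; rewrite -(g_inj _ _ _ gu gv).
      right; have [e [eE ve Pe]] := gzP _ _ gw gv.
      by rewrite setUC; apply: sd_plus_apex ve Pe.
    by exists (inl v); split; auto.
  have onlyz w : G w = Some c -> w = inr None.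
    case: w => [u gu|[e|//]]; first by have := nov u; rewrite -[g u]/(G (inl u)) gu eqxx.
    by case/GeP=> u [_ _ gu]; have := nov u; rewrite gu eqxx.
  have xz := onlyz _ Gx; have yz := onlyz _ Gy; subst x y.
  by exists (inr None); split; auto.
- move=> a' b' nab /gE - /(_ nab)[[a [b [ga gb abE]]]|[a [e [eE ae Pe H]]]].
    have : exists x, G (inr (Some [set a; b])) = g x /\ (x = a \/ x = b).
      rewrite /G abE; case: pickP => [x /andP[xab _]|/(_ a)].
        by exists x; split=> //; apply/set2P.
      by rewrite !inE eqxx ga.
    case=> x [Gx [xa|xb]]; subst x.
      exists (inr (Some [set a; b])), (inl b); rewrite Gx; split=> //.
      by rewrite setUC; apply: sd_plus_end => //; rewrite !inE eqxx orbT.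
    exists (inl a), (inr (Some [set a; b])); rewrite Gx; split=> //.
    by apply: sd_plus_end => //; rewrite !inE eqxx.
  case: H => -[ga gz'].
    by exists (inl a), (inr None); split=> //; apply: sd_plus_apex ae Pe.
  by exists (inr None), (inl a); split=> //; rewrite setUC; apply: sd_plus_apex ae Pe.
Qed.

Lemma grid_minor_edge : grid_minor [set [set true; false]].
Proof.
exists (fun p => if p == (1, 1) then Some true else if p == (2, 1) then Some false else None).
exists 3; split.
- by move=> p; case: ifP => [/eqP -> //|_]; case: ifP => // /eqP ->.
- move=> a p q; case: eqP => [-> [<-]|_].
    case: eqP => [-> _|_]; first exact: walk_refl.
    by case: eqP.
  case: eqP => // -> [<-]; case: eqP => // _; case: eqP => // -> _.
  exact: walk_refl.
- move=> a b ab _; case: a b ab => -[] // _.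
    by exists (1, 1), (2, 1).
  by exists (2, 1), (1, 1).
Qed.

Definition pair_graph (V : finType) (E : {set {set V}}) : Prop :=
  forall e, e \in E -> #|e| == 2.

Lemma card_set2 (V : finType) (a b : V) : (#|[set a; b]| == 2) = (a != b).
Proof. by rewrite cards2; case: (a != b). Qed.

(** If [b] lies on an edge, [a] is placed in a face beside that edge; otherwise ab is a component by
    itself and is added by a disjoint union. *)
Lemma grid_minor_pendant (V : finType) (E : {set {set V}}) (a b : V) :
  pair_graph E -> grid_minor E -> a != b -> (forall e, e \in E -> a \notin e) ->
  grid_minor ([set a; b] |: E).
Proof.
move=> E2 gm ab aE.
have cases a' b' : [set a'; b'] \in [set a; b] |: E ->
    [\/ a' = a /\ b' = b, a' = b /\ b' = a |
        [/\ [set a'; b'] \in E, a' != a & b' != a]].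
  rewrite !inE => /orP[/eqP/set2_inj[]|abE]; [by constructor 1|by constructor 2|].
  constructor 3; split=> //; apply/eqP => aa; have /negP := aE _ abE;
    by apply; rewrite aa !inE eqxx ?orbT.
have [e /andP[eE be]|nob] := pickP [pred e in E | b \in e]; last first.
  pose g (x : V + bool) := match x with
    | inl v => if (v == a) || (v == b) then None else Some v
    | inr true => Some a | inr false => Some b end.
  have g_inj x y c : g x = Some c -> g y = Some c -> x = y.
    rewrite /g; case: x => [x|[]]; case: y => [y|[]] //.
    - by case: ifP => // _; case: ifP => // _ [->] [->].
    - by case: ifP => // xab [?] [?]; subst; rewrite eqxx in xab.
    - by case: ifP => // xab [?] [?]; subst; rewrite eqxx orbT in xab.
    - by move=> [?]; case: ifP => // xab [?]; subst; rewrite eqxx in xab.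
    - by move=> [<-] [ba]; rewrite ba eqxx in ab.
    - by move=> [?]; case: ifP => // xab [?]; subst; rewrite eqxx orbT in xab.
    - by move=> [<-] [ba]; rewrite ba eqxx in ab.
  pose E1 : {set {set V + bool}} := [set s | [exists x, [exists y,
     ([set x; y] \in E) && (s == [set inl x; inl y])]] || (s == [set inr true; inr false])].
  apply: (grid_minor_map (E := E1) (g := g)).
  - by move=> x y c gx gy; exists x; rewrite (g_inj _ _ _ gx gy); split; auto.
  - move=> a' b' nab' /cases[[-> ->]|[-> ->]|[abE na nb]].
    + by exists (inr true), (inr false); split=> //; rewrite inE eqxx orbT.
    + by exists (inr false), (inr true); split=> //; rewrite inE setUC eqxx orbT.
    have nb' x : x \in [set a'; b'] -> x != b.
      by apply: contraTneq => ->; apply/negP => bE; have := nob [set a'; b']; rewrite /= abE bE.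
    have nba : (a' == b) = false by apply: negbTE; apply: nb'; rewrite !inE eqxx.
    have nbb : (b' == b) = false by apply: negbTE; apply: nb'; rewrite !inE eqxx orbT.
    exists (inl a'), (inl b'); rewrite /g (negPf na) (negPf nb) nba nbb.
    split=> //; rewrite /E1 inE; apply/orP; left; apply/existsP; exists a'.
    by apply/existsP; exists b'; rewrite abE eqxx.
  apply: grid_minor_union gm grid_minor_edge => x y nxy; rewrite inE.
  case/orP=> [/existsP[u /existsP[v /andP[uvE /eqP/set2_inj[]]]]|/eqP/set2_inj[]] [-> ->].
  - by [].
  - by rewrite setUC.
  - by rewrite inE.
  - by rewrite inE setUC.
have [F [l [r [_ _ _ gmf]]]] := grid_minor_faces E2 gm.
apply: (sd_plus_map (g := fun v => if v == a then None else Some v) (gz := Some a)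
  _ _ _ (gmf (l e))).
- by move=> u v c; case: ifP => // _ [<-]; case: ifP => // _ [].
- by move=> u c [<-]; case: ifP => // ua [uu]; rewrite uu eqxx in ua.
- move=> a' b' nab' /cases[[-> ->]|[-> ->]|[abE na nb]].
  + right; exists b, e; split=> //; first by rewrite eqxx.
    by right; rewrite eq_sym (negPf ab).
  + right; exists b, e; split=> //; first by rewrite eqxx.
    by left; rewrite eq_sym (negPf ab).
  + by left; exists a', b'; rewrite (negPf na) (negPf nb).
Qed.

Section Maximal.
Context (V : finType) (E : {set {set V}}).
Context (E2 : pair_graph E) (E_gm : grid_minor E) (V4 : 4 <= #|V|).
Context (E_max : forall a b, a != b -> grid_minor ([set a; b] |: E) -> [set a; b] \in E).

(** Two vertices on a common face are adjacent, since an edge could be drawn through the face; four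
    of them would form a K5 with a new vertex in that face. So a face boundary has at most three
    edges and 2|E| <= 3|F|. The graph and its dual are connected, so the two incidence matrices have
    ranks at least |V| - 1 and |F| - 1; as their product is zero, |F| + |V| <= |E| + 2. *)
Lemma maximal_grid_minor : 3 * #|V| <= #|E| + 6.
Proof.
have other (a : V) : exists b, a != b.
  have /card_gt1P[x [y [_ _ xy]]] : 1 < #|V| by lia.
  by have [->|] := eqVneq a x; [exists y|exists x].
have cover a : exists2 e, e \in E & a \in e.
  have [e /andP[eE ae]|noe] := pickP [pred e in E | a \in e]; first by exists e.
  have aE e : e \in E -> a \notin e.
    by move=> eE; apply/negP => ae; have := noe e; rewrite /= eE ae.
  have [b ab] := other a.
  have := E_max ab (grid_minor_pendant E2 E_gm ab aE).
  by move/aE; rewrite !inE eqxx.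
have [F [l [r [ev lift lconst gmf]]]] := grid_minor_faces E2 E_gm.
pose P phi e := (l e == phi) || (r e == phi).
pose U phi := [set a | [exists e in E, (a \in e) && P phi e]].
have UP phi a : a \in U phi -> exists e, [/\ e \in E, a \in e & P phi e].
  by rewrite inE => /existsP[e /andP[eE /andP[ae Pe]]]; exists e.
have clique phi a b : a \in U phi -> b \in U phi -> a != b -> [set a; b] \in E.
  move=> /UP[e [eE ae Pe]] /UP[e' [e'E be' Pe']] ab; apply: E_max => //.
  apply: (@sd_plus_map _ _ _ _ _ some (Some a) _ _ _ (gmf phi)).
  - by move=> u v c [->] [->].
  - by move=> u c [<-] [->]; exists e.
  - move=> a' b' nab'; rewrite !inE => /orP[/eqP/set2_inj[]|abE].
    + by case=> -> ->; right; exists b, e'; split=> //; right.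
    + by case=> -> ->; right; exists b, e'; split=> //; left.
    + by left; exists a', b'.
have U3 phi : #|U phi| <= 3.
  rewrite leqNgt; apply/negP => U4.
  have [X [XU X4]] : exists X : {set V}, X \subset U phi /\ #|X| = 4.
    have : 0 < #|[set A : {set V} | A \subset U phi & #|A| == 4]|.
      by rewrite cards_draws bin_gt0.
    by case/card_gt0P=> X; rewrite inE => /andP[XU /eqP X4]; exists X.
  pose Y : {set option V} := None |: Some @: X.
  have Y5 : #|Y| = 5.
    rewrite cardsU1 card_imset ?X4; last by move=> ? ? [].
    by rewrite (_ : None \notin _) //; apply/negP => /imsetP[].
  apply: (K5_not_grid_minor Y5).
  apply: (@sd_plus_map _ _ _ _ _ (fun v => Some (Some v)) (Some None) _ _ _ (gmf phi)).
  - by move=> u v c [<-] [].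
  - by move=> u c [<-].
  - have inX v : (Some v \in Y) = (v \in X).
      rewrite !inE /=; apply/imsetP/idP => [[x xX [->]] //|vX]; by exists v.
    move=> a' b' nab'; rewrite inE => /andP[/subsetP sY _].
    have a'Y : a' \in Y by apply: sY; rewrite !inE eqxx.
    have b'Y : b' \in Y by apply: sY; rewrite !inE eqxx orbT.
    case: a' b' nab' a'Y b'Y {sY} => [a|] [b|] nab; rewrite ?inX => aX bX.
    + left; exists a, b; split=> //; apply: (clique phi); try exact: (subsetP XU).
      by move: nab; rewrite (inj_eq Some_inj).
    + have [e [eE ae Pe]] := UP _ _ (subsetP XU _ aX).
      by right; exists a, e; split=> //; left.
    + have [e [eE be Pe]] := UP _ _ (subsetP XU _ bX).
      by right; exists b, e; split=> //; right.
    + by rewrite eqxx in nab.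
have inU e phi a : e \in E -> P phi e -> a \in e -> a \in U phi.
  by move=> eE Pe ae; rewrite inE; apply/existsP; exists e; rewrite eE ae Pe.
(* The vertices of a face form a clique, so [chi] induces a function on faces; it takes equal values
   on the two sides of every edge and is therefore constant. *)
have conn (chi : V -> 'F_2) : (forall a b, [set a; b] \in E -> chi a = chi b) ->
    forall a b, chi a = chi b.
  move=> chiE.
  have chiU phi a b : a \in U phi -> b \in U phi -> chi a = chi b.
    move=> aU bU; have [-> //|ab] := eqVneq a b.
    by apply: chiE; exact: clique aU bU ab.
  pose X phi := if [pick a in U phi] is Some a then chi a else 0%R.
  have XE phi a : a \in U phi -> X phi = chi a.
    rewrite /X; case: pickP => [b bU aU|/(_ a) -> //]; exact: chiU bU aU.
  have XX : forall e, e \in E -> X (l e) = X (r e).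
    move=> e eE; have /card_gt0P[a ae] : 0 < #|e| by rewrite (eqP (E2 eE)).
    by rewrite (XE _ a) ?(XE _ a) //; apply: inU ae => //; rewrite /P eqxx ?orbT.
  move=> a b.
  have [e eE ae] := cover a; have [e' e'E be'] := cover b.
  have aU : a \in U (l e) by apply: inU ae => //; rewrite /P eqxx.
  have bU : b \in U (l e') by apply: inU be' => //; rewrite /P eqxx.
  by rewrite -(XE _ _ aU) -(XE _ _ bU); exact: lconst XX _ _.
have bev := face_boundary_even ev.
have bsub phi : face_boundary E l r phi \subset
    [set e : {set V} | e \subset U phi & #|e| == 2].
  apply/subsetP => e; rewrite !inE => /andP[eE Pe].
  rewrite E2 // andbT; apply/subsetP => a; apply: inU => //.
  by move: Pe; rewrite /P; case: (l e == phi).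
have pairsU phi : #|[set e : {set V} | e \subset U phi & #|e| == 2]| <= 3.
  by rewrite cards_draws; case: #|U phi| (U3 phi) => [|[|[|[|]]]].
(* With the same face on both sides, its boundary would omit [e] from at most three pairs, which is
   too small for a nonempty even set. Being empty, it would make this face the only one, carrying
   all of the at least four vertices. *)
have noloop e : e \in E -> l e != r e.
  move=> eE; apply/negP => /eqP lr.
  have bd0 : face_boundary E l r (l e) = set0.
    apply/eqP; apply: contraT => bn0.
    have b3 : 3 <= #|face_boundary E l r (l e)|.
      by apply: even_set_ge3 => // e'; rewrite inE => /andP[/E2].
    have : face_boundary E l r (l e) \proper
        [set e' : {set V} | e' \subset U (l e) & #|e'| == 2].
      apply/properP; split; [exact: bsub|exists e; last by rewrite inE lr addbb andbF].
      rewrite inE E2 // andbT; apply/subsetP => a; apply: inU => //.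
      by rewrite /P eqxx.
    by move/proper_card/leq_trans/(_ (pairsU (l e))); rewrite ltnNge b3.
  have oneF : forall psi, psi = l e.
    move=> psi; apply/eqP.
    have H e' : e' \in E -> ((l e' == l e)%:R = (r e' == l e)%:R :> 'F_2)%R.
      move=> e'E; have : e' \notin face_boundary E l r (l e) by rewrite bd0 inE.
      by rewrite inE e'E /= negb_add => /eqP ->.
    have := lconst (fun phi => (phi == l e)%:R%R) H psi (l e).
    by rewrite eqxx; case: (psi == l e).
  have : #|V| <= #|U (l e)|.
    rewrite -cardsT; apply/subset_leq_card/subsetP => a _.
    have [e' e'E ae'] := cover a; apply: inU e'E _ ae'.
    by rewrite /P (oneF (l e')) eqxx.
  by have := U3 (l e); lia.
have F0 : 0 < #|F|.
  have /card_gt0P[a _] : 0 < #|V| by lia.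
  by have [e _ _] := cover a; apply/card_gt0P; exists (l e).
have sumF : 2 * #|E| <= 3 * #|F|.
  rewrite mulnC -sum_nat_const [3 * _]mulnC -[#|F|]sum1_card big_distrl /=.
  have -> : \sum_(e in E) 2 = \sum_phi #|face_boundary E l r phi|.
    by rewrite sum_face_boundary; apply: eq_bigr => e /noloop ->.
  by apply: leq_sum => phi _; apply: leq_trans (pairsU phi); exact: subset_leq_card.
suff : #|F| + #|V| <= #|E| + 2 by lia.
pose eE (i : 'I_#|E|) : {set V} := enum_val i.
have eEP i : eE i \in E by exact: enum_valP.
pose A : 'M['F_2]_(#|E|, #|V|) := (\matrix_(i, j) (enum_val j \in eE i)%:R)%R.
pose Dl : 'M['F_2]_(#|F|, #|E|) := (\matrix_(i, j)
  ((l (eE j) == enum_val i)%:R + (r (eE j) == enum_val i)%:R))%R.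
have DA : (Dl *m A = 0)%R.
  apply/matrixP => i j; rewrite !mxE -[RHS](ev (enum_val i) (enum_val j)).
  rewrite [RHS]big_mkcondr /= -(sum_enum_val E (fun e => if enum_val j \in e then
    ((l e == enum_val i)%:R + (r e == enum_val i)%:R)%R else 0%R)).
  by apply: eq_bigr => k _; rewrite !mxE mulr_natr mulrb.
have rA : #|V| <= (\rank A).+1.
  rewrite -mxrank_tr; apply: rank_const_kernel => u uA i j.
  have main : forall a b, [set a; b] \in E -> u 0%R (enum_rank a) = u 0%R (enum_rank b).
    move=> a b abE; have ab : a != b by rewrite -card_set2 E2.
    have /rowP/(_ (enum_rank_in abE [set a; b])) := uA; rewrite !mxE.
    under eq_bigr => k _ do rewrite !mxE mulr_natr mulrb /eE enum_rankK_in //.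
    rewrite -big_mkcond /= (bigD1 (enum_rank a)) /=; last by rewrite enum_rankK !inE eqxx.
    rewrite (bigD1 (enum_rank b)) /=; last first.
      by rewrite enum_rankK !inE eqxx orbT (inj_eq enum_rank_inj) eq_sym.
    rewrite big1 => [|k /andP[/andP[]]]; last first.
      rewrite !inE => /orP[] /eqP kE; rewrite -kE enum_valK ?eqxx //.
    rewrite addr0 => /eqP; rewrite addr_eq0 => /eqP ->.
    by apply/eqP; rewrite eq_sym -subr_eq0 opprK addF2.
  by have := conn (fun a => u 0%R (enum_rank a)) main (enum_val i) (enum_val j);
    rewrite !enum_valK.
have rD : #|F| <= (\rank Dl).+1.
  apply: rank_const_kernel => u uD i j.
  have main e : e \in E -> u 0%R (enum_rank (l e)) = u 0%R (enum_rank (r e)).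
    move=> eE'; have lr := noloop e eE'.
    have /rowP/(_ (enum_rank_in eE' e)) := uD; rewrite !mxE.
    under eq_bigr => k _ do rewrite !mxE mulrDr !mulr_natr !mulrb /eE enum_rankK_in //.
    rewrite big_split /= -!big_mkcond /=.
    rewrite (big_pred1 (enum_rank (l e))) => [|k]; last first.
      by rewrite /= -(inj_eq enum_rank_inj) enum_valK eq_sym.
    rewrite (big_pred1 (enum_rank (r e))) => [|k]; last first.
      by rewrite /= -(inj_eq enum_rank_inj) enum_valK eq_sym.
    move=> /eqP; rewrite addr_eq0 => /eqP ->.
    by apply/eqP; rewrite eq_sym -subr_eq0 opprK addF2.
  by have := lconst (fun phi => u 0%R (enum_rank phi)) main (enum_val i) (enum_val j);
    rewrite !enum_valK.
have := mulmx0_rank_max DA; lia.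
Qed.

End Maximal.

(** Apply [maximal_grid_minor] to an edge-maximal extension on the subtype of [U]. Confining the new
    edges to [U] later keeps them off a planted copy. *)
Lemma grid_minor_extend (V : finType) (U : {set V}) (E : {set {set V}}) :
  pair_graph E -> grid_minor E -> (forall e, e \in E -> e \subset U) -> 4 <= #|U| ->
  exists E' : {set {set V}}, [/\ E \subset E', pair_graph E', grid_minor E',
    forall e, e \in E' -> e \subset U & 3 * #|U| <= #|E'| + 6].
Proof.
move=> E2 gm EU U4.
pose S : finType := {x | x \in U}.
have cS : #|S| = #|U| by rewrite card_sig; apply: eq_card.
pose down (A : {set {set V}}) : {set {set S}} := [set e | val @: (e : {set S}) \in A].
have img2 (a b : S) : val @: [set a; b] = [set val a; val b] by rewrite imsetU1 imset_set1.
have imgE (e : {set S}) : #|val @: e| = #|e| by rewrite card_imset //; exact: val_inj.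
pose P (A : {set {set S}}) := [&& down E \subset A, [forall e in A, #|e| == 2] & `[< grid_minor A >]].
have P0 : P (down E).
  rewrite /P subxx /=; apply/andP; split.
    by apply/forall_inP => e; rewrite inE => /E2; rewrite imgE.
  apply/asboolP; apply: (grid_minor_map (g := insub)) gm.
    have insK x (c : S) : insub x = Some c -> x = val c by case: insubP => // u _ <- [<-].
    by move=> a b c /insK -> /insK ->; exists (val c); rewrite valK; split; auto.
  move=> a b _; rewrite inE img2 => abE; exists (val a), (val b).
  by rewrite !valK.
case: (arg_maxnP (fun A : {set {set S}} => #|A|) P0) => A /and3P[EA /forall_inP A2 /asboolP gmA] Amax.
have A3 : 3 * #|S| <= #|A| + 6.
  apply: maximal_grid_minor => //; first by rewrite cS.
  move=> a b ab gmab; apply: contraT => abA.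
  have : P ([set a; b] |: A).
    apply/and3P; split; first by rewrite (subset_trans EA) ?subsetUr.
      by apply/forall_inP => e; rewrite !inE => /orP[/eqP -> |/A2 //]; rewrite card_set2.
    exact/asboolP.
  by move/Amax; rewrite cardsU1 abA; lia.
exists [set val @: (e : {set S}) | e in A]; split.
- apply/subsetP => e eE; apply/imsetP.
  have eU : {subset e <= U} by apply/subsetP; exact: EU.
  have eE' : val @: [set x : S | val x \in e] = e.
    apply/setP => x; apply/imsetP/idP => [[y /[!inE] ye ->] //|xe].
    by exists (Sub x (eU x xe)); rewrite ?inE SubK.
  by exists [set x : S | val x \in e]; rewrite // (subsetP EA) // inE eE'.
- by move=> e /imsetP[e' /A2 e'2 ->]; rewrite imgE.
- apply: (grid_minor_map (g := fun x => Some (val x))) gmA.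
    move=> a b c [ac] [bc]; have ab : a = b by apply: val_inj; exact: etrans ac (esym bc).
    by exists a; rewrite -ab; split; auto; congr Some.
  move=> a b ab /imsetP[e eA abE]; have /cards2P[x [y [xy exy]]] := A2 _ eA.
  move: abE; rewrite exy img2 => /set2_inj[[-> ->]|[-> ->]].
    by exists x, y; rewrite -exy.
  by exists y, x; rewrite setUC -exy.
- move=> e /imsetP[e' _ ->]; apply/subsetP => x /imsetP[y _ ->]; exact: (valP y).
- by rewrite -cS card_imset //; apply: imset_inj; exact: val_inj.
Qed.

(** * Components and planted copies *)

(** Double counting of the pairs formed by an object of [S] and a choice for it. *)
Lemma choice_count (A C B : finType) (S : {set A}) (S' : {set B}) (W : A -> {set C})
    (f : A -> C -> B) (x y : nat) :
  (forall a, a \in S -> x <= #|W a|) ->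
  (forall a c, a \in S -> c \in W a -> f a c \in S') ->
  (forall b, b \in S' -> #|[set p : A * C | [&& p.1 \in S, p.2 \in W p.1 & f p.1 p.2 == b]]| <= y) ->
  #|S| * x <= #|S'| * y.
Proof.
move=> Wx fS' fy; pose P := [set p : A * C | (p.1 \in S) && (p.2 \in W p.1)].
apply: (@leq_trans #|P|).
  rewrite -sum_nat_const -sum1_card.
  rewrite (eq_bigl (fun p => (p.1 \in S) && (p.2 \in W p.1))) => [|p]; last by rewrite inE.
  rewrite -(pair_big_dep (mem S) (fun a c => c \in W a) (fun _ _ => 1)) /=.
  by apply: leq_sum => a aS; rewrite sum1_card; exact: Wx.
rewrite -sum1_card (partition_big (fun p => f p.1 p.2) (mem S')) /=; last first.
  by move=> p; rewrite inE => /andP[pS pW]; exact: fS'.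
rewrite -sum_nat_const; apply: leq_sum => b bS'; rewrite sum1_card.
apply: leq_trans (fy b bS'); apply: subset_leq_card; apply/subsetP => p.
by rewrite unfold_in !inE -andbA.
Qed.

Section Components.
Context (T : finType).
Implicit Types (G : {set {set T}}) (X : {set T}).

Lemma adj_sym G : symmetric (adj G).
Proof. by move=> x y; rewrite /adj setUC. Qed.

Lemma connect_adjC G : connect_sym (adj G).
Proof. exact: sym_connect_sym (@adj_sym G). Qed.

Definition comp G v := [set y | connect (adj G) v y].

Lemma comp_sub G X v : v \in X ->
  (forall x y, x \in X -> [set x; y] \in G -> y \in X) -> comp G v \subset X.
Proof.
move=> vX H; apply/subsetP => y; rewrite inE => vy.
have cl : closed (adj G) X.
  by apply: (intro_closed (@connect_adjC G)) => x z xz xX; exact: (H x z xX xz).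
by rewrite -(closed_connect cl vy).
Qed.

Lemma mem_comp G v : v \in comp G v.
Proof. by rewrite inE connect0. Qed.

Lemma comp_step G v x y : x \in comp G v -> [set x; y] \in G -> y \in comp G v.
Proof. by rewrite !inE => vx xy; apply: connect_trans vx _; exact: connect1. Qed.

Lemma comp_eq G v w : w \in comp G v -> comp G w = comp G v.
Proof.
rewrite inE => vw; apply/setP => y; rewrite !inE.
by rewrite (same_connect (@connect_adjC G) vw).
Qed.

(** Any edge leaving the component of [G'] would meet it, so agreement on the edges that meet it
    pins the component down. *)
Lemma comp_transfer G G' v : pair_graph G -> pair_graph G' ->
  (forall (e : {set T}) u, u \in e -> u \in comp G' v -> (e \in G) = (e \in G')) ->
  comp G v = comp G' v /\ induced_edges G (comp G' v) = induced_edges G' (comp G' v).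
Proof.
move=> pG pG' H; split.
  have h : comp G v \subset comp G' v.
    apply: comp_sub; first exact: mem_comp.
    by move=> x y xC xy; apply: comp_step (xC) _; rewrite -(H _ x) // !inE eqxx.
  apply/eqP; rewrite eqEsubset h /=.
  suff : comp G' v \subset comp G' v :&: comp G v by rewrite subsetI => /andP[].
  apply: comp_sub; first by rewrite inE !mem_comp.
  move=> x y; rewrite inE => /andP[xC' xC] xy; rewrite inE (comp_step xC' xy).
  by apply: comp_step xC _; rewrite (H _ x) // !inE eqxx.
apply/setP => e; rewrite !inE; have [sub|] := boolP (e \subset _); last by rewrite !andbF.
rewrite !andbT; have [->|/set0Pn[u ue]] := eqVneq e set0.
  by apply/idP/idP => [/pG|/pG']; rewrite cards0.
by rewrite (H e u) // (subsetP sub).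
Qed.

End Components.

Section Placement.
Context (V T : finType) (H : {set {set V}}).
Hypothesis pH : pair_graph H.
Hypothesis cH : connected_graph H.
Implicit Types (G : {set {set T}}) (j : {ffun V -> T}).

Definition place j : {set {set T}} := [set j @: (e : {set V}) | e in H].
Definition img j : {set T} := j @: [set: V].
Definition away G (X : {set T}) := [set e in G | [disjoint e & X]].

Lemma card_img j : injective j -> #|img j| = #|V|.
Proof. by move=> ji; rewrite card_imset // cardsT. Qed.

Lemma place_img j e : e \in place j -> e \subset img j.
Proof. by case/imsetP=> f _ ->; apply: imsetS; exact: subsetT. Qed.

Lemma card_place j : injective j -> #|place j| = #|H|.
Proof. by move=> ji; rewrite card_imset //; exact: imset_inj. Qed.

Lemma place_pair j : injective j -> pair_graph (place j).
Proof. by move=> ji e /imsetP[f fH ->]; rewrite card_imset // pH. Qed.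

Lemma place_disjoint j G : injective j -> pair_graph G -> away G (img j) = G -> [disjoint G & place j].
Proof.
move=> ji pG aG; rewrite disjoint_subset; apply/subsetP => e eG; rewrite !inE.
apply/negP => /place_img sub; move: (eG); rewrite -aG inE => /andP[_ dis].
have := pG e eG; rewrite -(setIidPl sub); move: dis; rewrite -setI_eq0 => /eqP ->.
by rewrite cards0.
Qed.

Definition copy_at G u : bool :=
  isomorphic_to H (comp G u) (induced_edges G (comp G u)).

Lemma has_copy G u : copy_at G u -> has_component_iso H G.
Proof.
by move=> cp; apply/existsP; exists (comp G u); rewrite [isomorphic_to _ _ _]cp andbT; apply/existsP; exists u.
Qed.

Lemma card_copy G u : copy_at G u -> #|comp G u| = #|V|.
Proof.
move=> /existsP[f /and3P[/injectiveP fi /eqP <- _]].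
by rewrite card_imset // cardsT.
Qed.

Section Glue.
Context (G : {set {set T}}) (j : {ffun V -> T}).
Hypothesis pG : pair_graph G.
Hypothesis ji : injective j.
Hypothesis aG : away G (img j) = G.

Lemma glue_card : #|G :|: place j| = #|G| + #|H|.
Proof.
rewrite cardsU card_place //; have := place_disjoint ji pG aG.
by rewrite -setI_eq0 => /eqP ->; rewrite cards0 subn0.
Qed.

Lemma glue_pair : pair_graph (G :|: place j).
Proof. by move=> e; rewrite inE => /orP[/pG|/(place_pair ji)]. Qed.

Lemma away_mem e x : e \in G -> x \in e -> x \notin img j.
Proof.
rewrite -aG inE => /andP[_]; rewrite disjoint_subset => /subsetP h /h.
by rewrite inE.
Qed.

Lemma glue_diff : (G :|: place j) :\: place j = G.
Proof.
apply/setP => e; rewrite !inE; have := place_disjoint ji pG aG.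
rewrite disjoint_subset => /subsetP h; have [eG|] := boolP (e \in G).
  by have := h e eG; rewrite inE => ->.
by rewrite orFb andNb.
Qed.

Lemma glue_comp v : comp (G :|: place j) (j v) = img j.
Proof.
apply/eqP; rewrite eqEsubset; apply/andP; split.
  apply: comp_sub; first by rewrite imset_f ?inE.
  move=> x y xX; rewrite inE => /orP[/away_mem/(_ (set21 x y))|/place_img/subsetP].
    by rewrite xX.
  by apply; rewrite set22.
apply/subsetP => _ /imsetP[w _ ->]; rewrite inE.
have /andP[_ /forallP/(_ v)/forallP/(_ w)/connectP[s ps ->]] := cH.
elim: s v ps => [|x s IH] v /=; first by rewrite connect0.
case/andP=> vx /IH; apply: connect_trans; apply: connect1.
by rewrite /adj inE; apply/orP; right; apply/imsetP; exists [set v; x]; rewrite // imsetU1 imset_set1.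
Qed.

Lemma glue_copy v : copy_at (G :|: place j) (j v).
Proof.
rewrite /copy_at glue_comp; apply/existsP; exists j; apply/and3P; split=> //; first exact/injectiveP.
apply/eqP/setP => e; rewrite !inE; apply/idP/idP => [ep|/andP[/orP[eG|//] sub]].
  by rewrite ep orbT; exact: place_img.
have /cards2P[x [y [_ eE]]] := pG eG.
have xe : x \in e by rewrite eE !inE eqxx.
by have := away_mem eG xe; rewrite (subsetP sub).
Qed.

Lemma glue_has : has_component_iso H (G :|: place j).
Proof. by have /andP[/card_gt0P[v _] _] := cH; exact: has_copy (glue_copy v). Qed.

(** Take the disjoint union of the two models and erase the labels in [img j] from that of [G],
    where these vertices lie on no edge. *)
Lemma glue_grid_minor : grid_minor H -> grid_minor G -> grid_minor (G :|: place j).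
Proof.
move=> gH gG.
pose E : {set {set V + T}} := [set inl @: (e : {set V}) | e in H] :|: [set inr @: (e : {set T}) | e in G].
have gE : grid_minor E.
  apply: grid_minor_union gH gG => a b ab; rewrite inE => /orP[] /imsetP[e eE abE].
    case: a b ab abE => [a|a] [b|b] ab abE.
    - suff -> : [set a; b] = e by [].
      apply: (imset_inj (f := @inl V T)) => [x y []//|]; by rewrite -abE imsetU1 imset_set1.
    - by have /imsetP[] : inr b \in inl @: e by rewrite -abE !inE eqxx orbT.
    - by have /imsetP[] : inr a \in inl @: e by rewrite -abE !inE eqxx.
    - by have /imsetP[] : inr a \in inl @: e by rewrite -abE !inE eqxx.
  case: a b ab abE => [a|a] [b|b] ab abE.
  - by have /imsetP[] : inl b \in inr @: e by rewrite -abE !inE eqxx orbT.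
  - by have /imsetP[] : inl a \in inr @: e by rewrite -abE !inE eqxx.
  - by have /imsetP[] : inl b \in inr @: e by rewrite -abE !inE eqxx orbT.
  - suff -> : [set a; b] = e by [].
    apply: (imset_inj (f := @inr V T)) => [x y []//|]; by rewrite -abE imsetU1 imset_set1.
pose g (z : V + T) : option T := match z with
  | inl v => Some (j v) | inr t => if t \in img j then None else Some t end.
apply: (grid_minor_map (g := g)) gE.
  have gi a b c : g a = Some c -> g b = Some c -> a = b.
    case: a b => [a|a] [b|b] /=.
    - by move=> <- [/ji ->].
    - by move=> [<-]; case: ifP => // /negP h [bE]; case: h; rewrite bE imset_f ?inE.
    - by case: ifP => // /negP h [aE] [bE]; case: h; rewrite aE -bE imset_f ?inE.
    - by case: ifP => // _ [->]; case: ifP => // _ [->].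
  by move=> a b c ga gb; exists a; split; auto; left; exact: gi gb ga.
move=> a b ab; rewrite inE => /orP[abG|/imsetP[e eH abE]].
  exists (inr a), (inr b); rewrite /= !ifF; first split=> //.
  - rewrite inE; apply/orP; right; apply/imsetP; exists [set a; b] => //.
    by rewrite imsetU1 imset_set1.
  - by apply: negbTE; apply: (away_mem abG); rewrite !inE eqxx orbT.
  - by apply: negbTE; apply: (away_mem abG); rewrite !inE eqxx.
have /imsetP[x xe aE] : a \in j @: e by rewrite -abE !inE eqxx.
have /imsetP[y ye bE] : b \in j @: e by rewrite -abE !inE eqxx orbT.
exists (inl x), (inl y); rewrite /= aE bE; split=> //.
rewrite inE; apply/orP; left; apply/imsetP; exists e => //.
rewrite -[e](_ : [set x; y] = e) ?imsetU1 ?imset_set1 //.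
apply/eqP; rewrite eqEcard subUset !sub1set xe ye /= (eqP (pH eH)) cards2.
by case: (x =P y) => // xy; move: ab; rewrite aE bE xy eqxx.
Qed.

End Glue.

Lemma has_component_split G : pair_graph G -> has_component_iso H G ->
  exists j, injective j /\ G = away G (img j) :|: place j.
Proof.
move=> pG /existsP[C /andP[/existsP[v /eqP CE] /existsP[j /and3P[/injectiveP ji /eqP jC /eqP pE]]]].
exists j; split=> //; apply/setP => e; rewrite in_setU.
have -> : place j = induced_edges G C by rewrite -pE.
rewrite /img jC !inE; have [eG|//] := boolP (e \in G); rewrite /=.
have /cards2P[x [y [_ eE]]] := pG _ eG.
have CE' : C = comp G v by rewrite CE.
have xy : [set x; y] \in G by rewrite -eE.
have yx : [set y; x] \in G by rewrite setUC.
apply/esym; rewrite -setI_eq0 orbC; have [sub|nsub] := boolP (e \subset C) => //=.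
apply/eqP/setP => z; rewrite !inE; apply/negP => /andP[ze zC].
case/negP: nsub; move: ze zC; rewrite eE CE' subUset !sub1set in_set2 => /orP[] /eqP -> zC.
  by rewrite zC (comp_step zC xy).
by rewrite zC (comp_step zC yx).
Qed.

End Placement.

Lemma card_bigcup_leq (I T : finType) (P : {set I}) (F : I -> {set T}) k :
  (forall i, i \in P -> #|F i| <= k) -> #|\bigcup_(i in P) F i| <= #|P| * k.
Proof.
move=> Fk; rewrite -sum_nat_const.
elim/big_rec2: _ => [|i y A iP le]; first by rewrite cards0.
by apply: leq_trans (leq_card_setU _ _) _; exact: leq_add (Fk i iP) le.
Qed.

Definition drawable (T : finType) (G : {set {set T}}) : bool :=
  `[< pair_graph G /\ grid_minor G >].

Lemma drawableP (T : finType) (G : {set {set T}}) :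
  reflect (pair_graph G /\ grid_minor G) (drawable G).
Proof. exact: asboolP. Qed.

(** * Planting a copy of H on freed vertices *)

Section Absorb.
Context (V T : finType) (H : {set {set V}}).
Hypotheses (pH : pair_graph H) (cH : connected_graph H) (gH : grid_minor H).

Definition with_copy a b : {set {set {set T}}} :=
  [set G | [&& drawable G, has_component_iso H G & a <= #|G| <= b]].

(* A copy of H in the new graph that is not the planted one must contain a *)
(* vertex of B, since otherwise it would be a component of the old graph. *)
Lemma card_copies (G G1 : {set {set T}}) (j : {ffun V -> T}) (B : {set T}) :
  pair_graph G -> ~~ has_component_iso H G -> pair_graph G1 -> injective j ->
  away G1 (img j) = G1 ->
  (forall (e : {set T}) u, u \in e -> u \notin img j -> u \notin B -> (e \in G) = (e \in G1)) ->
  #|[set u | copy_at H (G1 :|: place H j) u]| <= #|B|.+1 * #|V|.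
Proof.
move=> pG nG pG1 ji aG1 loc.
set G2 := G1 :|: place H j.
have pG2 : pair_graph G2 by exact: glue_pair.
have /andP[/card_gt0P[v0 _] _] := cH.
pose W u := if copy_at H G2 u then comp G2 u else set0.
have Wc u : #|W u| <= #|V| by rewrite /W; case: ifP => [/card_copy ->//|_]; rewrite cards0.
apply: (@leq_trans #|\bigcup_(u in j v0 |: B) W u|); last first.
  apply: leq_trans (card_bigcup_leq (fun u _ => Wc u)) _; rewrite leq_mul2r.
  by apply/orP; right; rewrite cardsU1; case: (_ \notin _) => //; rewrite add1n leqnn.
apply: subset_leq_card; apply/subsetP => v; rewrite inE => cv.
have toU u : u \in j v0 |: B -> u \in comp G2 v -> v \in \bigcup_(u in j v0 |: B) W u.
  move=> uB uv; apply/bigcupP; exists u => //.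
  by rewrite /W /copy_at (comp_eq uv) -/(copy_at H G2 v) cv mem_comp.
have [|jv] := boolP (j v0 \in comp G2 v); first by apply: toU; rewrite !inE eqxx.
have [/pred0P dis|/pred0Pn[u /= /andP[uB uC]]] := boolP [disjoint B & comp G2 v]; last first.
  by apply: toU uC; rewrite !inE uB orbT.
have offX u : u \in comp G2 v -> u \notin img j.
  move=> uC; apply: contraNN jv => /imsetP[w _ uw].
  by rewrite -(comp_eq uC) uw glue_comp // imset_f ?inE.
have [|ec ei] := @comp_transfer T G G2 v pG pG2.
  move=> e u ue uC; rewrite (loc e u) //; last 2 first.
  - exact: offX.
  - by have := dis u; rewrite /= uC andbT => ->.
  rewrite inE; case: (boolP (e \in place H j)) => [/place_img/subsetP/(_ u ue) h|_]; last by rewrite orbF.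
  by have := offX u uC; rewrite h.
case/negP: nG; apply: (@has_copy _ _ H G v).
by rewrite /copy_at ec ei.
Qed.

Section Count.
Context (S : {set {set {set T}}}) (J : {set {set T}} -> {set {ffun V -> T}}).
Context (red : {set {set T}} -> {ffun V -> T} -> {set {set T}}) (a b beta F : nat).
Hypothesis S_pair : forall G, G \in S -> pair_graph G.
Hypothesis S_no : forall G, G \in S -> ~~ has_component_iso H G.
Hypothesis red_drawable : forall G j, G \in S -> j \in J G -> drawable (red G j).
Hypothesis J_inj : forall G j, G \in S -> j \in J G -> injective j.
Hypothesis red_away : forall G j, G \in S -> j \in J G -> away (red G j) (img j) = red G j.
Hypothesis red_card : forall G j, G \in S -> j \in J G -> a <= #|red G j| + #|H| <= b.
Hypothesis red_local : forall G j, G \in S -> j \in J G -> exists2 B : {set T}, #|B| <= beta &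
  forall (e : {set T}) u, u \in e -> u \notin img j -> u \notin B -> (e \in G) = (e \in red G j).
Hypothesis fibre : forall G1 j, #|[set G in S | (j \in J G) && (red G j == G1)]| <= F.

(** To undo a planting, note that [j] maps into the vertices lying in copies of H, at most (beta +
    1)|V| by [card_copies]. Once [j] is known, removing the planted edges gives [red G j], and at
    most [F] graphs [G] lead there. *)
Lemma absorb_count x : (forall G, G \in S -> x <= #|J G|) ->
  #|S| * x <= #|with_copy a b| * ((beta.+1 * #|V|) ^ #|V| * F).
Proof.
move=> Jx; apply: (choice_count (W := J) (f := fun G j => red G j :|: place H j)) => //.
  move=> G j GS jJ; have /drawableP[pr gr] := red_drawable GS jJ.
  have ji := J_inj GS jJ; have ar := red_away GS jJ.
  rewrite inE glue_has // glue_card // red_card // !andbT; apply/drawableP.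
  by split; [exact: glue_pair|exact: glue_grid_minor].
move=> G2 _; set P := [set _ | _].
pose W := [set u | copy_at H G2 u].
have [->|/set0Pn[[G0 j0]]] := eqVneq P set0; first by rewrite cards0.
have PP G j : (G, j) \in P -> [/\ G \in S, j \in J G & red G j :|: place H j = G2].
  by rewrite inE /= => /and3P[? ? /eqP].
move=> /PP[G0S j0J G02].
have Wle : #|W| <= beta.+1 * #|V|.
  have /drawableP[pr gr] := red_drawable G0S j0J.
  have [B Bb loc] := red_local G0S j0J.
  rewrite /W -G02; apply: leq_trans (card_copies _ _ pr _ _ loc) _ => //.
  - exact: S_pair.
  - exact: S_no.
  - exact: J_inj G0S j0J.
  - exact: red_away.
  - by rewrite leq_mul2r ltnS Bb orbT.
rewrite -sum1_card (partition_big snd (mem (@ffun_on V (mem W)))) /=; last first.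
  move=> [G j] /PP[GS jJ G2E]; apply/ffun_onP => v; rewrite inE -G2E.
  have /drawableP[pr gr] := red_drawable GS jJ.
  by apply: glue_copy => //; [exact: J_inj GS jJ|exact: red_away].
apply: (@leq_trans (\sum_(j in @ffun_on V (mem W)) F)); last first.
  rewrite sum_nat_const leq_mul2r (@card_ffun_on V T (mem W)); apply/orP; right.
  by rewrite leq_exp2r ?Wle //; case/andP: cH.
apply: leq_sum => j _; rewrite sum1_card.
apply: leq_trans (fibre (G2 :\: place H j) j).
apply: leq_trans (leq_imset_card (fun G => (G, j)) _).
apply: subset_leq_card; apply/subsetP => -[G j'].
rewrite unfold_in /= => /andP[/PP[GS jJ G2E] /eqP j'E]; rewrite j'E in jJ G2E *.
apply/imsetP; exists G => //; rewrite !inE GS jJ -G2E /=.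
have /drawableP[pr gr] := red_drawable GS jJ.
by rewrite glue_diff //; [exact: J_inj GS jJ|exact: red_away].
Qed.

End Count.
End Absorb.

Lemma drawable_sub (T : finType) (G G' : {set {set T}}) : G' \subset G -> drawable G -> drawable G'.
Proof.
move=> sub /drawableP[pG gG]; apply/drawableP; split; last exact: grid_minor_sub gG.
by move=> e /(subsetP sub)/pG.
Qed.

Lemma card_pairs (T : finType) : #|[set e : {set T} | #|e| == 2]| <= #|T| ^ 2.
Proof.
rewrite -mulnn -card_prod -cardsT; apply: leq_trans (leq_imset_card (fun p => [set p.1; p.2]) _).
apply: subset_leq_card; apply/subsetP => e; rewrite inE => /cards2P[x [y [_ ->]]].
by apply/imsetP; exists (x, y).
Qed.

Definition injections (V T : finType) (X : {set T}) : {set {ffun V -> T}} :=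
  [set j : {ffun V -> T} in ffun_on (mem X) | injectiveb j].

Lemma injectionsP (V T : finType) (X : {set T}) (j : {ffun V -> T}) :
  j \in injections V X -> injective j /\ forall v, j v \in X.
Proof. by rewrite inE => /andP[/ffun_onP jX /injectiveP]. Qed.

(** As n >= 2g|V|, every factor |X| - i of the falling factorial is still at least n / 2g. *)
Lemma card_injections (V T : finType) (X : {set T}) g n :
  n <= g * #|X| -> 2 * g * #|V| <= n -> n ^ #|V| <= (2 * g) ^ #|V| * #|injections V X|.
Proof.
move=> nX Vn; rewrite card_inj_ffuns_on ffact_prod.
have -> : n ^ #|V| = \prod_(i < #|V|) n by rewrite prod_nat_const card_ord.
have -> : (2 * g) ^ #|V| = \prod_(i < #|V|) (2 * g) by rewrite prod_nat_const card_ord.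
rewrite -big_split /=; apply: leq_prod => i _.
have h : 2 * g * i <= 2 * g * #|V| by rewrite leq_mul2l (ltnW (ltn_ord i)) orbT.
set x := #|_|; have -> : x = #|X| by apply: eq_card.
by rewrite mulnBr; lia.
Qed.

(** * Adding and deleting edges off a component H *)

Section Ratios.
Context (V T : finType) (H : {set {set V}}).
Hypotheses (pH : pair_graph H) (cH : connected_graph H) (gH : grid_minor H).
Local Notation P k := (with_copy T H k k).

Lemma with_copyP k G : reflect [/\ drawable G, has_component_iso H G & #|G| = k] (G \in P k).
Proof.
rewrite inE -eqn_leq eq_sym; apply: (iffP and3P) => [[? ? /eqP]|[? ? ->]] //.
Qed.

Lemma card_pair_fibre (I A : finType) (Q : {set A * I}) (D : {set I}) :
  (forall p q, p \in Q -> q \in Q -> p.2 = q.2 -> p.1 = q.1) ->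
  (forall p, p \in Q -> p.2 \in D) -> #|Q| <= #|D|.
Proof.
move=> inj QD; rewrite -(card_in_imset (f := snd) (D := mem Q)).
  by apply: subset_leq_card; apply/subsetP => _ /imsetP[p pQ ->]; exact: QD.
  by move=> [a i] [b k] pQ qQ /= e; have /= -> := inj _ _ pQ qQ e; rewrite e.
Qed.

(** The rest of the graph lives on |T| - |V| vertices and extends there to at least 3(|T| - |V|) - 6
    edges, any new one of which can be added. In the result the added edge is one of m + 1. *)
Lemma copy_extend m : 4 <= #|T| - #|V| ->
  #|P m| * (3 * (#|T| - #|V|) - 6 - m) <= #|P m.+1| * m.+1.
Proof.
move=> n4; pose W (G : {set {set T}}) := [set e | (e \notin G) && (e |: G \in P m.+1)].
apply: (choice_count (W := W) (f := fun G e => e |: G)).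
- move=> G /with_copyP[/drawableP[pG gG] hG cG].
  have [j [ji GE]] := has_component_split pG hG.
  set G0 := away G (img j) in GE; have aG0 : away G0 (img j) = G0.
    by apply/setP => e; rewrite !inE -andbA andbb.
  have sub0 : G0 \subset G by apply/subsetP => e; rewrite inE => /andP[].
  have /drawableP[pG0 gG0] : drawable G0 by apply: (drawable_sub sub0); exact/drawableP.
  have U0 e : e \in G0 -> e \subset ~: img j by rewrite inE disjoints_subset => /andP[].
  have cU : #|~: img j| = #|T| - #|V| by rewrite cardsCs setCK card_img.
  have [|E' [sE pE gE UE cE]] := grid_minor_extend pG0 gG0 U0; first by rewrite cU.
  have cG0 : #|G0| + #|H| = m by rewrite -cG GE glue_card.
  apply: (@leq_trans #|E' :\: G0|).
    by rewrite cardsD (setIidPr sE); move: cE; rewrite cU; lia.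
  apply: subset_leq_card; apply/subsetP => e; rewrite in_setD => /andP[eG0 eE].
  have aE : away (e |: G0) (img j) = e |: G0.
    apply/setP => x; rewrite inE; case: (boolP (x \in e |: G0)) => //=.
    by rewrite in_setU1 disjoints_subset => /orP[/eqP -> |/U0 //]; exact: UE.
  have sub1 : e |: G0 \subset E' by rewrite subUset sub1set eE.
  have /drawableP[pe ge] : drawable (e |: G0) by apply: (drawable_sub sub1); exact/drawableP.
  have eG : e |: G = (e |: G0) :|: place H j by rewrite {1}GE setUA.
  rewrite inE eG; have -> /= : e \notin G.
    rewrite GE inE (negPf eG0) /=; apply/negP => /place_img eI.
    have := UE e eE; rewrite -disjoints_subset => /pred0P dis.
    have /cards2P[x [y [_ eE']]] := pE _ eE; have := dis x.
    by rewrite /= (subsetP eI) eE' !inE eqxx.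
  apply/with_copyP; split; last by rewrite glue_card // cardsU1 eG0 -cG0.
    by apply/drawableP; split; [exact: glue_pair|exact: glue_grid_minor].
  exact: glue_has.
- by move=> G e _; rewrite inE => /andP[].
- move=> b /with_copyP[_ _ <-]; apply: card_pair_fibre => [p q|p]; rewrite !inE.
    move=> /and3P[_ /andP[np _] /eqP pb] /and3P[_ /andP[nq _] /eqP qb] pq.
    by rewrite -[p.1](setU1K np) -[q.1](setU1K nq) pb qb pq.
  by move=> /and3P[_ _ /eqP <-]; rewrite !inE eqxx.
Qed.

(** Any edge off the copy can be deleted, and it is restored by naming a pair of vertices. *)
Lemma copy_delete m : #|P m.+1| * (m.+1 - #|H|) <= #|P m| * #|T| ^ 2.
Proof.
pose W (G : {set {set T}}) := [set e in G | G :\ e \in P m].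
apply: leq_trans (leq_mul (leqnn _) (card_pairs T)).
apply: (choice_count (W := W) (f := fun G e => G :\ e)).
- move=> G /with_copyP[/drawableP[pG gG] hG cG].
  have [j [ji GE]] := has_component_split pG hG.
  set G0 := away G (img j) in GE; have aG0 : away G0 (img j) = G0.
    by apply/setP => e; rewrite !inE -andbA andbb.
  have sub0 : G0 \subset G by apply/subsetP => e; rewrite inE => /andP[].
  have /drawableP[pG0 gG0] : drawable G0 by apply: (drawable_sub sub0); exact/drawableP.
  have cG0 : #|G0| + #|H| = m.+1 by rewrite -cG GE glue_card.
  apply: (@leq_trans #|G0|); first by lia.
  apply: subset_leq_card; apply/subsetP => e eG0; have eG := subsetP sub0 e eG0.
  have ne : e \notin place H j.
    have := place_disjoint H ji pG0 aG0; rewrite disjoint_subset => /subsetP/(_ e eG0).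
    by rewrite inE.
  rewrite inE eG /=; apply/with_copyP; split.
  + by apply: (@drawable_sub _ G); [exact: subD1set|apply/drawableP].
  + rewrite {1}GE setDUl; have -> : place H j :\ e = place H j.
      by apply/setP => x; rewrite !inE; case: eqVneq => // ->; rewrite (negPf ne).
    apply: glue_has => //; first by move=> x; rewrite inE => /andP[_ /pG0].
    apply/setP => x; rewrite !inE; case: eqVneq => //= _.
    by case: (x \in G) => //=; rewrite andbb.
  + by have := cardsD1 e G; rewrite eG cG; lia.
- by move=> G e _; rewrite inE => /andP[].
- move=> b _; apply: card_pair_fibre => [p q|p]; rewrite !inE.
    move=> /and3P[_ /andP[np _] /eqP pb] /and3P[_ /andP[nq _] /eqP qb] pq.
    by rewrite -(setD1K np) -(setD1K nq) pb qb pq.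
  by move=> /and3P[/andP[/drawableP[pG _] _] /andP[pG' _] _]; exact: pG.
Qed.

(** The hypothesis says m <= (3 - 1/s)|T|. Hence at least |T| / 2s edges can be added, and the added
    one is among at most 3|T|: a factor 6s per step. *)
Lemma copy_extend_iter s m i : 0 < s -> s * m + #|T| <= 3 * s * #|T| ->
  2 * s * (3 * #|V| + 6) <= #|T| -> i <= m -> #|P (m - i)| <= (6 * s) ^ i * #|P m|.
Proof.
move=> s0 sm sn; elim: i => [|i IH] im; first by rewrite subn0 mul1n.
apply: (@leq_trans (6 * s * #|P (m - i)|)); last first.
  by rewrite expnS -(mulnA (6 * s)) leq_mul2l (IH (ltnW im)) orbT.
have n4 : 4 <= #|T| - #|V| by nia.
have := copy_extend (m - i.+1) n4; have -> : (m - i.+1).+1 = m - i by lia.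
move: #|P _| #|P _| => y x le.
have h1 : #|T| <= 2 * s * (3 * (#|T| - #|V|) - 6 - (m - i.+1)) by nia.
have h2 : m - i <= 3 * #|T| by nia.
have T0 : 0 < #|T| by lia.
rewrite -(leq_pmul2r T0); apply: (@leq_trans (2 * s * (y * (m - i)))); last first.
  by have := leq_mul (leqnn (2 * s * y)) h2; lia.
by apply: leq_trans (leq_mul (leqnn x) h1) _; rewrite mulnCA leq_mul2l le orbT.
Qed.

(** At least |T| / q - |H| >= |T| / 2q edges can be deleted, against at most |T|^2 ways to restore
    one: a factor 2q|T| per step. *)
Lemma copy_delete_iter q m i : #|T| <= q * m -> 2 * q * #|H| <= #|T| -> 0 < #|T| ->
  #|P (m + i)| <= (2 * q * #|T|) ^ i * #|P m|.
Proof.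
move=> qm qn T0; elim: i => [|i IH]; first by rewrite addn0 mul1n.
apply: (@leq_trans (2 * q * #|T| * #|P (m + i)|)); last first.
  by rewrite expnS -(mulnA (2 * q * #|T|)) leq_mul2l IH orbT.
have := copy_delete (m + i); rewrite addnS; move: #|P _| #|P _| => y x le.
have h1 : #|T| <= 2 * q * ((m + i).+1 - #|H|) by nia.
rewrite -(leq_pmul2r T0); apply: (@leq_trans (2 * q * (y * #|T| ^ 2))); last by rewrite -mulnn; lia.
by apply: leq_trans (leq_mul (leqnn x) h1) _; rewrite mulnCA leq_mul2l le orbT.
Qed.

(** Freeing vertices loses a varying number of edges, so up to [L] may be missing after planting;
    each deficit is repaired separately. *)
Lemma copy_range s m L : 0 < s -> s * m + #|T| <= 3 * s * #|T| ->
  2 * s * (3 * #|V| + 6) <= #|T| ->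
  #|with_copy T H (m - L) m| <= L.+1 * (6 * s) ^ L * #|P m|.
Proof.
move=> s0 sm sn.
have sub : with_copy T H (m - L) m \subset \bigcup_(i in [set: 'I_L.+1]) P (m - minn i m).
  apply/subsetP => G; rewrite inE => /and3P[dG hG cG].
  have iL : m - #|G| < L.+1 by lia.
  apply/bigcupP; exists (Ordinal iL); [by rewrite inE|]; apply/with_copyP; split=> //.
  rewrite -[nat_of_ord (Ordinal iL)]/(m - #|G|) (minn_idPl (leq_subr _ _)) subKn //.
  by case/andP: cG.
apply: leq_trans (subset_leq_card sub) _.
apply: leq_trans (card_bigcup_leq (k := (6 * s) ^ L * #|P m|) _) _; last first.
  by rewrite cardsT card_ord mulnA.
move=> i _; apply: leq_trans (copy_extend_iter s0 sm sn (geq_minr i m)) _.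
by rewrite leq_mul2r leq_pexp2l ?muln_gt0 ?orbT //; have := ltn_ord i; lia.
Qed.

End Ratios.

(** * Removable vertices *)

Section Degrees.
Context (T : finType).
Implicit Types (G : {set {set T}}) (U X K : {set T}).

Definition nbr G x := [set y | [set x; y] \in G].

Lemma nbrC G x y : (y \in nbr G x) = (x \in nbr G y).
Proof. by rewrite !inE setUC. Qed.

Lemma nbr_neq G x y : pair_graph G -> y \in nbr G x -> x != y.
Proof. by move=> pG; rewrite inE => /pG; rewrite card_set2. Qed.

Lemma handshake G : pair_graph G -> \sum_x #|nbr G x| <= 2 * #|G|.
Proof.
move=> pG; apply: (@leq_trans (\sum_x \sum_(e in G | x \in e) 1)).
  apply: leq_sum => x _; rewrite sum1_card.
  rewrite -(@card_in_imset _ _ (fun y => [set x; y])) => [|y z yx zx]; last first.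
    by move/set2_inj => [[]|[-> ->]].
  apply: subset_leq_card; apply/subsetP => _ /imsetP[y yx ->].
  by rewrite unfold_in /=; move: yx; rewrite inE => -> ; rewrite !inE eqxx.
rewrite (exchange_big_dep (mem G)) /=; last by move=> x e _ /andP[].
rewrite mulnC -sum_nat_const; apply: leq_sum => e eG; have /eqP <- := pG e eG.
by rewrite sum1_card; apply: subset_leq_card; apply/subsetP => x /andP[].
Qed.

Lemma drawable_edges G U : drawable G -> (forall e, e \in G -> e \subset U) -> #|G| <= 3 * #|U|.
Proof.
move=> /drawableP[pG gG] GU; have [|UG] := ltnP #|G| #|U|; first by lia.
have [->//|G0] := posnP #|G|.
have := @euler_upper T G U 3 pG GU gG G0 UG; move: #|U| #|G| => u m.
suff : forall Z : {set {set T}}, Z \subset G -> Z != set0 -> even_set Z -> 3 <= #|Z| by move=> h /(_ h); lia.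
by move=> Z ZG; apply: even_set_ge3 => e /(subsetP ZG)/pG.
Qed.

(** An edge xa is continued at [a] by some x'a, and the edges at x and at x' form disjoint sets of
    at least two. *)
Lemma even_set_bipartite (Z : {set {set T}}) X K : [disjoint X & K] ->
  (forall e, e \in Z -> exists x a, [/\ x \in X, a \in K & e = [set x; a]]) ->
  Z != set0 -> even_set Z -> 4 <= #|Z|.
Proof.
move=> XK ZP /set0Pn[e eZ] ev.
have nXK x a : x \in X -> a \in K -> x != a.
  by move=> xX aK; apply: contraTneq aK => <-; rewrite (disjointFr XK).
have Z2 d : d \in Z -> #|d| == 2.
  by move=> /ZP[x [a [xX aK ->]]]; rewrite card_set2 nXK.
have ZX y a : a \in K -> [set a; y] \in Z -> y \in X.
  move=> aK /ZP[x [b [xX bK /set2_inj[[ax _]|[_ ->//]]]]].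
  by rewrite ax (disjointFr XK xX) in aK.
have [x [a [xX aK eE]]] := ZP e eZ; rewrite eE in eZ.
have [x' [x'x x'a x'Z]] : exists c, [/\ c != x, c != a & [set a; c] \in Z].
  by apply: even_set_other => //; [rewrite eq_sym; exact: nXK|rewrite setUC].
have x'X := ZX _ _ aK x'Z.
have ge2 z d : d \in Z -> z \in d -> 2 <= #|[set d in Z | z \in d]|.
  move=> dZ zd; have := ev z; have : 0 < #|[set d in Z | z \in d]|.
    by apply/card_gt0P; exists d; rewrite inE dZ.
  by case: #|_| => [|[|]].
have dis : [set d in Z | x \in d] :&: [set d in Z | x' \in d] = set0.
  apply/setP => d; rewrite !inE; apply/negP => /andP[/andP[dZ xd] /andP[_ x'd]].
  move: xd x'd; have [y [c [yX cK ->]]] := ZP d dZ; rewrite !inE.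
  have /negPf -> := nXK x c xX cK; have /negPf -> := nXK x' c x'X cK.
  by rewrite !orbF => /eqP xy /eqP x'y; rewrite x'y xy eqxx in x'x.
have := cardsU [set d in Z | x \in d] [set d in Z | x' \in d]; rewrite dis cards0 subn0 => cU.
apply: (@leq_trans #|[set d in Z | x \in d] :|: [set d in Z | x' \in d]|).
  by rewrite cU; apply: (@leq_add 2 2); [apply: ge2 eZ _|apply: ge2 x'Z _]; rewrite !inE eqxx ?orbT.
by apply: subset_leq_card; apply/subsetP => d; rewrite !inE => /orP[] /andP[].
Qed.

Lemma bipartite_edges G X K : drawable G -> [disjoint X & K] ->
  (forall e, e \in G -> exists x a, [/\ x \in X, a \in K & e = [set x; a]]) ->
  #|G| <= 2 * (#|X| + #|K|).
Proof.
move=> /drawableP[pG gG] XK GP; have cU : #|X :|: K| = #|X| + #|K|.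
  by rewrite cardsU disjoint_setI0 // cards0 subn0.
have GU e : e \in G -> e \subset X :|: K.
  by move=> /GP[x [a [xX aK ->]]]; rewrite subUset !sub1set !inE xX aK orbT.
have [|UG] := ltnP #|G| #|X :|: K|; first by rewrite cU; lia.
have [->//|G0] := posnP #|G|.
have := @euler_upper T G _ 4 pG GU gG G0 UG; rewrite cU; move: #|X| #|K| #|G| => u k m.
suff : forall Z : {set {set T}}, Z \subset G -> Z != set0 -> even_set Z -> 4 <= #|Z| by move=> h /(_ h); lia.
by move=> Z ZG; apply: (even_set_bipartite XK) => e /(subsetP ZG)/GP.
Qed.

Lemma heavy_few G d : pair_graph G -> d.+1 * #|[set x | d < #|nbr G x|]| <= 2 * #|G|.
Proof.
move=> /handshake; apply: leq_trans; rewrite mulnC -sum_nat_const.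
rewrite [leqRHS](bigID (fun x => d < #|nbr G x|)) /=; apply: leq_trans (leq_addr _ _).
by rewrite big_set /= (eq_bigl (fun x => d < #|nbr G x|)) //; apply: leq_sum.
Qed.

(** A maximal independent subset of [X] dominates [X]. *)
Lemma independent_subset G X d : (forall x, x \in X -> #|nbr G x| <= d) ->
  (forall x, x \notin nbr G x) ->
  exists I : {set T}, [/\ I \subset X, forall x y, x \in I -> y \in I -> y \notin nbr G x &
    #|X| <= d.+1 * #|I|].
Proof.
move=> Xd irr; pose P (I : {set T}) := (I \subset X) && [forall x in I, [disjoint nbr G x & I]].
have [|I /maxsetP[/andP[IX ind] Imax] _] := @maxset_exists T P set0.
  by rewrite /P sub0set; apply/forallP => x; rewrite inE.
have indI x y : x \in I -> y \in I -> y \notin nbr G x.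
  by move=> xI yI; have /forall_inP/(_ x xI) dis := ind; rewrite (disjointFl dis yI).
exists I; split=> //.
apply: (@leq_trans #|I :|: \bigcup_(x in I) nbr G x|).
  apply: subset_leq_card; apply/subsetP => y yX; rewrite inE.
  have [//|yI /=] := boolP (y \in I); apply: contraT => nb.
  have nyx x : x \in I -> y \notin nbr G x.
    by move=> xI; apply: contra nb => yx; apply/bigcupP; exists x.
  suff /Imax/(_ (subsetUr _ _)) eI : P (y |: I) by rewrite -eI setU11 in yI.
  rewrite /P subUset sub1set yX IX; apply/forall_inP => x xI.
  rewrite -setI_eq0; apply/eqP/setP => z; rewrite in_setI in_setU1 in_set0; apply: negbTE.
  apply/negP => /andP[zx]; move: xI; rewrite in_setU1.
  move=> /orP[/eqP xy|xI] /orP[/eqP zy|zI].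
  - by move: zx; rewrite xy zy (negPf (irr y)).
  - by move: zx; rewrite xy nbrC (negPf (nyx z zI)).
  - by move: zx; rewrite zy (negPf (nyx x xI)).
  - by move: zx; rewrite (negPf (indI x z xI zI)).
apply: leq_trans (leq_card_setU _ _) _; rewrite mulSn leq_add2l mulnC.
by apply: card_bigcup_leq => x /(subsetP IX); exact: Xd.
Qed.

End Degrees.

Section Structure.
Context (T : finType) (d : nat).
Implicit Types (G : {set {set T}}) (X K : {set T}).

Definition isolated G := [set x | nbr G x == set0].
Definition light G := [set x | #|nbr G x| <= d].
Definition light_pairs G := [set x in light G | ~~ [disjoint nbr G x & light G]].
Definition slim G := [set x in light G :\: light_pairs G | 0 < #|nbr G x| <= 2].
(** On slim vertices it depends only on the neighbourhood, so each class of twins keeps one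
    model. *)
Definition twin_rep G x := odflt x [pick y in slim G | nbr G y == nbr G x].
(** These can be deleted and later restored by pointing at their representatives, which are never
    deleted themselves. *)
Definition twinned G := slim G :\: [set twin_rep G x | x in slim G].

Lemma slim_nbr G x : x \in slim G -> nbr G x \subset ~: light G.
Proof.
by rewrite !inE => /andP[/andP[h l] _]; rewrite l /= negbK disjoints_subset in h.
Qed.

Lemma twin_repP G x : x \in slim G ->
  [/\ twin_rep G x \in slim G & nbr G (twin_rep G x) = nbr G x].
Proof.
move=> xs; rewrite /twin_rep; case: pickP => [y /andP[ys /eqP e] //|/(_ x)].
by rewrite xs eqxx.
Qed.

Lemma twin_rep_eq G x y : x \in slim G -> y \in slim G -> nbr G x = nbr G y ->
  twin_rep G x = twin_rep G y.
Proof.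
move=> xs ys e; rewrite /twin_rep (@eq_pick _ _ (fun z => (z \in slim G) && (nbr G z == nbr G y))).
  by case: pickP => [//|/(_ y)]; rewrite ys eqxx.
by move=> z; rewrite e.
Qed.

(* Contracting one vertex with neighbourhood {a, b} onto a makes ab an edge. *)
Lemma pair_neighbourhoods G X K : drawable G -> [disjoint X & K] ->
  #|[set N : {set T} | [&& #|N| == 2, N \subset K & [exists x in X, nbr G x == N]]]| <= 3 * #|K|.
Proof.
move=> dG XK; have /drawableP[pG gG] := dG.
set E := [set N | _]; apply: drawable_edges => [|N]; last by rewrite inE => /and3P[].
apply/drawableP; split; first by move=> N; rewrite inE => /andP[].
pose xi N := [pick x in X | nbr G x == N].
have xiP N : N \in E -> exists x, [/\ xi N = Some x, x \in X & nbr G x = N].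
  rewrite inE => /and3P[_ _ /exists_inP[x xX xN]]; rewrite /xi.
  by case: pickP => [y /andP[yX /eqP yN]|/(_ x)]; [exists y|rewrite xX xN].
pose g x := if x \in K then Some x else
  if (x \in X) && (nbr G x \in E) && (xi (nbr G x) == Some x) then [pick a in nbr G x] else None.
have gK x : x \in K -> g x = Some x by rewrite /g => ->.
have gX x c : g x = Some c -> x \notin K -> c \in nbr G x /\ c \in K.
  rewrite /g; case: ifP => // xK; case: ifP => // /andP[/andP[_ xE] _].
  case: pickP => // a ax [<-] _; split=> //.
  by move: xE; rewrite inE => /and3P[_ /subsetP/(_ a ax)].
apply: (grid_minor_map (g := g)) gG.
- move=> a b c ga gb.
  have h x : g x = Some c -> x = c \/ [set x; c] \in G.
    move=> gx; have [xK|xK] := boolP (x \in K); first by move: gx; rewrite gK // => -[->]; left.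
    by have [] := gX x c gx xK; rewrite inE; right.
  have cK : c \in K.
    have [aK|aK] := boolP (a \in K); first by move: ga; rewrite gK // => -[<-].
    by have [] := gX a c ga aK.
  by exists c; split; [exact: gK|exact: h|exact: h].
- move=> a b ab abE; have [x [xiE xX xN]] := xiP _ abE.
  have abK : [set a; b] \subset K by move: abE; rewrite inE => /and3P[].
  have aK : a \in K by rewrite (subsetP abK) // !inE eqxx.
  have bK : b \in K by rewrite (subsetP abK) // !inE eqxx orbT.
  have ax : [set x; a] \in G by have : a \in nbr G x; [rewrite xN !inE eqxx|rewrite inE].
  have bx : [set x; b] \in G by have : b \in nbr G x; [rewrite xN !inE eqxx orbT|rewrite inE].
  have : g x = Some a \/ g x = Some b.
    rewrite /g (disjointFr XK xX) xX xN abE xiE eqxx /=; case: pickP => [c|/(_ a)].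
      by rewrite !inE => /orP[] /eqP ->; [left|right].
    by rewrite !inE eqxx.
  case=> gx; first by exists x, b; split=> //; exact: gK.
  by exists a, x; split=> //; [exact: gK|rewrite setUC].
Qed.

(** Representatives have distinct neighbourhoods. These are single heavy vertices, or pairs of heavy
    vertices, and such pairs form a planar graph by [pair_neighbourhoods]. *)
Lemma slim_reps G : drawable G -> #|[set twin_rep G x | x in slim G]| <= 4 * #|~: light G|.
Proof.
move=> dG; have sl : [disjoint slim G & ~: light G].
  by rewrite disjoints_subset setCK; apply/subsetP => x; rewrite inE => /andP[/setDP[]].
rewrite -(@card_in_imset _ _ (nbr G)) => [|_ _ /imsetP[x xs ->] /imsetP[y ys ->]]; last first.
  have [_ ->] := twin_repP xs; have [_ ->] := twin_repP ys; exact: twin_rep_eq.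
set Q := [set N : {set T} | [&& #|N| == 2, N \subset ~: light G & [exists x in slim G, nbr G x == N]]].
have Qle : #|Q| <= 3 * #|~: light G| by exact: pair_neighbourhoods.
apply: (@leq_trans #|[set [set a] | a in ~: light G] :|: Q|); last first.
  by apply: leq_trans (leq_card_setU _ _) _; rewrite card_imset; [lia|exact: set1_inj].
apply: subset_leq_card; apply/subsetP => _ /imsetP[_ /imsetP[x xs ->] ->].
have [_ ->] := twin_repP xs; have sub := slim_nbr xs.
have : 0 < #|nbr G x| <= 2 by move: xs; rewrite inE => /andP[].
rewrite in_setU => /andP[c1 c2]; apply/orP.
have [/cards1P[a aE]|n1] := boolP (#|nbr G x| == 1).
  by left; rewrite aE; apply: imset_f; rewrite -sub1set -aE.
right; rewrite inE sub; have -> /= : #|nbr G x| == 2 by lia.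
by apply/exists_inP; exists x.
Qed.

(** The edges at these vertices all lead to the set K of heavy vertices. They form a bipartite
    planar graph with at least 3|X| and at most 2(|X| + |K|) edges. *)
Lemma branching_few G : drawable G ->
  #|[set x in light G :\: light_pairs G | 2 < #|nbr G x|]| <= 2 * #|~: light G|.
Proof.
move=> dG; set X := [set x in _ | _].
have XK : [disjoint X & ~: light G].
  by rewrite disjoints_subset setCK; apply/subsetP => x; rewrite inE => /andP[/setDP[]].
have nX x : x \in X -> nbr G x \subset ~: light G.
  by rewrite !inE => /andP[/andP[h l] _]; rewrite l /= negbK disjoints_subset in h.
pose E := [set e in G | [exists x in X, x \in e]].
have EP e : e \in E -> exists x a, [/\ x \in X, a \in ~: light G & e = [set x; a]].
  rewrite inE => /andP[eG /exists_inP[x xX xe]].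
  have /drawableP[pG _] := dG; have /cards2P[y [z [yz eE]]] := pG _ eG.
  have [w eW] : exists w, e = [set x; w].
    by move: xe; rewrite eE !inE => /orP[] /eqP ->; [exists z|exists y; rewrite setUC].
  exists x, w; split=> //; apply: (subsetP (nX x xX)); by rewrite inE -eW.
have dE : drawable E by apply: drawable_sub dG; apply/subsetP => e; rewrite inE => /andP[].
have := bipartite_edges dE XK EP.
have : #|X| * 3 <= #|E| * 1.
  apply: (choice_count (W := nbr G) (f := fun x a => [set x; a])).
  - by move=> x; rewrite inE => /andP[].
  - move=> x a xX; rewrite [a \in _]inE inE => -> /=.
    by apply/exists_inP; exists x; rewrite // !inE eqxx.
  - move=> b _; apply/card_le1_eqP => -[x a] [y c].
    rewrite in_set /= => /and3P[xX ax /eqP xE]; rewrite in_set /= => /and3P[yX cy /eqP]; rewrite -xE => /esym/set2_inj.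
    have cK : c \in ~: light G by rewrite (subsetP (nX y yX)).
    case=> [[-> ->] //|[xc _]].
    by move: cK; rewrite -xc (disjointFr XK xX).
lia.
Qed.

End Structure.

(** With d = 119 at most 2|G| / 120 <= n / 20 vertices are heavy, so there are at most n / 10
    branching vertices and n / 5 representatives. The three classes cover the remaining 13n / 20 or
    more. *)
Lemma vertex_trichotomy (T : finType) (G : {set {set T}}) : drawable G -> #|G| <= 3 * #|T| ->
  [\/ #|T| <= 10 * #|isolated G|, #|T| <= 10 * #|light_pairs 119 G| | #|T| <= 10 * #|twinned 119 G|].
Proof.
move=> dG G3; have /drawableP[pG _] := dG.
have h1 : 120 * #|~: light 119 G| <= 2 * #|G|.
  suff -> : ~: light 119 G = [set x | 119 < #|nbr G x|] by exact: heavy_few.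
  by apply/setP => x; rewrite !inE ltnNge.
have h2 := branching_few 119 dG; have h3 := slim_reps 119 dG.
set X3 := [set x in _ | _] in h2; set R := [set _ | x in _] in h3.
have cover : [set: T] = ~: light 119 G :|: (isolated G :|: (light_pairs 119 G :|: (X3 :|: (R :|: twinned 119 G)))).
  apply/setP => x; rewrite !in_setU in_setC in_setD -/R !inE.
  case: (x \in R) => /=; first by rewrite !orbT.
  case: (#|nbr G x| <= 119) => //=; rewrite -cards_eq0.
  by case: [disjoint _ & _] => //=; case: #|nbr G x| => [|[|[|k]]].
have : #|T| <= #|~: light 119 G| + (#|isolated G| + (#|light_pairs 119 G| + (#|X3| + (#|R| + #|twinned 119 G|)))).
  rewrite -cardsT cover; do 4 (apply: leq_trans (leq_card_setU _ _) _; rewrite leq_add2l).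
  exact: leq_card_setU.
move: #|isolated G| #|light_pairs _ G| #|twinned _ G| #|T| #|G| #|X3| #|R| #|~: _| G3 h1 h2 h3.
move=> i l t n m x r k G3 h1 h2 h3 h.
by have [?|[?|?]] : n <= 10 * i \/ (n <= 10 * l \/ n <= 10 * t) by [lia];
  [constructor 1|constructor 2|constructor 3].
Qed.

(** * Counting graphs without the component *)

Section Stars.
Context (T : finType) (G : {set {set T}}) (X : {set T}) (D : nat).
Hypothesis pG : pair_graph G.
Hypothesis indX : forall x y, x \in X -> y \in X -> y \notin nbr G x.
Hypothesis degX : forall x, x \in X -> 0 < #|nbr G x| <= D.

Definition around := \bigcup_(x in X) nbr G x.

Lemma card_around : #|around| <= #|X| * D.
Proof. by apply: card_bigcup_leq => x /degX/andP[]. Qed.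

Lemma away_or_star e : e \in G -> e \notin away G X -> exists x y, [/\ x \in X, y \in nbr G x & e = [set x; y]].
Proof.
move=> eG; rewrite inE eG /= => /pred0Pn[x /= /andP[xe xX]].
have /cards2P[y [z [yz eE]]] := pG eG.
by move: xe; rewrite eE !inE => /orP[] /eqP xE; [exists x, z|exists x, y];
  split=> //; rewrite ?inE xE ?(setUC [set z]) -?eE // setUC.
Qed.

Lemma off_around e u : e \in G -> u \in e -> u \notin X -> u \notin around -> e \in away G X.
Proof.
move=> eG ue uX uB; apply: contraT => /(away_or_star eG)[x [y [xX yx eE]]].
move: ue; rewrite eE !inE => /orP[] /eqP uE; first by rewrite uE xX in uX.
by case/negP: uB; apply/bigcupP; exists x; rewrite ?uE.
Qed.

Lemma away_sub : away G X \subset G.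
Proof. by apply/subsetP => e; rewrite inE => /andP[]. Qed.

(** As [X] is independent, the edges at its different vertices are different, so at least one is
    lost for each. *)
Lemma card_away : #|away G X| + #|X| <= #|G| <= #|away G X| + D * #|X|.
Proof.
have cD : #|G :\: away G X| = #|G| - #|away G X| by rewrite cardsD (setIidPr away_sub).
have le := subset_leq_card away_sub.
have : #|G :\: away G X| <= D * #|X|.
  apply: (@leq_trans #|\bigcup_(x in X) [set [set x; y] | y in nbr G x]|).
    apply: subset_leq_card; apply/subsetP => e; rewrite in_setD => /andP[eA eG].
    have [x [y [xX yx ->]]] := away_or_star eG eA.
    by apply/bigcupP; exists x => //; apply: imset_f.
  rewrite mulnC; apply: card_bigcup_leq => x /degX/andP[_]; apply: leq_trans.
  exact: leq_imset_card.
have : #|X| * 1 <= #|G :\: away G X| * 1.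
  apply: (choice_count (W := nbr G) (f := fun x y => [set x; y])).
  - by move=> x /degX/andP[].
  - move=> x y xX; rewrite inE => xy; rewrite in_setD xy andbT inE xy /=.
    by apply/pred0Pn; exists x; rewrite /= !inE eqxx.
  - move=> b _; apply/card_le1_eqP => -[x a] [y c].
    rewrite in_set /= => /and3P[xX ax /eqP xE]; rewrite in_set /= => /and3P[yX cy /eqP].
    rewrite -xE => /esym/set2_inj[[-> ->] //|[_ ay]].
    by have := indX xX yX; rewrite -ay ax.
by rewrite cD; lia.
Qed.

End Stars.

Section Types.
Context (V T : finType) (H : {set {set V}}) (m : nat).
Hypotheses (pH : pair_graph H) (cH : connected_graph H) (gH : grid_minor H).
Let h := #|V|.
Let n := #|T|.

Definition without_copy : {set {set {set T}}} :=
  [set G | [&& drawable G, ~~ has_component_iso H G & #|G| == m]].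

Lemma without_copyP G : G \in without_copy -> [/\ drawable G, ~~ has_component_iso H G & #|G| = m].
Proof. by rewrite inE => /and3P[? ? /eqP]. Qed.

Lemma pair_of_drawable (G : {set {set T}}) : drawable G -> pair_graph G.
Proof. by case/drawableP. Qed.

Lemma choice_rate (A C B : finType) (S : {set A}) (S' : {set B}) (J : A -> {set C}) k N y :
  (forall x, (forall a, a \in S -> x <= #|J a|) -> #|S| * x <= #|S'| * y) ->
  (forall a, a \in S -> N <= k * #|J a|) -> #|S| * N <= k * (#|S'| * y).
Proof.
move=> cnt rate; have [->|/set0Pn[a0 a0S]] := eqVneq S set0; first by rewrite cards0.
have [a aS amin] := arg_minnP (fun a => #|J a|) a0S.
apply: (@leq_trans (k * (#|S| * #|J a|))); last by rewrite leq_mul2l cnt ?orbT.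
by rewrite mulnCA leq_mul2l rate ?orbT.
Qed.

(** Nothing is freed, so [G] is the new graph without the planted copy ([F = 1]); the result has |H|
    surplus edges. *)
Lemma isolated_count : 2 * 10 * h <= n ->
  #|[set G in without_copy | n <= 10 * #|isolated G|]| * n ^ h <=
  (2 * 10) ^ h * (#|with_copy T H (m + #|H|) (m + #|H|)| * ((1 * h) ^ h * 1)).
Proof.
move=> hn; set S := [set G in _ | _].
have SP G : G \in S -> [/\ drawable G, ~~ has_component_iso H G, #|G| = m & n <= 10 * #|isolated G|].
  by rewrite inE => /andP[/without_copyP[? ? ?]].
apply: (choice_rate (J := fun G => injections V (isolated G))) => [x|G /SP[_ _ _ le]]; last first.
  exact: card_injections.
apply: (@absorb_count V T H pH cH gH S _ (fun G j => G) _ _ 0 1).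
- by move=> G /SP[/pair_of_drawable].
- by move=> G /SP[].
- by move=> G j /SP[].
- by move=> G j _ /injectionsP[].
- move=> G j /SP[/pair_of_drawable pG _ _ _] /injectionsP[_ jX].
  apply/setP => e; rewrite inE; have [eG|//] := boolP (e \in G); apply/pred0P => x0 /=.
  apply/negP => /andP[xe /imsetP[v _ xE]].
  have := jX v; rewrite inE -xE; have /cards2P[y [z [_ eE]]] := pG _ eG.
  move: xe eG; rewrite eE !inE => /orP[] /eqP -> eG /eqP/setP.
    by move/(_ z); rewrite !inE eG.
  by move/(_ y); rewrite !inE setUC eG.
- by move=> G j /SP[_ _ -> _] _; rewrite leqnn.
- by move=> G j _ _; exists set0; rewrite ?cards0.
- move=> G1 j; apply/card_le1_eqP => G G'; rewrite in_set => /and3P[_ _ /eqP ->].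
  by rewrite in_set => /and3P[_ _ /eqP ->].
Qed.

Lemma twinned_facts (G : {set {set T}}) (j : {ffun V -> T}) d : j \in injections V (twinned d G) ->
  [/\ injective j, (forall x y, x \in img j -> y \in img j -> y \notin nbr G x),
    (forall x, x \in img j -> 0 < #|nbr G x| <= 2) & forall v, j v \in slim d G].
Proof.
move=> /injectionsP[ji jX]; have jS v : j v \in slim d G by have := jX v; rewrite inE => /andP[].
split=> //.
- move=> _ _ /imsetP[v _ ->] /imsetP[w _ ->]; apply/negP => /(subsetP (slim_nbr (jS v))).
  by have := jS w; rewrite inE in_setC => /andP[/setDP[-> _]].
- by move=> _ /imsetP[v _ ->]; have := jS v; rewrite inE => /andP[].
Qed.

(** Between h and 2h edges are lost and |H| <= h gained. [G] is rebuilt from the list of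
    representatives of the deleted vertices. *)
Lemma twinned_count d : 2 * 10 * h <= n -> #|H| <= h ->
  #|[set G in without_copy | n <= 10 * #|twinned d G|]| * n ^ h <=
  (2 * 10) ^ h * (#|with_copy T H (m - 2 * h) m| * (((h * 2).+1 * h) ^ h * n ^ h)).
Proof.
move=> hn He; set S := [set G in _ | _].
have SP G : G \in S -> [/\ drawable G, ~~ has_component_iso H G, #|G| = m & n <= 10 * #|twinned d G|].
  by rewrite inE => /andP[/without_copyP[? ? ?]].
apply: (choice_rate (J := fun G => injections V (twinned d G))) => [x|G /SP[_ _ _ le]]; last first.
  exact: card_injections.
apply: (@absorb_count V T H pH cH gH S _ (fun G j => away G (img j)) _ _ (h * 2) (n ^ h)).
- by move=> G /SP[/pair_of_drawable].
- by move=> G /SP[].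
- by move=> G j /SP[dG _ _ _] _; apply: drawable_sub dG; exact: away_sub.
- by move=> G j _ /injectionsP[].
- by move=> G j _ _; apply/setP => e; rewrite !inE -andbA andbb.
- move=> G j /SP[dG _ cG _] /twinned_facts[ji ind deg _].
  have := card_away (pair_of_drawable dG) ind deg; rewrite card_img // cG -/h.
  by move: #|away _ _| => k; lia.
- move=> G j /SP[dG _ cG _] /twinned_facts[ji ind deg _].
  exists (around G (img j)).
    by have := card_around deg; rewrite card_img.
  move=> e u ue uX uB; apply/idP/idP => [eG|]; last exact: (subsetP (away_sub _ _)).
  exact: (off_around (pair_of_drawable dG) eG ue).
- move=> G1 j.
  pose rebuild (y : {ffun V -> T}) :=
    G1 :|: \bigcup_(v in [set: V]) [set [set j v; u] | u in nbr G1 (y v)].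
  apply: (@leq_trans #|rebuild @: [set: {ffun V -> T}]|); last first.
    by apply: leq_trans (leq_imset_card _ _) _; rewrite cardsT card_ffun.
  apply: subset_leq_card; apply/subsetP => G; rewrite in_set => /and3P[/SP[dG _ _ _] jJ /eqP G1E].
  have [ji ind deg jS] := twinned_facts jJ.
  apply/imsetP; exists [ffun v => twin_rep d G (j v)]; rewrite ?inE //.
  (* The representative was not chosen and its neighbours are heavy, while the deleted vertices are
     light, so its neighbourhood is intact in [G1]. *)
  have nb v : nbr G1 (twin_rep d G (j v)) = nbr G (j v).
    have [rs <-] := twin_repP (jS v); apply/setP => u.
    rewrite !inE -G1E inE; have [eG|//] := boolP (_ \in G); rewrite /=.
    apply/pred0P => x0 /=; apply/negP => /andP[]; rewrite !inE => /orP[] /eqP -> /imsetP[w _ wE].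
      have [_ jX] := injectionsP jJ; have := jX w; rewrite inE -wE.
      by move=> /andP[/negP[]]; apply/imsetP; exists (j v).
    have := subsetP (slim_nbr rs) u; rewrite inE eG wE in_setC => /(_ isT).
    by have := jS w; rewrite inE => /andP[/setDP[-> _]].
  apply/setP => e; rewrite in_setU; apply/idP/orP => [eG|[|/bigcupP[v _ /imsetP[u]]]].
  + have [eA|eA] := boolP (e \in away G (img j)); first by left; rewrite -G1E.
    right; have [_ [u [/imsetP[v _ ->] ux ->]]] := away_or_star (pair_of_drawable dG) eG eA.
    by apply/bigcupP; exists v; rewrite ?inE // ffunE nb; apply: imset_f.
  + by rewrite -G1E; exact: (subsetP (away_sub _ _)).
  + by rewrite ffunE nb inE => eG ->.
Qed.

End Types.

(** * Contracting one edge at each vertex of an independent set *)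

Section Contract.
Context (T : finType) (G : {set {set T}}) (X : {set T}) (pi : T -> T) (D : nat).
Hypothesis dG : drawable G.
Hypothesis indX : forall x y, x \in X -> y \in X -> y \notin nbr G x.
Hypothesis degX : forall x, x \in X -> 0 < #|nbr G x| <= D.
Hypothesis piX : forall x, x \in X -> pi x \in nbr G x.
Let pG : pair_graph G := pair_of_drawable dG.

Definition merge x := if x \in X then pi x else x.
Definition contract := [set merge @: (e : {set T}) | e in G & #|merge @: (e : {set T})| == 2].

Lemma merge_notin x : merge x \notin X.
Proof.
rewrite /merge; case: ifP => [xX|->//]; apply/negP => pX.
by have := indX xX pX; rewrite piX.
Qed.

Lemma merge_away e : e \in away G X -> merge @: e = e.
Proof.
rewrite inE => /andP[_ dis]; rewrite -[RHS]imset_id; apply: eq_in_imset => x xe.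
by rewrite /merge (disjointFr dis xe).
Qed.

Lemma away_contract : away G X \subset contract.
Proof.
apply/subsetP => e eA; have eG := subsetP (away_sub _ _) e eA.
apply/imsetP; exists e; last by rewrite merge_away.
by rewrite inE eG merge_away // pG.
Qed.

Lemma contractP e : e \in contract -> e \in away G X \/
  exists x u, [/\ x \in X, u \in nbr G x, u \notin X & e = [set pi x; u]].
Proof.
case/imsetP=> f; rewrite inE => /andP[fG c2] eE.
have [fA|fA] := boolP (f \in away G X); first by left; rewrite eE merge_away.
right; have [x [u [xX ux fE]]] := away_or_star pG fG fA; exists x, u.
have uX : u \notin X by apply: contraTN ux => uX; exact: indX.
by split=> //; rewrite eE fE imsetU1 imset_set1 /merge xX (negPf uX).
Qed.

Lemma contract_pair : pair_graph contract.
Proof. by move=> e /imsetP[f]; rewrite inE => /andP[_ c2] ->. Qed.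

Lemma contract_away : away contract X = contract.
Proof.
apply/setP => e; rewrite inE; have [/imsetP[f _ ->]|//] := boolP (e \in contract).
apply/pred0P => x /=; apply: negbTE; apply/negP => /andP[/imsetP[y _ ->]].
by rewrite (negPf (merge_notin y)).
Qed.

(** The fibres of [merge] are stars, since independence keeps [pi x] outside [X]. *)
Lemma contract_drawable : drawable contract.
Proof.
apply/drawableP; split; first exact: contract_pair.
have /drawableP[_ gG] := dG; apply: (grid_minor_map (g := fun x => Some (merge x))) gG.
- move=> a b c [ac] [bc]; have cX : c \notin X by rewrite -ac merge_notin.
  have hub x : merge x = c -> x = c \/ [set x; c] \in G.
    rewrite /merge; case: ifP => [xX <-|_ ->]; [right|by left].
    by have := piX xX; rewrite inE.
  exists c; split; [by rewrite /merge (negPf cX)|exact: hub|exact: hub].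
- move=> a b ab /imsetP[e]; rewrite inE => /andP[eG _] abE.
  have /imsetP[x xe aE] : a \in merge @: e by rewrite -abE !inE eqxx.
  have /imsetP[y ye bE] : b \in merge @: e by rewrite -abE !inE eqxx orbT.
  exists x, y; split; rewrite ?aE ?bE //.
  rewrite (_ : [set x; y] = e) //; apply/eqP.
  rewrite eqEcard subUset !sub1set xe ye /= (eqP (pG eG)) cards2.
  by case: (x =P y) => // xy; move: ab; rewrite aE bE xy eqxx.
Qed.

(** The edges from x to [pi x] are distinct and collapse, while all edges off [X] survive. *)
Lemma card_contract : #|contract| + #|X| <= #|G| <= #|contract| + D * #|X|.
Proof.
have /andP[_ up] := card_away pG indX degX.
have low := subset_leq_card away_contract.
suff le : #|contract| + #|X| <= #|G|.
  by rewrite le /=; apply: leq_trans up _; rewrite leq_add2r.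
pose P := [set [set x; pi x] | x in X].
have PG : P \subset G.
  by apply/subsetP => _ /imsetP[x xX ->]; have := piX xX; rewrite inE.
have cP : #|P| = #|X|.
  rewrite card_in_imset // => x y xX yX /set2_inj[[//]|[xy _]].
  by have := indX yX xX; rewrite xy piX.
have : #|contract| <= #|G :\: P|.
  apply: leq_trans (leq_imset_card (fun e : {set T} => merge @: e) _).
  apply: subset_leq_card; apply/subsetP => f /imsetP[e]; rewrite inE => /andP[eG c2] ->.
  apply: imset_f; rewrite in_setD eG andbT; apply/negP => /imsetP[x xX eE]; move: c2.
  have pX : pi x \notin X by apply/negP => pX; have := indX xX pX; rewrite piX.
  by rewrite eE imsetU1 imset_set1 /merge xX (negPf pX) setUid cards1.
have := subset_leq_card PG; rewrite cardsD (setIidPr PG) cP => XG.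
by rewrite leq_subRL // addnC.
Qed.

Lemma contract_local (e : {set T}) u : u \in e -> u \notin X -> u \notin around G X -> (e \in G) = (e \in contract).
Proof.
move=> ue uX uB; have toA (f : {set T}) : f \in G -> u \in f -> f \in away G X.
  by move=> fG uf; apply: (off_around pG fG uf).
apply/idP/idP => [eG|/contractP[/(subsetP (away_sub _ _)) //|[x [w [xX wx _ eE]]]]].
  by apply: (subsetP away_contract); exact: toA.
by move: ue; rewrite eE !inE => /orP[] /eqP uE; case/negP: uB; apply/bigcupP; exists x; rewrite // uE // piX.
Qed.

Lemma contract_nbr y : nbr contract y \subset nbr G y :|: around G X.
Proof.
apply/subsetP => u; rewrite inE => /contractP[/(subsetP (away_sub _ _)) yu|[x [w [xX wx _ /set2_inj yu]]]].
  by rewrite !inE yu.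
rewrite in_setU; apply/orP; right; apply/bigcupP; exists x => //.
by case: yu => [[_ ->]|[_ ->]] //; exact: piX.
Qed.

(* The contraction only changes edges from this set, which is determined by *)
(* the contracted graph together with X and pi. *)
Definition near_contraction (G1 : {set {set T}}) :=
  \bigcup_(x in X) ([set [set pi x; u] | u in nbr G1 (pi x)] :|: [set [set x; u] | u in pi x |: nbr G1 (pi x)]).

Lemma contract_outside : G :\: near_contraction contract = contract :\: near_contraction contract.
Proof.
apply/setP => e; rewrite !in_setD; have [//|eQ /=] := boolP (e \in near_contraction contract).
apply/idP/idP => [eG|ec].
  have [eA|eA] := boolP (e \in away G X); first exact: (subsetP away_contract).
  have [x [u [xX ux eE]]] := away_or_star pG eG eA; case/negP: eQ.
  apply/bigcupP; exists x; rewrite // in_setU; apply/orP; right; rewrite eE; apply: imset_f.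
  rewrite in_setU1; have [//|upi /=] := eqVneq u (pi x).
  have uX : u \notin X by apply: contraTN ux => uX; exact: indX.
  rewrite inE; apply/imsetP; exists e; last by rewrite eE imsetU1 imset_set1 /merge xX (negPf uX).
  by rewrite inE eG eE imsetU1 imset_set1 /merge xX (negPf uX) card_set2 eq_sym.
case: (contractP ec) => [/(subsetP (away_sub _ _)) //|[x [u [xX ux _ eE]]]]; case/negP: eQ.
apply/bigcupP; exists x; rewrite // in_setU; apply/orP; left; rewrite eE; apply: imset_f.
by rewrite inE -eE.
Qed.

Lemma card_near_contraction (G1 : {set {set T}}) k : (forall x, x \in X -> #|nbr G1 (pi x)| <= k) ->
  #|near_contraction G1| <= #|X| * (k + k.+1).
Proof.
move=> nk; apply: card_bigcup_leq => x xX; apply: leq_trans (leq_card_setU _ _) _.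
apply: leq_add; apply: leq_trans (leq_imset_card _ _) _; first exact: nk.
by rewrite cardsU1; have := nk x xX; case: (_ \notin _); lia.
Qed.

End Contract.

Section LightType.
Context (V T : finType) (H : {set {set V}}) (m d : nat).
Hypotheses (pH : pair_graph H) (cH : connected_graph H) (gH : grid_minor H).
Let h := #|V|.
Let n := #|T|.

(** A choice determined by [G]: large, and independent so that all its vertices can be contracted at
    once. *)
Definition spread (G : {set {set T}}) : {set T} :=
  odflt set0 [pick I : {set T} | [&& I \subset light_pairs d G,
    [forall x in I, [forall y in I, y \notin nbr G x]] & #|light_pairs d G| <= d.+1 * #|I|]].

Definition partner (G : {set {set T}}) x := odflt x [pick y in nbr G x | y \in light d G].

Lemma spreadP G : drawable G -> [/\ spread G \subset light_pairs d G,
  (forall x y, x \in spread G -> y \in spread G -> y \notin nbr G x) &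
  #|light_pairs d G| <= d.+1 * #|spread G|].
Proof.
move=> dG; rewrite /spread; case: pickP => [I /and3P[IL /forall_inP ind c]|none] /=.
  by split=> // x y xI yI; have /forall_inP := ind x xI; apply.
have [||I [IL ind c]] := @independent_subset T G (light_pairs d G) d.
- by move=> x; rewrite inE => /andP[]; rewrite inE.
- by move=> x; apply/negP => /(nbr_neq (pair_of_drawable dG)); rewrite eqxx.
have := none I; rewrite IL c andbT /=; case/forall_inP => x xI; apply/forall_inP => y yI.
exact: ind.
Qed.

Lemma partnerP G x : x \in light_pairs d G -> partner G x \in nbr G x /\ partner G x \in light d G.
Proof.
rewrite inE => /andP[_ /pred0Pn[y /andP[yx yl]]]; rewrite /partner.
by case: pickP => [z /andP[zx zl] //|/(_ y)] /=; move: yx yl => /= -> ->.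
Qed.

Lemma card_agree_off (Q G1 : {set {set T}}) :
  #|[set G : {set {set T}} | G :\: Q == G1 :\: Q]| <= 2 ^ #|Q|.
Proof.
rewrite -card_powerset; apply: leq_trans (leq_imset_card (fun A => G1 :\: Q :|: A) _).
apply: subset_leq_card; apply/subsetP => G; rewrite inE => /eqP GE.
by apply/imsetP; exists (G :&: Q); rewrite ?inE ?subsetIr // -GE setUC setID.
Qed.

(** Bounds the degree of a partner after contraction: at most d neighbours of its own and at most dh
    vertices around the contracted ones. *)
Let k := d * h.+1.

(** To undo the contraction, name the partners, in at most n^h ways. They have bounded degree after
    contraction, so the edges that may have changed lie in a set of bounded size, and boundedly many
    graphs remain. *)
Lemma light_count : 2 * (10 * d.+1) * h <= n -> #|H| <= h ->
  #|[set G in without_copy T H m | n <= 10 * #|light_pairs d G|]| * n ^ h <=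
  (2 * (10 * d.+1)) ^ h * (#|with_copy T H (m - d * h) m| *
    (((h * d).+1 * h) ^ h * (n ^ h * 2 ^ (h * (k + k.+1))))).
Proof.
move=> hn He; set S := [set G in _ | _].
have SP G : G \in S -> [/\ drawable G, ~~ has_component_iso H G, #|G| = m & n <= 10 * #|light_pairs d G|].
  by rewrite inE => /andP[/without_copyP[? ? ?]].
apply: (choice_rate (J := fun G => injections V (spread G))) => [x|G /SP[dG _ _ le]]; last first.
  apply: card_injections hn; have [_ _ c] := spreadP dG.
  by apply: leq_trans le _; rewrite -mulnA leq_mul2l c orbT.
have facts G j : G \in S -> j \in injections V (spread G) ->
    [/\ injective j, (forall x y, x \in img j -> y \in img j -> y \notin nbr G x),
      (forall x, x \in img j -> 0 < #|nbr G x| <= d),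
      (forall x, x \in img j -> partner G x \in nbr G x) &
      (forall x, x \in img j -> partner G x \in light d G)].
  move=> /SP[dG _ _ _] /injectionsP[ji jX]; have [IL ind _] := spreadP dG.
  have jL x0 : x0 \in img j -> x0 \in light_pairs d G.
    by move=> /imsetP[v _ ->]; exact: (subsetP IL).
  split=> //.
  - by move=> _ _ /imsetP[v _ ->] /imsetP[w _ ->]; exact: ind.
  - move=> x0 /jL x0L; have [px _] := partnerP x0L; apply/andP; split.
      by apply/card_gt0P; exists (partner G x0).
    by move: x0L; rewrite inE => /andP[]; rewrite inE.
  - by move=> x0 /jL/partnerP[].
  - by move=> x0 /jL/partnerP[].
apply: (@absorb_count V T H pH cH gH S _ (fun G j => contract G (img j) (partner G)) _ _ (h * d)
  (n ^ h * 2 ^ (h * (k + k.+1)))).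
- by move=> G /SP[/pair_of_drawable].
- by move=> G /SP[].
- by move=> G j GS /(facts G j GS)[ji ind deg prt _]; have [dG _ _ _] := SP G GS; exact: contract_drawable.
- by move=> G j _ /injectionsP[].
- by move=> G j GS /(facts G j GS)[ji ind deg prt _]; have [dG _ _ _] := SP G GS; exact: contract_away.
- move=> G j GS /(facts G j GS)[ji ind deg prt _]; have [dG _ cG _] := SP G GS.
  have := card_contract dG ind deg prt; rewrite card_img // cG -/h.
  by move: #|contract _ _ _| => c; lia.
- move=> G j GS /(facts G j GS)[ji ind deg prt _]; have [dG _ _ _] := SP G GS.
  exists (around G (img j)).
    by have := card_around deg; rewrite card_img.
  by move=> e u ue uX uB; exact: (contract_local dG ind prt ue uX uB).
move=> G1 j.
pose Q (y : {ffun V -> T}) := \bigcup_(v in [set: V])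
  ([set [set y v; u] | u in nbr G1 (y v)] :|: [set [set j v; u] | u in y v |: nbr G1 (y v)]).
(* The true partners always give a small [Q y]; the empty default makes the bound uniform over all
   guesses [y]. *)
pose F y := if #|Q y| <= h * (k + k.+1) then [set G : {set {set T}} | G :\: Q y == G1 :\: Q y] else set0.
apply: (@leq_trans #|\bigcup_(y in [set: {ffun V -> T}]) F y|); last first.
  rewrite -[n ^ h]card_ffun -cardsT; apply: card_bigcup_leq => y _; rewrite /F.
  case: ifP => [c|_]; last by rewrite cards0.
  by apply: leq_trans (card_agree_off _ _) _; rewrite leq_pexp2l.
apply: subset_leq_card; apply/subsetP => G; rewrite in_set => /and3P[GS jJ /eqP G1E].
have [ji ind deg prt prtl] := facts G j GS jJ; have [dG _ _ _] := SP G GS.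
apply/bigcupP; exists [ffun v => partner G (j v)]; first by rewrite inE.
have QE : Q [ffun v => partner G (j v)] = near_contraction (img j) (partner G) G1.
  apply/setP => e; apply/bigcupP/bigcupP => [[v _]|[_ /imsetP[v _ ->]]].
    by rewrite ffunE => h1; exists (j v) => //; exact: imset_f.
  by move=> h1; exists v => //; rewrite ffunE.
rewrite /F QE ifT.
  by rewrite inE -G1E; apply/eqP; exact: (contract_outside _ dG ind).
suff nk x0 : x0 \in img j -> #|nbr G1 (partner G x0)| <= k.
  by have := @card_near_contraction _ G (img j) (partner G) G1 k nk; rewrite card_img.
move=> xX; rewrite -G1E; apply: leq_trans (subset_leq_card (contract_nbr dG ind prt _)) _.
apply: leq_trans (leq_card_setU _ _) _; rewrite /k mulnS leq_add //.
  by have := prtl x0 xX; rewrite inE.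
by have := card_around deg; rewrite card_img // mulnC.
Qed.

End LightType.

Lemma exists_drawable (T : finType) m : 4 <= #|T| -> m + 6 <= 3 * #|T| ->
  exists G : {set {set T}}, drawable G /\ #|G| = m.
Proof.
move=> T4 mT; have g0 : grid_minor (set0 : {set {set T}}).
  by exists (fun=> None), 0; split=> // a b _; rewrite inE.
have [|||E [_ pE gE _ cE]] := @grid_minor_extend T [set: T] set0 _ g0.
- by move=> e; rewrite inE.
- by move=> e; rewrite inE.
- by rewrite cardsT.
pose G := [set e in take m (enum E)].
have cG : #|G| = m.
  rewrite cardsE (card_uniqP (take_uniq _ (enum_uniq _))) size_takel // -cardE.
  by move: cE; rewrite cardsT; lia.
exists G; split=> //; apply: (@drawable_sub _ E); last by apply/drawableP.
by apply/subsetP => e; rewrite inE => /mem_take; rewrite mem_enum.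
Qed.

Lemma cancel_rate x N A R B C p : 0 < N -> x * N <= A * (R * (B * N)) -> R <= C * p ->
  x <= A * B * C * p.
Proof.
move=> N0 h RC; rewrite -(leq_pmul2r N0); apply: (leq_trans h).
have := leq_mul (leqnn (A * B * N)) RC.
by rewrite (_ : A * (R * (B * N)) = A * B * N * R) 1?(_ : A * B * C * p * N = A * B * N * (C * p)); lia.
Qed.

Lemma cancel_rate2 x N A R B C D p : 0 < N -> x * N <= A * (R * B) -> R <= D * p -> D <= C * N ->
  x <= A * B * C * p.
Proof.
move=> N0 h RD DC; rewrite -(leq_pmul2r N0); apply: (leq_trans h).
have := leq_mul (leqnn (A * B)) (leq_trans RD (leq_mul DC (leqnn p))).
by rewrite (_ : A * (R * B) = A * B * R) 1?(_ : A * B * C * p * N = A * B * (C * N * p)); lia.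
Qed.

Lemma threshold a b c e n : a + b + c + 1 <= n -> e <= a -> [/\ 0 < n, e <= n, a <= n, b <= n & c <= n].
Proof. by move=> *; split; lia. Qed.

Lemma at_most_triple s m n : 0 < s -> s * m + n <= 3 * s * n -> m <= 3 * n.
Proof. nia. Qed.

Lemma without_copy_rate (V : finType) (H : {set {set V}}) q s :
  pair_graph H -> connected_graph H -> grid_minor H -> #|H| <= #|V| -> 0 < q -> 0 < s ->
  exists K N, forall (T : finType) m, N <= #|T| -> #|T| <= q * m -> s * m + #|T| <= 3 * s * #|T| ->
    #|without_copy T H m| <= K * #|with_copy T H m m|.
Proof.
move=> pH cH gH He q0 s0; set h := #|V|.
pose k := 119 * h.+1.
pose K1 := (2 * 10) ^ h * h ^ h * (2 * q) ^ h.
pose K2 := (2 * (10 * 120)) ^ h * (((h * 119).+1 * h) ^ h * 2 ^ (h * (k + k.+1))) *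
  ((119 * h).+1 * (6 * s) ^ (119 * h)).
pose K3 := (2 * 10) ^ h * (((h * 2).+1 * h) ^ h) * ((2 * h).+1 * (6 * s) ^ (2 * h)).
exists (K1 + K2 + K3), (2 * (10 * 120) * h + 2 * s * (3 * h + 6) + 2 * q * #|H| + 1) => T m nN nq sm.
have [|n0 n1 n2 n3 n4] := threshold (e := 2 * 10 * h) nN.
  by rewrite leq_mul2r; apply/orP; right.
set p := #|with_copy T H m m|.
have nh0 : 0 < #|T| ^ h by rewrite expn_gt0 n0.
pose S1 := [set G in without_copy T H m | #|T| <= 10 * #|isolated G|].
pose S2 := [set G in without_copy T H m | #|T| <= 10 * #|light_pairs 119 G|].
pose S3 := [set G in without_copy T H m | #|T| <= 10 * #|twinned 119 G|].
have b1 : #|S1| <= K1 * p.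
  have := isolated_count m pH cH gH n1; rewrite -/S1 mul1n muln1 => le.
  have del := copy_delete_iter cH #|H| nq n4 n0.
  (* The exponent condition |H| <= h enters here: the n^h choices gained pay for deleting |H| edges
     at a factor O(n) each. *)
  have up : (2 * q * #|T|) ^ #|H| <= (2 * q) ^ h * #|T| ^ h.
    by rewrite -expnMn leq_pexp2l // !muln_gt0 q0 n0.
  exact: cancel_rate2 nh0 le del up.
have b2 : #|S2| <= K2 * p.
  have := @light_count V T H m 119 pH cH gH n2 He; rewrite -/S2 -/h -/k => le.
  have rg := copy_range pH cH gH (119 * h) s0 sm n3.
  apply: cancel_rate nh0 _ rg; apply: leq_trans le _.
  by rewrite (mulnCA _ (#|T| ^ h)) (mulnC (#|T| ^ h)).
have b3 : #|S3| <= K3 * p.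
  have := @twinned_count V T H m pH cH gH 119 n1 He; rewrite -/S3 -/h => le.
  have rg := copy_range pH cH gH (2 * h) s0 sm n3.
  exact: cancel_rate nh0 le rg.
apply: (@leq_trans #|S1 :|: S2 :|: S3|).
  apply: subset_leq_card; apply/subsetP => G Gw; have [dG _ cG] := without_copyP Gw.
  have G3 : #|G| <= 3 * #|T| by rewrite cG; exact: at_most_triple sm.
  rewrite !in_setU ![_ \in [set _ in _ | _]]inE Gw.
  by case: (vertex_trichotomy dG G3) => ->; rewrite ?orbT.
apply: leq_trans (leq_card_setU _ _) _; rewrite !mulnDl leq_add //.
by apply: leq_trans (leq_card_setU _ _) _; rewrite leq_add.
Qed.

From mathcomp Require Import all_classical all_reals topology normedtype derive.
Import numFieldNormedType.Exports.

(** * Plane drawings of minors of the grid *)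

Section Geometry.
Local Open Scope ring_scope.
Context (R : realType).
Notation pt := (R * R)%type.
Implicit Types (x y z c d v : pt).

Lemma square_lower_bound (f : R -> R -> R) :
  continuous (fun z : pt => f z.1 z.2) ->
  (forall s t, 0 <= s <= 1 -> 0 <= t <= 1 -> 0 < f s t) ->
  exists2 eps : R, 0 < eps & forall s t, 0 <= s <= 1 -> 0 <= t <= 1 -> eps <= f s t.
Proof.
move=> cf fpos; pose A : set pt := (`[0, 1]%classic `*` `[0, 1]%classic)%classic.
have cA : compact A by apply: compact_setX; exact: segment_compact.
have A0 : (A !=set0)%classic.
  by exists (0, 0); split; rewrite /= in_itv /= lexx ler01.
have [c cA' cmin] := compact_EVT_min A0 cA (continuous_subspaceT cf).
exists (f c.1 c.2).
  by move/set_mem: cA' => [] /=; rewrite !in_itv /=; exact: fpos.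
move=> s t hs ht; apply: (cmin (s, t)); apply/mem_set.
by split; rewrite /= in_itv.
Qed.

Lemma finite_eps (I : finType) (P : I -> R -> Prop) :
  (forall i e e', 0 < e' <= e -> P i e -> P i e') ->
  (forall i, exists2 e, 0 < e & P i e) ->
  exists2 e, 0 < e & forall i, P i e.
Proof.
move=> Pmon Pex.
have [e eP] : exists e : I -> R, forall i, 0 < e i /\ P i (e i).
  by apply: (fin_all_exists (P := fun i e => 0 < e /\ P i e)) => i;
    have [e e0 Pe] := Pex i; exists e.
have pos : 0 < \big[Num.min/1]_i e i.
  by elim/big_ind: _ => // [a b a0 b0|i _]; [rewrite lt_min a0 b0|case: (eP i)].
exists (\big[Num.min/1]_i e i) => // i; apply: Pmon (eP i).2.
by rewrite pos /=; exact: bigmin_le_cond.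
Qed.

Definition on_segment (a b z : pt) : Prop :=
  exists2 t, 0 <= t <= 1 & z = ((1 - t) * a.1 + t * b.1, (1 - t) * a.2 + t * b.2).

Lemma on_segmentC a b z : on_segment a b z -> on_segment b a z.
Proof.
by case=> t t01 ->; exists (1 - t); [lra|congr (_, _); ring].
Qed.

Lemma on_segment_l a b : on_segment a b a.
Proof. by exists 0; [rewrite lexx ler01|case: a => ? ?; congr (_, _); rewrite /=; ring]. Qed.

Lemma on_segment_r a b : on_segment a b b.
Proof. exact/on_segmentC/on_segment_l. Qed.

Lemma pt_eq (a b : pt) : a.1 = b.1 -> a.2 = b.2 -> a = b.
Proof. by case: a b => ? ? [? ?] /= -> ->. Qed.

Definition l1 v : R := `|v.1| + `|v.2|.

Lemma l1_gt0 v : v <> 0 -> 0 < l1 v.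
Proof.
move=> v0; rewrite lt_neqAle addr_ge0 // andbT eq_sym paddr_eq0 // !normr_eq0.
by apply/negP => /andP[/eqP h1 /eqP h2]; apply: v0; exact: pt_eq.
Qed.

Lemma l1Z (k : R) v : 0 <= k -> l1 (k * v.1, k * v.2) = k * l1 v.
Proof. by move=> k0; rewrite /l1 /= !normrM ger0_norm // mulrDr. Qed.

Lemma affine_continuous (a b c d : R) :
  continuous (fun z : pt => `|a + b * z.1 + c * z.2 + d * (z.1 * z.2)|).
Proof.
move=> z; apply: (@continuous_comp _ _ _ (fun z : pt => a + b * z.1 + c * z.2 + d * (z.1 * z.2)) (@Num.norm _ R)).
  apply: cvgD; [apply: cvgD; [apply: cvgD; [exact: cvg_cst|]|]|].
  - by apply: cvgM; [exact: cvg_cst|exact: cvg_fst].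
  - by apply: cvgM; [exact: cvg_cst|exact: cvg_snd].
  - by apply: cvgM; [exact: cvg_cst|apply: cvgM; [exact: cvg_fst|exact: cvg_snd]].
exact: norm_continuous.
Qed.

Lemma affine_l1_continuous (a b c d a' b' c' d' : R) :
  continuous (fun z : pt => l1 (a + b * z.1 + c * z.2 + d * (z.1 * z.2),
                                a' + b' * z.1 + c' * z.2 + d' * (z.1 * z.2))).
Proof. by move=> z; apply: cvgD; exact: affine_continuous. Qed.

(** Over the unit square of parameters the difference of points on the two segments is bounded away
    from 0, and moving [x] by [v] changes it by at most the norm of [v]. *)
Lemma move_end_disjoint x y c d :
  (forall z, on_segment x y z -> on_segment c d z -> False) ->
  exists2 eps, 0 < eps & forall v, l1 v < eps -> forall z,
    on_segment (x.1 + v.1, x.2 + v.2) y z -> on_segment c d z -> False.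
Proof.
move=> dis.
pose f s t := l1 (y.1 - c.1 + (x.1 - y.1) * s + (c.1 - d.1) * t + 0 * (s * t),
                  y.2 - c.2 + (x.2 - y.2) * s + (c.2 - d.2) * t + 0 * (s * t)).
have cf : continuous (fun z : pt => f z.1 z.2).
  exact (@affine_l1_continuous (y.1 - c.1) (x.1 - y.1) (c.1 - d.1) 0
                              (y.2 - c.2) (x.2 - y.2) (c.2 - d.2) 0).
have [|eps eps0 fge] := square_lower_bound cf.
  move=> s t s01 t01; apply: l1_gt0 => -[e1 e2].
  apply: (dis ((1 - (1 - s)) * x.1 + (1 - s) * y.1, (1 - (1 - s)) * x.2 + (1 - s) * y.2)).
    by exists (1 - s) => //; lra.
  exists t => //; congr (_, _); apply/eqP; rewrite -subr_eq0; apply/eqP.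
    by rewrite -[RHS]e1; ring.
  by rewrite -[RHS]e2; ring.
exists eps => // v vlt z [s s01 zs] [t t01 zt].
have s'01 : 0 <= 1 - s <= 1 by lra.
have := fge (1 - s) t s'01 t01; rewrite leNgt => /negP; apply.
rewrite zs in zt; case: zt => /= e1 e2.
apply: le_lt_trans vlt.
have -> : f (1 - s) t = l1 ((1 - s) * (- v).1, (1 - s) * (- v).2).
  rewrite /f; congr (l1 (_, _)); rewrite /=.
    have : (1 - s) * (x.1 + v.1) + s * y.1 - ((1 - t) * c.1 + t * d.1) = 0 by rewrite e1 subrr.
    by move=> h; apply/eqP; rewrite -subr_eq0; apply/eqP; rewrite -[RHS]h; ring.
  have : (1 - s) * (x.2 + v.2) + s * y.2 - ((1 - t) * c.2 + t * d.2) = 0 by rewrite e2 subrr.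
  by move=> h; apply/eqP; rewrite -subr_eq0; apply/eqP; rewrite -[RHS]h; ring.
rewrite l1Z; last by lra.
have -> : l1 (- v) = l1 v by rewrite /l1 /= !normrN.
have : 0 <= l1 v by rewrite addr_ge0.
nra.
Qed.

(** Both segments contain [y], so directions at [y] are compared instead of points: the convex
    combinations of d - y and y - x are bounded away from 0. *)
Lemma move_end_common x y d : x <> y -> d <> y ->
  (forall z, on_segment x y z -> on_segment y d z -> z = y) ->
  exists2 eps, 0 < eps & forall v, l1 v < eps -> forall z,
    on_segment (x.1 + v.1, x.2 + v.2) y z -> on_segment y d z -> z = y.
Proof.
move=> xy dy com.
pose f (s t : R) := l1 (- (x.1 - y.1) + (d.1 - y.1 + (x.1 - y.1)) * s + 0 * t + 0 * (s * t),
                  - (x.2 - y.2) + (d.2 - y.2 + (x.2 - y.2)) * s + 0 * t + 0 * (s * t)).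
have fE s t : f s t = l1 (s * (d.1 - y.1) - (1 - s) * (x.1 - y.1),
                          s * (d.2 - y.2) - (1 - s) * (x.2 - y.2)).
  by congr (l1 (_, _)); ring.
have cf : continuous (fun z : pt => f z.1 z.2).
  exact (@affine_l1_continuous (- (x.1 - y.1)) (d.1 - y.1 + (x.1 - y.1)) 0 0
                              (- (x.2 - y.2)) (d.2 - y.2 + (x.2 - y.2)) 0 0).
have [|eps eps0 fge] := square_lower_bound cf.
  move=> s t s01 _; rewrite fE; apply: l1_gt0 => -[e1 e2].
  have s1 : s < 1.
    rewrite lt_neqAle; apply/andP; split; last by lra.
    apply/eqP => s1; apply: dy; apply: pt_eq; move: e1 e2; rewrite s1; lra.
  have s0 : 0 < s.
    rewrite lt_neqAle; apply/andP; split; last by lra.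
    apply/eqP => s0; apply: xy; apply: pt_eq; move: e1 e2; rewrite -s0; lra.
  have zz := com ((1 - s) * y.1 + s * d.1, (1 - s) * y.2 + s * d.2).
  have : ((1 - s) * y.1 + s * d.1, (1 - s) * y.2 + s * d.2) = y.
    apply: zz; last by exists s => //; lra.
    exists s; first by lra.
    congr (_, _); apply/eqP; rewrite -subr_eq0; apply/eqP.
      by rewrite -[RHS]e1; ring.
    by rewrite -[RHS]e2; ring.
  case: (y) (d) dy => y1 y2 [d1 d2] /= dy [h1 h2]; apply: dy.
  have h1' : s * (d1 - y1) = 0 by rewrite -[RHS](subrr y1) -{2}h1; ring.
  have h2' : s * (d2 - y2) = 0 by rewrite -[RHS](subrr y2) -{2}h2; ring.
  move/eqP: h1'; move/eqP: h2'; rewrite !mulf_eq0 (gt_eqF s0) /= !subr_eq0.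
  by move=> /eqP -> /eqP ->.
exists eps => // v vlt z [s s01 zs] [t t01 zt].
pose la := 1 - s.
have [tl0|tl0] := eqVneq (t + la) 0.
  have : t = 0 by move: tl0; rewrite /la; lra.
  by move=> t0; rewrite zt t0; apply: pt_eq; rewrite /=; ring.
exfalso.
have tlpos : 0 < t + la by rewrite lt_neqAle eq_sym tl0 /la; lra.
(* A common point other than [y] means t(d - y) = la(x + v - y); dividing by t + la turns this into
   a convex combination. *)
pose q := t / (t + la).
have q01 : 0 <= q <= 1.
  rewrite /q; apply/andP; split; first by apply: divr_ge0; [lra|exact: ltW].
  by rewrite ler_pdivrMr // mul1r /la; lra.
have z01 : 0 <= (0 : R) <= 1 by rewrite lexx ler01.
have := fge q 0 q01 z01; rewrite leNgt => /negP; apply.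
rewrite zs in zt; case: zt => /= e1 e2.
apply: le_lt_trans vlt.
have q1 : 1 - q = la / (t + la) by rewrite /q; field.
have la01 : 0 <= la / (t + la) <= 1 by rewrite -q1; lra.
have -> : f q 0 = l1 (la / (t + la) * v.1, la / (t + la) * v.2).
  rewrite fE q1 /q; congr (l1 (_, _)).
    have h : t * (d.1 - y.1) = la * (x.1 - y.1 + v.1).
      have : (1 - s) * (x.1 + v.1) + s * y.1 - ((1 - t) * y.1 + t * d.1) = 0 by rewrite e1 subrr.
      by rewrite /la => h; apply/eqP; rewrite eq_sym -subr_eq0; apply/eqP; rewrite -[RHS]h; ring.
    by rewrite mulrAC h; field.
  have h : t * (d.2 - y.2) = la * (x.2 - y.2 + v.2).
    have : (1 - s) * (x.2 + v.2) + s * y.2 - ((1 - t) * y.2 + t * d.2) = 0 by rewrite e2 subrr.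
    by rewrite /la => h; apply/eqP; rewrite eq_sym -subr_eq0; apply/eqP; rewrite -[RHS]h; ring.
  by rewrite mulrAC h; field.
rewrite l1Z; last by lra.
have : 0 <= l1 v by rewrite addr_ge0.
nra.
Qed.

End Geometry.

(** * Contracting an edge of a straight-line drawing *)

Section StraightLine.
Local Open Scope ring_scope.
Context (R : realType).
Notation pt := (R * R)%type.

(* Straight-line drawing: only the vertices on edges need be distinct points. *)
Record sl_drawing (X : finType) (G : rel X) (pos : X -> pt) : Prop := SlDrawing {
  sl_sym : symmetric G;
  sl_neq : forall a b, G a b -> pos a <> pos b;
  sl_cross : forall a b c d z, G a b -> G c d ->
    on_segment (pos a) (pos b) z -> on_segment (pos c) (pos d) z ->
    ((a = c /\ b = d) \/ (a = d /\ b = c)) \/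
    exists n, [/\ n = a \/ n = b, n = c \/ n = d & z = pos n]
}.

(** Contraction of [x] into [y] up to subdivision: an edge from [x] to w turns into a path from w to
    [y] with the bend [inr w], and [inl x] keeps no edge. *)
Definition contracted (X : finType) (G : rel X) (x y : X) : rel (X + X) :=
  fun u v => match u, v with
  | inl a, inl b => [&& a != x, b != x & G a b]
  | inl a, inr w => ((a == y) || (a == w)) && (G x w && (w != y))
  | inr w, inl a => ((a == y) || (a == w)) && (G x w && (w != y))
  | inr _, inr _ => false
  end.

Section Contraction.
Context (X : finType) (G : rel X) (pos : X -> pt) (x y : X).
Context (dG : sl_drawing G pos) (xy : G x y).

Let ux := (pos y).1 - (pos x).1.
Let uy := (pos y).2 - (pos x).2.
(** Signed distance from the line through [x] and [y], times the length of that edge. *)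
Definition height (z : pt) : R := ux * (z.2 - (pos x).2) - uy * (z.1 - (pos x).1).
Let h w := height (pos w).
Let nbr w := G x w && (w != y).

Lemma sl_irrefl a : G a a = false.
Proof. by apply/negP => /(sl_neq dG). Qed.

Lemma height_x : height (pos x) = 0.
Proof. by rewrite /height; ring. Qed.

Lemma height_y : height (pos y) = 0.
Proof. by rewrite /height /ux /uy; ring. Qed.

Lemma height_segment a b t :
  height ((1 - t) * a.1 + t * b.1, (1 - t) * a.2 + t * b.2) =
  (1 - t) * height a + t * height b.
Proof. by rewrite /height /=; ring. Qed.

Lemma star_cross w w' z : G x w -> G x w' -> w != w' ->
  on_segment (pos x) (pos w) z -> on_segment (pos x) (pos w') z -> z = pos x.
Proof.
move=> xw xw' ww' zw zw'; case: (sl_cross dG xw xw' zw zw') => [[[_ e]|[_ e]]|].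
- by rewrite e eqxx in ww'.
- by rewrite e sl_irrefl in xw.
case=> n [[->|->] // [e|e] zE]; first by rewrite e sl_irrefl in xw.
by rewrite e eqxx in ww'.
Qed.

(** On the same side of [x] as [y], such a neighbour would make two edges at [x] overlap. *)
Lemma behind w : nbr w -> h w = 0 -> exists2 k, k < 0 &
  pos w = ((pos x).1 + k * ux, (pos x).2 + k * uy).
Proof.
case/andP=> xw wy hw.
have u0 : 0 < ux ^+ 2 + uy ^+ 2.
  rewrite lt_neqAle addr_ge0 ?sqr_ge0 // andbT eq_sym paddr_eq0 ?sqr_ge0 //.
  rewrite !sqrf_eq0; apply/negP => /andP[/eqP u1 /eqP u2].
  by apply: (sl_neq dG xy); apply: pt_eq; move: u1 u2; rewrite /ux /uy; lra.
have uN0 := lt0r_neq0 u0.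
pose k := (ux * ((pos w).1 - (pos x).1) + uy * ((pos w).2 - (pos x).2)) / (ux ^+ 2 + uy ^+ 2).
have hw' : ux * ((pos w).2 - (pos x).2) = uy * ((pos w).1 - (pos x).1).
  by apply/eqP; rewrite -subr_eq0; apply/eqP.
have wE : pos w = ((pos x).1 + k * ux, (pos x).2 + k * uy).
  apply: pt_eq => /=; rewrite /k; apply: (mulIf uN0).
    have -> : ((pos x).1 + (ux * ((pos w).1 - (pos x).1) + uy * ((pos w).2 - (pos x).2)) /
      (ux ^+ 2 + uy ^+ 2) * ux) * (ux ^+ 2 + uy ^+ 2) =
      (pos x).1 * (ux ^+ 2 + uy ^+ 2) + (ux * ((pos w).1 - (pos x).1)) * ux +
      uy * (ux * ((pos w).2 - (pos x).2)) by field.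
    by rewrite hw'; ring.
  have -> : ((pos x).2 + (ux * ((pos w).1 - (pos x).1) + uy * ((pos w).2 - (pos x).2)) /
      (ux ^+ 2 + uy ^+ 2) * uy) * (ux ^+ 2 + uy ^+ 2) =
      (pos x).2 * (ux ^+ 2 + uy ^+ 2) + ux * (uy * ((pos w).1 - (pos x).1)) +
      (uy * ((pos w).2 - (pos x).2)) * uy by field.
  by rewrite -hw'; ring.
exists k => //; rewrite ltNge; apply/negP => k0.
have [kz|kz] := eqVneq k 0.
  by apply: (sl_neq dG xw); rewrite wE kz !mul0r !addr0 -surjective_pairing.
have kpos : 0 < k by rewrite lt_neqAle eq_sym kz.
pose m := 1 / (1 + k).
have km0 : 0 < 1 + k by lra.
pose z := ((pos x).1 + m * k * ux, (pos x).2 + m * k * uy).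
have mk01 : 0 <= m * k <= 1.
  by rewrite /m mul1r mulr_ge0 ?invr_ge0 ?(ltW km0) //= mulrC ler_pdivrMr // mul1r; lra.
have m01 : 0 <= m <= 1.
  by rewrite /m mul1r invr_ge0 (ltW km0) //= invf_le1 //; lra.
have /(star_cross xw xy wy) zx : on_segment (pos x) (pos w) z.
  by exists m => //; rewrite wE /z /=; congr (_, _); ring.
have /zx : on_segment (pos x) (pos y) z.
  by exists (m * k) => //; rewrite /z /ux /uy; congr (_, _); ring.
move=> zE.
have e1 : (pos x).1 + m * k * ux = (pos x).1 by rewrite -[in RHS]zE.
have e2 : (pos x).2 + m * k * uy = (pos x).2 by rewrite -[in RHS]zE.
have mkN0 : m * k != 0.
  by rewrite mulf_neq0 // /m mul1r invr_eq0 lt0r_neq0.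
have u1 : ux = 0 by apply: (mulfI mkN0); rewrite mulr0; move: e1; lra.
have u2 : uy = 0 by apply: (mulfI mkN0); rewrite mulr0; move: e2; lra.
by move: u0; rewrite u1 u2 expr0n /= addr0 ltxx.
Qed.

Lemma behind_unique w w' : nbr w -> nbr w' -> h w = 0 -> h w' = 0 -> w = w'.
Proof.
move=> nw nw' hw hw'; apply/eqP/negPn/negP => ww'.
wlog [k [k' [k0 k'k wE w'E]]] : w w' nw nw' hw hw' ww' / exists k k', [/\ k < 0, k' <= k,
    pos w = ((pos x).1 + k * ux, (pos x).2 + k * uy) &
    pos w' = ((pos x).1 + k' * ux, (pos x).2 + k' * uy)].
  move=> W; have [k k0 wE] := behind nw hw; have [k' k'0 w'E] := behind nw' hw'.
  have [kk|kk] := lerP k' k; first by apply: (W w w') => //; exists k, k'.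
  by apply: (W w' w) => //; [rewrite eq_sym|exists k', k; split=> //; exact: ltW].
have [xw _] := andP nw; have [xw' _] := andP nw'.
have k'0 : k' < 0 by apply: le_lt_trans k0.
have /(star_cross xw xw' ww') : on_segment (pos x) (pos w) (pos w) by exact: on_segment_r.
case/(_ _)/esym/(sl_neq dG xw) => //; exists (k / k').
  apply/andP; split; first by apply: mulr_le0; [exact: ltW|rewrite invr_le0; exact: ltW].
  by rewrite ler_ndivrMr // mul1r.
have k'N : k' != 0 by rewrite lt_eqF.
by rewrite wE w'E /=; congr (_, _); field.
Qed.

Definition slide (t : R) w : pt :=
  ((1 - t) * (pos x).1 + t * (pos w).1, (1 - t) * (pos x).2 + t * (pos w).2).

Lemma slide_segment t w : 0 <= t <= 1 -> on_segment (pos x) (pos w) (slide t w).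
Proof. by move=> t01; exists t. Qed.

Lemma height_slide t w : height (slide t w) = t * h w.
Proof. by rewrite height_segment height_x mulr0 add0r. Qed.

Lemma near_edge w c d : G x w -> G c d -> c != x -> d != x ->
  exists2 eps, 0 < eps & forall t, 0 <= t -> t < eps -> forall z,
    on_segment (slide t w) (pos y) z -> on_segment (pos c) (pos d) z ->
    (c = y \/ d = y) /\ z = pos y.
Proof.
move=> xw cd cx dx.
have xyn := sl_neq dG xy.
pose v : pt := ((pos w).1 - (pos x).1, (pos w).2 - (pos x).2).
have v0 : 0 < l1 v.
  apply: l1_gt0 => -[e1 e2]; apply: (sl_neq dG xw); apply: pt_eq; lra.
have slideE t : slide t w = ((pos x).1 + t * v.1, (pos x).2 + t * v.2).
  by rewrite /slide /v /=; congr (_, _); ring.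
have reduce (Q : pt -> Prop) : (exists2 eps, 0 < eps & forall u, l1 u < eps -> forall z,
      on_segment ((pos x).1 + u.1, (pos x).2 + u.2) (pos y) z -> Q z) ->
    exists2 eps, 0 < eps & forall t, 0 <= t -> t < eps -> forall z,
      on_segment (slide t w) (pos y) z -> Q z.
  case=> eps e0 H; exists (eps / l1 v); first by rewrite divr_gt0.
  move=> t t0; rewrite ltr_pdivlMr // => te z; rewrite slideE => zs.
  by apply: (H (t * v.1, t * v.2)) => //; rewrite l1Z.
suff : exists2 eps, 0 < eps & forall u, l1 u < eps -> forall z,
      on_segment ((pos x).1 + u.1, (pos x).2 + u.2) (pos y) z ->
      on_segment (pos c) (pos d) z -> (c = y \/ d = y) /\ z = pos y.
  exact: reduce.
have common z : on_segment (pos x) (pos y) z -> on_segment (pos c) (pos d) z ->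
    (c = y \/ d = y) /\ z = pos y.
  move=> zxy zcd; case: (sl_cross dG xy cd zxy zcd) => [[[e _]|[e _]]|].
  - by rewrite e eqxx in cx.
  - by rewrite e eqxx in dx.
  case=> n [[nx|ny] ncd zE].
    by case: ncd => e; move: cx dx; rewrite -e nx eqxx.
  by split; [case: ncd => <-; auto|rewrite -ny].
have [cy|cy] := eqVneq c y.
  have [||eps e0 H] := @move_end_common R (pos x) (pos y) (pos d) xyn.
  - by move=> e; apply: (sl_neq dG cd); rewrite cy e.
  - by move=> z zxy zcd; apply: (common _ _ _).2 => //; rewrite cy.
  exists eps => // u ue z zs zcd; split; first by left.
  by apply: H ue _ zs _; rewrite -cy.
have [dy|dy] := eqVneq d y.
  have [||eps e0 H] := @move_end_common R (pos x) (pos y) (pos c) xyn.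
  - by move=> e; apply: (sl_neq dG cd); rewrite dy e.
  - by move=> z zxy zcd; apply: (common _ _ _).2 => //; rewrite dy; exact: on_segmentC.
  exists eps => // u ue z zs zcd; split; first by right.
  by apply: H ue _ zs _; rewrite -dy; exact: on_segmentC.
have [|eps e0 H] := @move_end_disjoint R (pos x) (pos y) (pos c) (pos d).
  move=> z zxy zcd; have [[e|e] _] := common _ zxy zcd.
    by rewrite e eqxx in cy.
  by rewrite e eqxx in dy.
by exists eps => // u ue z zs zcd; case: (H u ue z zs zcd).
Qed.

Lemma small_height : exists2 eta : R, 0 < eta &
  (forall w, h w != 0 -> eta < `|h w|) /\
  forall w c d, h w != 0 -> G x w -> G c d -> c != x -> d != x -> forall z,
    on_segment (slide (eta / `|h w|) w) (pos y) z -> on_segment (pos c) (pos d) z ->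
    (c = y \/ d = y) /\ z = pos y.
Proof.
pose P (i : X * (X * X)) (e : R) := h i.1 != 0 -> e < `|h i.1| /\
  (G x i.1 -> G i.2.1 i.2.2 -> i.2.1 != x -> i.2.2 != x -> forall t, 0 <= t ->
    t <= e / `|h i.1| -> forall z, on_segment (slide t i.1) (pos y) z ->
    on_segment (pos i.2.1) (pos i.2.2) z -> (i.2.1 = y \/ i.2.2 = y) /\ z = pos y).
have [||eta eta0 etaP] := @finite_eps R (X * (X * X))%type P.
- move=> i e e' /andP[e'0 ee'] Pe hn; have [eh H] := Pe hn; split; first exact: le_lt_trans eh.
  move=> *; apply: H; eauto; apply: le_trans; first eassumption.
  by rewrite ler_wpM2r ?invr_ge0.
- case=> w [c d]; rewrite /P /=.
  have [hw|hw] := eqVneq (h w) 0; first by exists 1.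
  have h0 : 0 < `|h w| by rewrite normr_gt0.
  have half : 0 < `|h w| / 2 < `|h w| by lra.
  have [/and4P[xw cd cx dx]|nH] := boolP [&& G x w, G c d, c != x & d != x]; last first.
    exists (`|h w| / 2); first by lra.
    move=> _; split; first by lra.
    by move=> xw cd cx dx; rewrite xw cd cx dx in nH.
  have [eps e0 H] := near_edge xw cd cx dx.
  exists (Num.min (`|h w| / 2) (`|h w| * eps / 2)).
    by rewrite lt_min; apply/andP; split; [lra|rewrite divr_gt0 // mulr_gt0].
  move=> _; split; first by rewrite gt_min; apply/orP; left; lra.
  move=> _ _ _ _ t t0 tle; apply: H => //; apply: le_lt_trans tle _.
  rewrite ltr_pdivrMr // gt_min; apply/orP; right.
  have : 0 < `|h w| * eps by rewrite mulr_gt0.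
  by rewrite mulrC; lra.
exists eta => //; split=> [w hw|w c d hw xw cd cx dx z].
  by case: (etaP (w, (w, w)) hw).
have [_ H] := etaP (w, (c, d)) hw; apply: H => //=.
by rewrite divr_ge0 // ltW.
Qed.

(** The bend of w is put on the segment from x to w at height plus or minus [eta], or at [x] itself
    for the at most one neighbour of height 0. Segments from [y] to two bends meet only in [y]:
    points of equal nonzero height on them have equal parameter, which would make the bends
    coincide. The rest of an old edge at [x] has height at least [eta] in absolute value and can
    meet them only in its bend. Other edges are avoided because [eta] is small. *)
Lemma contracted_drawing : exists pos' : X + X -> pt, sl_drawing (contracted G x y) pos'.
Proof.
have [eta eta0 [eta_lt eta_near]] := small_height.
pose tau w := if h w == 0 then 0 else eta / `|h w|.
have tau0 w : h w = 0 -> tau w = 0 by rewrite /tau => ->; rewrite eqxx.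
have tau_pos w : h w != 0 -> 0 < tau w.
  by move=> hw; rewrite /tau (negPf hw) divr_gt0 // normr_gt0.
have tau01 w : 0 <= tau w < 1.
  have [hw|hw] := eqVneq (h w) 0; first by rewrite tau0 // lexx ltr01.
  rewrite ltW ?tau_pos //= /tau (negPf hw) ltr_pdivrMr ?normr_gt0 // mul1r.
  exact: eta_lt.
have tau_h w : h w != 0 -> tau w * `|h w| = eta.
  by move=> hw; rewrite /tau (negPf hw) mulfVK // normr_eq0.
pose s w := slide (tau w) w.
have sh w : height (s w) = tau w * h w by rewrite height_slide.
have s_seg w : on_segment (pos x) (pos w) (s w).
  by apply: slide_segment; have := tau01 w; lra.
have s_x w : h w = 0 -> s w = pos x.
  by move=> hw; rewrite /s /slide tau0 //; apply: pt_eq; rewrite /=; ring.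
have outer w z : on_segment (s w) (pos w) z -> on_segment (pos x) (pos w) z /\
    exists2 r, 0 <= r <= 1 & height z = (tau w + r * (1 - tau w)) * h w.
  case=> r r01 ->; have t01 := tau01 w; split.
    exists (tau w + r * (1 - tau w)); first by nra.
    by rewrite /s /slide /=; congr (_, _); ring.
  by exists r => //; rewrite height_segment sh; rewrite /h; ring.
have inner w z : on_segment (pos y) (s w) z ->
    exists2 t, 0 <= t <= 1 & [/\ height z = t * (tau w * h w),
      z.1 = (1 - t) * (pos y).1 + t * (s w).1 & z.2 = (1 - t) * (pos y).2 + t * (s w).2].
  case=> t t01 ->; exists t => //; split=> //.
  by rewrite height_segment height_y sh mulr0 add0r.
have s_eq w w' : G x w -> G x w' -> w != w' -> s w = s w' -> s w = pos x.
  move=> xw xw' ww' ss; apply: (star_cross xw xw' ww') => //.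
  by rewrite ss.
have s_xh w : G x w -> s w = pos x -> h w = 0.
  move=> xw sx; apply/eqP/negPn/negP => hw.
  have := sh w; rewrite sx height_x => /esym/eqP.
  by rewrite mulf_eq0 (negPf hw) orbF gt_eqF // tau_pos.
pose pos' (u : X + X) := match u with inl a => pos a | inr w => s w end.
pose C u v u' v' := forall z, on_segment (pos' u) (pos' v) z -> on_segment (pos' u') (pos' v') z ->
   ((u = u' /\ v = v') \/ (u = v' /\ v = u')) \/
   exists n, [/\ n = u \/ n = v, n = u' \/ n = v' & z = pos' n].
have Cflip u v u' v' : C u v u' v' -> C v u u' v'.
  move=> H z /on_segmentC z1 z2; case: (H z z1 z2) => [[[-> ->]|[-> ->]]|[n [n1 n2 zE]]]; auto.
  by right; exists n; split=> //; case: n1; auto.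
have Cswap u v u' v' : C u v u' v' -> C u' v' u v.
  move=> H z z1 z2; case: (H z z2 z1) => [[[-> ->]|[-> ->]]|[n [n1 n2 zE]]]; auto.
  by right; exists n.
have Cflip' u v u' v' : C u v u' v' -> C u v v' u'.
  by move=> H; apply/Cswap/Cflip/Cswap.
pose kind (u v : X + X) := (exists a b, [/\ u = inl a, v = inl b & [&& a != x, b != x & G a b]]) \/
  (exists w, [/\ u = inl y, v = inr w & nbr w]) \/
  (exists w, [/\ u = inl w, v = inr w & nbr w]).
have kindP u v : contracted G x y u v -> kind u v \/ kind v u.
  case: u v => [a|w] [b|w'] //=; first by move=> H; left; left; exists a, b.
    case/andP=> /orP[/eqP -> nw|/eqP -> nw]; left; right; [left|right]; by exists w'.
  case/andP=> /orP[/eqP -> nw|/eqP -> nw]; right; right; [left|right]; by exists w.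
(* [O] stands for an untouched edge, [Y] for a segment from [y] to a bend, [S] for the remaining
   part of an old edge at [x]. *)
have OO a b c d : [&& a != x, b != x & G a b] -> [&& c != x, d != x & G c d] ->
    C (inl a) (inl b) (inl c) (inl d).
  move=> /and3P[_ _ ab] /and3P[_ _ cd] z z1 z2.
  case: (sl_cross dG ab cd z1 z2) => [[[-> ->]|[-> ->]]|[n [n1 n2 zE]]]; auto.
  right; exists (inl n); split=> //; first by case: n1 => ->; auto.
  by case: n2 => ->; auto.
have OY a b w : [&& a != x, b != x & G a b] -> nbr w -> C (inl a) (inl b) (inl y) (inr w).
  move=> /and3P[ax bx ab] /andP[xw wy] z z1 /on_segmentC z2; right.
  suff [yab zy] : (a = y \/ b = y) /\ z = pos y.
    by exists (inl y); split=> //; [case: yab => ->; auto|left].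
  have [hw|hw] := eqVneq (h w) 0; last first.
    apply: (eta_near w a b hw xw ab ax bx z _ z1).
    by move: z2; rewrite /= /s /tau (negPf hw).
  move: z2; rewrite /= s_x // => z2.
  case: (sl_cross dG xy ab z2 z1) => [[[e _]|[e _]]|].
  - by rewrite e eqxx in ax.
  - by rewrite e eqxx in bx.
  case=> n [[nx|ny] nab zE].
    by case: nab => e; move: ax bx; rewrite -e nx eqxx.
  by split; [case: nab => <-; auto|rewrite -ny].
have OS a b w : [&& a != x, b != x & G a b] -> nbr w -> C (inl a) (inl b) (inl w) (inr w).
  move=> /and3P[ax bx ab] /andP[xw wy] z z1 /on_segmentC/outer[z2 _]; right.
  case: (sl_cross dG xw ab z2 z1) => [[[e _]|[e _]]|].
  - by rewrite e eqxx in ax.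
  - by rewrite e eqxx in bx.
  case=> n [[nx|nw] nab zE].
    by case: nab => e; move: ax bx; rewrite -e nx eqxx.
  exists (inl w); split; [by case: nab => <-; rewrite nw; auto|by left|by rewrite zE nw].
have eta_h w : h w != 0 -> `|tau w * h w| = eta.
  by move=> hw; rewrite normrM gtr0_norm ?tau_h // tau_pos.
have pos_neq (t : R) : 0 <= t <= 1 -> t != 0 -> 0 < t.
  by move=> t01 tN; rewrite lt_neqAle eq_sym tN /=; lra.
have xyN := sl_neq dG xy.
have YY w w' : nbr w -> nbr w' -> C (inl y) (inr w) (inl y) (inr w').
  move=> nw nw' z /inner[t t01 [zh z1 z2]] /inner[t' t'01 [zh' z1' z2']].
  have [xw wy] := andP nw; have [xw' wy'] := andP nw'.
  have [ww'|ww'] := eqVneq w w'; first by left; left; rewrite ww'.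
  right; exists (inl y); split; auto.
  have [t0|/(pos_neq _ t01) tpos] := eqVneq t 0.
    by apply: pt_eq; rewrite ?z1 ?z2 t0 /=; ring.
  have [t0|/(pos_neq _ t'01) t'pos] := eqVneq t' 0.
    by apply: pt_eq; rewrite ?z1' ?z2' t0 /=; ring.
  exfalso; have hh : t * (tau w * h w) = t' * (tau w' * h w') by rewrite -zh.
  have [hw|hw] := eqVneq (h w) 0; have [hw'|hw'] := eqVneq (h w') 0.
  - by move: ww'; rewrite (behind_unique nw nw' hw hw') eqxx.
  - move: hh; rewrite hw !mulr0 => /esym/eqP; rewrite !mulf_eq0 (gt_eqF t'pos) (negPf hw') orbF /=.
    by rewrite gt_eqF // tau_pos.
  - move: hh; rewrite hw' !mulr0 => /eqP; rewrite !mulf_eq0 (gt_eqF tpos) (negPf hw) orbF /=.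
    by rewrite gt_eqF // tau_pos.
  have tt' : t = t'.
    have : `|t * (tau w * h w)| = `|t' * (tau w' * h w')| by rewrite hh.
    rewrite !(normrM t) !(normrM t') !eta_h // !gtr0_norm //.
    by move/(mulIf (lt0r_neq0 eta0)).
  have ss : s w = s w'.
    by rewrite -tt' in z1' z2'; apply: pt_eq; apply: (mulfI (lt0r_neq0 tpos)); lra.
  by move/eqP: hw; apply; apply: s_xh xw (s_eq _ _ xw xw' ww' ss).
have YS w w' : nbr w -> nbr w' -> C (inl y) (inr w) (inl w') (inr w').
  move=> nw nw' z /inner[t t01 [zh z1 z2]] /on_segmentC/outer[zxw' [r r01 zh']].
  have [xw wy] := andP nw; have [xw' wy'] := andP nw'.
  have t1z : 1 <= t -> z = s w.
    move=> t1; have te : t = 1 by lra.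
    by apply: pt_eq; rewrite ?z1 ?z2 te; ring.
  have [ww'|ww'] := eqVneq w w'.
    rewrite -{}ww' in nw' xw' wy' zxw' zh' *; right; exists (inr w); split; auto.
    have [hw|hw] := eqVneq (h w) 0.
      rewrite [pos' _]s_x //; apply: (star_cross xw xy wy) => //.
      exists (1 - t); first by lra.
      by apply: pt_eq => /=; rewrite ?z1 ?z2 s_x //; ring.
    apply: t1z; have tw := tau_pos _ hw; have tw1 := tau01 w.
    have : t * tau w = tau w + r * (1 - tau w).
      by apply: (mulIf hw); rewrite -zh' zh; ring.
    have : 0 <= r * (1 - tau w) by apply: mulr_ge0; lra.
    nra.
  exfalso; have [hw'|hw'] := eqVneq (h w') 0; last first.
    have tw' := tau_pos _ hw'; have tw1' := tau01 w'; have ew' := tau_h _ hw'.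
    have rt : 0 <= r * (1 - tau w') by apply: mulr_ge0; lra.
    have big : eta <= `|height z|.
      rewrite zh' normrM ger0_norm; last by lra.
      by rewrite -ew'; apply: ler_wpM2r; [exact: normr_ge0|lra].
    have [hw|hw] := eqVneq (h w) 0.
      by move: big; rewrite zh hw !mulr0 normr0 leNgt eta0.
    have t1 : 1 <= t.
      have t0 : 0 <= t by lra.
      by move: big; rewrite zh normrM eta_h // (ger0_norm t0) -{1}[eta]mul1r ler_pM2r.
    have zs := t1z t1.
    move/eqP: hw; apply; apply: s_xh => //; rewrite -zs.
    by apply: (star_cross xw xw' ww') => //; rewrite zs.
  have [hw|hw] := eqVneq (h w) 0.
    by move: ww'; rewrite (behind_unique nw nw' hw hw') eqxx.
  have t0 : t = 0.
    move/eqP: zh; rewrite zh' hw' mulr0 eq_sym !mulf_eq0 (negPf hw) orbF.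
    by rewrite (gt_eqF (tau_pos _ hw)) orbF => /eqP.
  have zy : z = pos y by apply: pt_eq; rewrite ?z1 ?z2 t0; ring.
  apply: xyN; rewrite -zy; apply/esym; apply: (star_cross xw' xy wy') => //.
  by rewrite zy; exact: on_segment_r.
have SS w w' : nbr w -> nbr w' -> C (inl w) (inr w) (inl w') (inr w').
  move=> nw nw' z /on_segmentC/outer[zxw [r r01 zh]] /on_segmentC/outer[zxw' [r' r'01 zh']].
  have [xw wy] := andP nw; have [xw' wy'] := andP nw'.
  have [ww'|ww'] := eqVneq w w'; first by left; left; rewrite ww'.
  have zx := star_cross xw xw' ww' zxw zxw'.
  have h0 v q : nbr v -> 0 <= q <= 1 -> height z = (tau v + q * (1 - tau v)) * h v -> h v = 0.
    move=> _ q01; rewrite zx height_x => /esym/eqP; rewrite mulf_eq0 => /orP[/eqP e|/eqP //].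
    apply/eqP/negPn/negP => hv; have := tau_pos _ hv; have := tau01 v => tv tp.
    have : 0 <= q * (1 - tau v) by apply: mulr_ge0; lra.
    lra.
  by move: ww'; rewrite (behind_unique nw nw' (h0 _ _ nw r01 zh) (h0 _ _ nw' r'01 zh')) eqxx.
have kneq u v : kind u v -> pos' u <> pos' v.
  case=> [[a [b [-> -> /and3P[_ _ ab]]]]|[[w [-> -> /andP[xw wy]]]|[w [-> -> /andP[xw wy]]]]] /=.
  - exact: (sl_neq dG ab).
  - move=> ys; have [hw|hw] := eqVneq (h w) 0; first by apply: xyN; rewrite ys s_x.
    have := sh w; rewrite -ys height_y => /esym/eqP; rewrite mulf_eq0 (negPf hw) orbF.
    by rewrite (gt_eqF (tau_pos _ hw)).
  - move=> ws; have [hw|hw] := eqVneq (h w) 0; first by apply: (sl_neq dG xw); rewrite ws s_x.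
    have := sh w; rewrite -ws -/(h w) => /eqP; rewrite -subr_eq0 -{1}[h w]mul1r -mulrBl.
    by rewrite mulf_eq0 (negPf hw) orbF; have := tau01 w; move=> t1 /eqP; lra.
exists pos'; split.
- by move=> [a|w] [b|w'] //=; rewrite (sl_sym dG); case: (a != x); case: (b != x).
- by move=> u v /kindP[/kneq //|/kneq n e]; apply: n.
- move=> u v u' v' z uv u'v'.
  have kC k1 k2 k1' k2' : kind k1 k2 -> kind k1' k2' -> C k1 k2 k1' k2'.
    case=> [[a [b [-> -> H]]]|[[w [-> -> H]]|[w [-> -> H]]]];
      case=> [[c [d [-> -> H']]]|[[w' [-> -> H']]|[w' [-> -> H']]]]; auto.
  case: (kindP _ _ uv) => ku; case: (kindP _ _ u'v') => kv.
  + exact: kC.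
  + exact/Cflip'/kC.
  + exact/Cflip/kC.
  + exact/Cflip/Cflip'/kC.
Qed.

End Contraction.
End StraightLine.

(** * The straight-line drawing of the grid *)

Section GridDrawing.
Local Open Scope ring_scope.
Context (R : realType) (N : nat).
Notation Q := ('I_N * 'I_N)%type.

Definition grid_pos (x : Q) : R * R := ((x.1 : nat)%:R, (x.2 : nat)%:R).

Lemma nat_shift (i j : nat) (s t : R) : 0 <= s <= 1 -> 0 <= t <= 1 ->
  i%:R + s = j%:R + t ->
  [\/ i = j, j = i.+1 /\ (s = 1 /\ t = 0) | i = j.+1 /\ (s = 0 /\ t = 1)].
Proof.
move=> s01 t01 e; case: (ltngtP i j) => ij; last by constructor 1.
  have ij1 : (i.+1)%:R <= (j%:R : R) by rewrite ler_nat.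
  rewrite -natr1 in ij1; constructor 2; split; last by lra.
  by apply/eqP; rewrite -(eqr_nat R) -natr1; apply/eqP; lra.
have ij1 : (j.+1)%:R <= (i%:R : R) by rewrite ler_nat.
rewrite -natr1 in ij1; constructor 3; split; last by lra.
by apply/eqP; rewrite -(eqr_nat R) -natr1; apply/eqP; lra.
Qed.

Definition step (b : bool) (p q : Q) : bool :=
  if b then (q.1 == p.1.+1 :> nat) && (q.2 == p.2 :> nat) else (q.1 == p.1 :> nat) && (q.2 == p.2.+1 :> nat).

Lemma step_segment b p q z : step b p q -> on_segment (grid_pos p) (grid_pos q) z ->
  exists2 t, 0 <= t <= 1 &
  z = (if b then ((p.1 : nat)%:R + t, (p.2 : nat)%:R) else ((p.1 : nat)%:R, (p.2 : nat)%:R + t)).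
Proof.
rewrite /step /grid_pos; case: b => /andP[] => [/eqP e1 /eqP e2|/eqP e1 /eqP e2] [t t01 ->];
  exists t => //=; rewrite e1 e2 -natr1; congr (_, _); ring.
Qed.

Lemma grid_pos_inj : injective grid_pos.
Proof.
case=> a b [c d] [/eqP e1 /eqP e2]; move: e1 e2; rewrite !eqr_nat => /eqP/val_inj -> /eqP/val_inj ->.
by [].
Qed.

Lemma nat_hit (i j : nat) (t : R) : 0 <= t <= 1 -> i%:R + t = j%:R ->
  (j = i /\ t = 0) \/ (j = i.+1 /\ t = 1).
Proof.
move=> t01 e; have o01 : 0 <= (0 : R) <= 1 by rewrite lexx ler01.
have e' : i%:R + t = j%:R + 0 by rewrite addr0.
case: (nat_shift t01 o01 e') => [ij|[ij [t1 _]]|[_ [_ h]]]; last by lra.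
  by left; split=> //; move: e; rewrite ij; lra.
by right.
Qed.

Lemma cell_eq (x y : Q) : x.1 = y.1 :> nat -> x.2 = y.2 :> nat -> x = y.
Proof. by case: x y => [? ?] [? ?] /= /val_inj -> /val_inj ->. Qed.

Lemma step_cross_hv p q p' q' z : step true p q -> step false p' q' ->
  on_segment (grid_pos p) (grid_pos q) z -> on_segment (grid_pos p') (grid_pos q') z ->
  exists n, [/\ n = p \/ n = q, n = p' \/ n = q' & z = grid_pos n].
Proof.
move=> pq pq' /(step_segment pq)[t t01 zE] /(step_segment pq')[t' t'01 zE'].
have h1 : (p.1 : nat)%:R + t = (p'.1 : nat)%:R by have := zE'; rewrite zE => -[].
have h2 : (p'.2 : nat)%:R + t' = (p.2 : nat)%:R by have := zE'; rewrite zE => -[_ ->].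
move: pq pq' => /andP[/eqP q1 /eqP q2] /andP[/eqP q1' /eqP q2'].
have [n [np zn n1 n2]] : exists n : Q, [/\ n = p \/ n = q, z = grid_pos n,
    n.1 = p'.1 :> nat & n.2 = p.2 :> nat].
  case: (nat_hit t01 h1) => -[e t0].
    by exists p; split; auto; rewrite zE t0 addr0.
  exists q; split; auto; last by rewrite q1.
  by rewrite zE t0 /grid_pos q1 q2 -natr1.
exists n; split=> //; case: (nat_hit t'01 h2) => -[e t0].
  by left; apply: cell_eq; rewrite ?n1 ?n2.
by right; apply: cell_eq; rewrite ?n1 ?n2 ?e ?q1' ?q2'.
Qed.

Lemma step_cross b b' p q p' q' z : step b p q -> step b' p' q' ->
  on_segment (grid_pos p) (grid_pos q) z -> on_segment (grid_pos p') (grid_pos q') z ->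
  (p = p' /\ q = q') \/
  exists n, [/\ n = p \/ n = q, n = p' \/ n = q' & z = grid_pos n].
Proof.
move=> pq pq' zs zs'; have [bb|] := eqVneq b b'; last first.
  case: b b' pq pq' => -[] pq pq' // _; right; first exact: step_cross_hv zs zs'.
  by have [n [? ? ?]] := step_cross_hv pq' pq zs' zs; exists n.
have [t t01 zE] := step_segment pq zs; have [t' t'01 zE'] := step_segment pq' zs'.
have zz := zE; rewrite zE' -bb in zz; rewrite -{}bb in pq' zE'.
have close (s s' : nat) : (if b then s = (p.1 : nat) /\ s' = (p'.1 : nat) /\ p'.2 = p.2 :> nat
    else s = (p.2 : nat) /\ s' = (p'.2 : nat) /\ p'.1 = p.1 :> nat) -> s'%:R + t' = s%:R + t ->
    (p = p' /\ q = q') \/ exists n, [/\ n = p \/ n = q, n = p' \/ n = q' & z = grid_pos n].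
  move=> H /(nat_shift t'01 t01)[e|[e [t0 t1]]|[e [t0 t1]]].
  - left; case: b pq pq' H {zE zE' zz} => /andP[/eqP q1 /eqP q2] /andP[/eqP q1' /eqP q2'] [h1 [h2 h3]];
      split; apply: cell_eq; lia.
  - right; exists p; split; auto.
      by case: b pq pq' H {zE zE' zz} => /andP[/eqP q1 /eqP q2] /andP[/eqP q1' /eqP q2'] [h1 [h2 h3]];
        right; apply: cell_eq; lia.
    by rewrite zE t1 !addr0; case: (b).
  - right; exists p'; split; auto.
      by case: b pq pq' H {zE zE' zz} => /andP[/eqP q1 /eqP q2] /andP[/eqP q1' /eqP q2'] [h1 [h2 h3]];
        right; apply: cell_eq; lia.
    by rewrite zE' t0 !addr0; case: (b).
case: b pq pq' zE zE' zz close => pq pq' zE zE' [z1 z2] close.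
  have /eqP : (p'.2 : nat)%:R = (p.2 : nat)%:R :> R by [].
  by rewrite eqr_nat => /eqP e; apply: (close p.1 p'.1).
have /eqP : (p'.1 : nat)%:R = (p.1 : nat)%:R :> R by [].
by rewrite eqr_nat => /eqP e; apply: (close p.2 p'.2).
Qed.

Lemma grid_drawing : sl_drawing (fun p q : Q => gadj (cell_of p) (cell_of q)) grid_pos.
Proof.
have adjP p q : gadj (cell_of p) (cell_of q) -> exists b, step b p q \/ step b q p.
  case: p q => [a c] [a' c']; rewrite /gadj /cell_of /step /= => H.
  have [e|e] := eqVneq (a : nat) a'; [exists false|exists true];
    (have [l|l] := ltnP (a + c) (a' + c')); lia.
split.
- by move=> p q; rewrite gadjC.
- move=> p q pq /grid_pos_inj e; move: pq; rewrite e /gadj; lia.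
- move=> p q p' q' z /adjP[b pq] /adjP[b' pq'] zs zs'.
  case: pq pq' => pq [] pq'.
  + case: (step_cross pq pq' zs zs') => [[-> ->]|[n [? ? ?]]]; auto; by right; exists n.
  + case: (step_cross pq pq' zs (on_segmentC zs')) => [[-> ->]|[n [? h ?]]]; auto.
    by right; exists n; split=> //; case: h; auto.
  + case: (step_cross pq pq' (on_segmentC zs) zs') => [[-> ->]|[n [h ? ?]]]; auto.
    by right; exists n; split=> //; case: h; auto.
  + case: (step_cross pq pq' (on_segmentC zs) (on_segmentC zs')) => [[-> ->]|[n [h h' ?]]]; auto.
    by right; exists n; split=> //; [case: h|case: h']; auto.
Qed.

End GridDrawing.

(** * Shrinking the branch sets of vertices to single points *)

Section Models.
Context (R : realType) (V : finType) (E : {set {set V}}).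
Notation L := (V + {set V})%type.

Definition inside_class (X : finType) (G : rel X) (lab : X -> option L) w : rel X :=
  fun p q => [&& G p q, lab p == Some w & lab q == Some w].

(* A model of the 1-subdivision of E as a minor of a straight-line drawing. *)
Record sl_model (X : finType) (G : rel X) (pos : X -> R * R) (lab : X -> option L) : Prop :=
  SlModel {
  model_drawing : sl_drawing G pos;
  model_connected : forall w p q, lab p = Some w -> lab q = Some w ->
    connect (inside_class G lab w) p q;
  model_adj : forall e u, e \in E -> u \in e -> exists p q,
    [/\ lab p = Some (inl u), lab q = Some (inr e) & G p q]
}.

Definition branch_cells (X : finType) (lab : X -> option L) : {set X} :=
  [set p | if lab p is Some (inl _) then true else false].

Lemma connect_leaves (X : finType) (r : rel X) (A : {pred X}) p q :
  connect r p q -> p \in A -> q \notin A -> exists y x, [/\ r y x, y \in A & x \notin A].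
Proof.
case/connectP=> s; elim: s p => [|z s IH] p /=; first by move=> _ -> pA; rewrite pA.
case/andP=> pz zs qE pA qA; have [zA|zA] := boolP (z \in A); last by exists p, z.
exact: IH zs qE zA qA.
Qed.

(** A maximal proper connected subset containing [p] misses just one point, since any point adjacent
    to it could be added. *)
Lemma connected_minus_leaf (X : finType) (r : rel X) (C : {set X}) p q :
  symmetric r -> p \in C -> q \in C -> p != q ->
  (forall a b, r a b -> (a \in C) && (b \in C)) ->
  {in C &, forall a b, connect r a b} ->
  exists x y, [/\ x \in C, y \in C, r y x &
    {in C :\ x &, forall a b, connect (fun a b => [&& r a b, a != x & b != x]) a b}].
Proof.
move=> rsym pC qC pq rC con.
pose rA (A : {set X}) a b := [&& r a b, a \in A & b \in A].
pose P (A : {set X}) := [&& p \in A, A \proper C &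
  [forall a in A, forall b in A, connect (rA A) a b]].
have P0 : P [set p].
  apply/and3P; split; first by rewrite inE.
    apply/properP; split; first by rewrite finset.sub1set.
    by exists q => //; rewrite inE eq_sym.
  by apply/forall_inP => a /set1P ->; apply/forall_inP => b /set1P ->; rewrite connect0.
case: (arg_maxnP (fun A : {set X} => #|A|) P0) => A /and3P[pA AC /forall_inP conA] Amax.
have [sAC [q' q'C q'A]] := properP AC.
have [y [x [ryx yA xA]]] := connect_leaves (con _ _ pC q'C) pA q'A.
have /andP[yC xC] := rC _ _ ryx.
have CE : C = x |: A.
  apply/eqP; rewrite finset.eqEsubset finset.subUset finset.sub1set xC sAC /= andbT; apply: contraT => nsub.
  suff PxA : P (x |: A) by have := Amax _ PxA; rewrite /= cardsU1 xA add1n ltnn.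
  have monA : subrel (rA A) (rA (x |: A)).
    by move=> a b /and3P[ab aA bA]; rewrite /rA ab !inE aA bA !orbT.
  have conA' a b : a \in A -> b \in A -> connect (rA (x |: A)) a b.
    move=> aA bA; apply: (connect_sub _ (forall_inP (conA a aA) b bA)).
    by move=> ? ? /monA; exact: connect1.
  have cyx : connect (rA (x |: A)) y x.
    by apply: connect1; rewrite /rA ryx !inE yA eqxx orbT.
  have rAsym : connect_sym (rA (x |: A)).
    by apply: sym_connect_sym => a b; rewrite /rA rsym [RHS]andbCA andbA andbC andbA [in RHS]andbC; case: (r b a); case: (a \in _); case: (b \in _).
  have toy a : a \in x |: A -> connect (rA (x |: A)) y a.
    by case/setU1P => [->//|aA]; exact: conA'.
  apply/and3P; split; first by rewrite !inE pA orbT.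
    rewrite fintype.properE nsub andbT finset.subUset finset.sub1set xC; exact: fintype.proper_sub.
  apply/forall_inP => a aA; apply/forall_inP => b bA.
  by apply: connect_trans (toy b bA); rewrite rAsym; exact: toy.
exists x, y; split=> // a b; rewrite CE finset.setU1K // => aA bA.
apply: (connect_sub _ (forall_inP (conA a aA) b bA)) => c d /and3P[cd cA dA].
apply: connect1; rewrite cd /=; apply/andP; split; by apply: contraNneq xA => <-.
Qed.

Lemma connect_map (X Y : finType) (r : rel X) (r' : rel Y) (h : X -> Y) a b :
  (forall c d, r c d -> connect r' (h c) (h d)) -> connect r a b -> connect r' (h a) (h b).
Proof.
move=> H /connectP[s + ->]; elim: s a => [|c s IH] a /=; first by rewrite connect0.
by case/andP=> /H ac /IH; exact: connect_trans.
Qed.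

(** A non-cutting point [x] of the branch set of [v] is contracted into a neighbour [y] there. A
    bend towards a point labelled by an edge joins the branch set of that edge, which is why the
    subdivision is modelled; the other bends stay unlabelled. *)
Lemma sl_model_reduce (X : finType) (G : rel X) pos lab v p q :
  sl_model G pos lab -> lab p = Some (inl v) -> lab q = Some (inl v) -> p != q ->
  exists (X' : finType) (G' : rel X') pos' lab',
    sl_model G' pos' lab' /\ #|branch_cells lab'| < #|branch_cells lab|.
Proof.
case=> dG con adj lp lq pq.
have Gsym := sl_sym dG.
pose C := [set c | lab c == Some (inl v)].
have rsym w : symmetric (inside_class G lab w).
  by move=> a b; rewrite /inside_class Gsym; case: (G b a); rewrite //= andbC.
have pC : p \in C by rewrite inE lp.
have qC : q \in C by rewrite inE lq.
have rC a b : inside_class G lab (inl v) a b -> (a \in C) && (b \in C).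
  by move=> /and3P[_ la lb]; rewrite !inE la lb.
have conC : {in C &, forall a b, connect (inside_class G lab (inl v)) a b}.
  by move=> a b; rewrite !inE => /eqP la /eqP lb; exact: con.
have [x [y [xC' yC' /and3P[yx _ _] conx]]] :=
  connected_minus_leaf (rsym (inl v)) pC qC pq rC conC.
have /eqP xC : lab x == Some (inl v) by move: xC'; rewrite inE.
have /eqP yC : lab y == Some (inl v) by move: yC'; rewrite inE.
have xy : G x y by rewrite Gsym.
have [pos' dG'] := contracted_drawing dG xy.
pose lab' (u : X + X) : option L := match u with
  | inl a => if a == x then None else lab a
  | inr w => if G x w && (w != y) then
      if lab w is Some (inr e) then Some (inr e) else None else None
  end.
have yx' : y != x by apply/eqP => e; move: yx; rewrite e (sl_irrefl dG).
exists (X + X)%type, (contracted G x y), pos', lab'; split; last first.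
  have bE : branch_cells lab' = inl @: (branch_cells lab :\ x).
    apply/setP => -[a|w]; rewrite !inE /=.
      rewrite mem_imset; last by move=> ? ? [].
      by rewrite !inE; case: (a == x).
    transitivity false; last by apply/esym/negbTE/negP => /imsetP[].
    by case: ifP => // _; case: (lab w) => [[]|].
  rewrite bE card_imset; last by move=> ? ? [].
  by rewrite [X in _ < X](cardsD1 x) inE xC.
have lift w a b : inside_class G lab w a b -> a != x -> b != x ->
    inside_class (contracted G x y) lab' w (inl a) (inl b).
  by move=> /and3P[ab la lb] ax bx; rewrite /inside_class /= ax bx ab (negPf ax) (negPf bx) la lb.
split=> //.
- move=> w.
  have csym : connect_sym (inside_class (contracted G x y) lab' w).
    apply: sym_connect_sym => a b; rewrite /inside_class (sl_sym dG').
    by case: (contracted _ _ _ _ _); rewrite //= andbC.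
  have [->|wv] := eqVneq w (inl v).
    move=> [a|a] [b|b] /=; try by case: ifP => // _; case: (lab _) => [[]|].
      case: eqP => // /eqP ax la; case: eqP => // /eqP bx lb.
      have := conx a b; rewrite !inE ax bx la lb eqxx => /(_ isT isT).
      apply: connect_map => c d /and3P[cd cx dx]; apply: connect1; exact: lift.
    by case: ifP => // _ _; case: ifP => // _; case: (lab _) => [[]|].
  have nx a : lab a = Some w -> a != x.
    by move=> la; apply: contraNneq wv => ax; move: la; rewrite ax xC => -[->].
  have ll a b : lab a = Some w -> lab b = Some w ->
      connect (inside_class (contracted G x y) lab' w) (inl a) (inl b).
    move=> la lb; apply: connect_map (con _ _ _ la lb) => c d cd; apply: connect1.
    by have /and3P[_ /eqP lc /eqP ld] := cd; apply: lift => //; exact: nx.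
  have tol u : lab' u = Some w -> exists2 a, lab a = Some w &
      connect (inside_class (contracted G x y) lab' w) u (inl a).
    case: u => [a|a] /=; first by case: eqP => // _ la; exists a.
    case: ifP => // xa; case la : (lab a) => [[|e]|] // [ew]; exists a; first by rewrite la ew.
    apply: connect1; rewrite /inside_class /= eqxx orbT xa la ew eqxx /=.
    by rewrite (negPf (nx a _)) ?la ?ew.
  move=> a b /tol[a' la' ca] /tol[b' lb' cb].
  by apply: connect_trans ca (connect_trans (ll _ _ la' lb') _); rewrite csym.
- move=> e u eE ue; have [a [b [la lb ab]]] := adj e u eE ue.
  have bx : b != x by apply: contra_eqN xC => /eqP <-; rewrite lb.
  have [ax|ax] := eqVneq a x.
    have uv : u = v by move: la; rewrite ax xC => -[].
    have bny : b != y by apply: contra_eqN yC => /eqP <-; rewrite lb.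
    rewrite ax in ab.
    by exists (inl y), (inr b); rewrite /= (negPf yx') yC uv eqxx /= bny ab lb.
  by exists (inl a), (inl b); rewrite /= (negPf ax) (negPf bx) la lb.
Qed.

Lemma grid_minor_sl_model : (forall e, e \in E -> #|e| == 2) -> grid_minor E ->
  exists (X : finType) (G : rel X) pos lab, sl_model G pos lab.
Proof.
move=> E2 gm; have [F [l [r [_ _ _ gmf]]]] := grid_minor_faces E2 gm.
(* Any face serves, as its vertex is dropped again and only the subdivision is kept. *)
have [f [N [fN fC fE]]] := gmf (l finset.set0).
pose Q : finType := ('I_N * 'I_N)%type.
pose lab (q : Q) : option L := if f (cell_of q) is Some w then
  match w with inl v => Some (inl v) | inr (Some e) => Some (inr e) | inr None => None end
  else None.
have cellP p : f p -> exists q : Q, cell_of q = p by exact: (labelled_cell fN).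
pose up (w : L) : V + option {set V} := match w with inl v => inl v | inr e => inr (Some e) end.
have labE q w : lab q = Some w <-> f (cell_of q) = Some (up w).
  rewrite /lab; case: (f _) => [[v|[e|]]|]; case: w => [v'|e'] /=;
    by split=> // -[->].
exists Q, (fun p q => gadj (cell_of p) (cell_of q)), (@grid_pos R N), lab; split.
- exact: grid_drawing.
- move=> w p q /labE fp /labE fq.
  move: (fC _ _ _ fp fq) => {fp fq}.
  move pE : (cell_of p) => p0; move qE : (cell_of q) => q0 wk.
  elim: wk p pE q qE => [p1 _|p1 q1 r1 /eqP fp1 adj wk IH] p pE q qE.
    by rewrite (cell_of_inj (etrans pE (esym qE))) connect0.
  have /eqP fq1 := walk_start wk.
  have [z zE] : exists z : Q, cell_of z = q1 by apply: cellP; rewrite fq1.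
  apply: connect_trans (IH z zE q qE); apply: connect1.
  rewrite /inside_class pE zE adj /=; apply/andP; split; apply/eqP/labE.
    by rewrite pE.
  by rewrite zE.
- move=> e u eE ue.
  have := fE (inl u) (inr (Some e)) isT (sd_plus_end _ eE ue).
  case=> p [q [fp fq pq]].
  have [p' pE] : exists z : Q, cell_of z = p by apply: cellP; rewrite fp.
  have [q' qE] : exists z : Q, cell_of z = q by apply: cellP; rewrite fq.
  exists p', q'; split; [|by apply/labE; rewrite qE|by rewrite pE qE].
  by apply/labE; rewrite pE.
Qed.

Lemma grid_minor_thin_model : (forall e, e \in E -> #|e| == 2) -> grid_minor E ->
  exists (X : finType) (G : rel X) pos lab, sl_model G pos lab /\
    forall v p q, lab p = Some (inl v) -> lab q = Some (inl v) -> p = q.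
Proof.
move=> E2 gm; have [X [G [pos [lab M]]]] := grid_minor_sl_model E2 gm.
move: {2}(#|branch_cells lab|) (leqnn #|branch_cells lab|) => n.
elim: n X G pos lab M => [|n IH] X G pos lab M le_n.
  exists X, G, pos, lab; split=> // v p q lp lq.
  move: le_n; rewrite leqn0 cards_eq0 => /eqP/setP/(_ p); by rewrite !inE lp.
have [thin|] := pselect (forall v p q, lab p = Some (inl v) -> lab q = Some (inl v) -> p = q).
  by exists X, G, pos, lab.
move=> /existsNP[v /existsNP[p /existsNP[q]]] /not_implyP[lp /not_implyP[lq /eqP pq]].
have [X' [G' [pos' [lab' [M' lt]]]]] := sl_model_reduce M lp lq pq.
by apply: IH M' _; lia.
Qed.

End Models.

(** * From thin models to plane drawings *)

Section Arcs.
Local Open Scope ring_scope.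
Context (R : realType).
Notation pt := (R * R)%type.

Definition straight (p q : pt) (t : R) : pt :=
  ((1 - t) * p.1 + t * q.1, (1 - t) * p.2 + t * q.2).

Lemma straight_continuous p q : continuous (straight p q).
Proof.
have lin (a b : R) : continuous (fun t : R => (1 - t) * a + t * b).
  move=> t; apply: cvgD; apply: cvgM; try exact: cvg_cst; try exact: cvg_id.
  by apply: cvgB; [exact: cvg_cst|exact: cvg_id].
by move=> t; exact: (cvg_pair (lin p.1 q.1 t) (lin p.2 q.2 t)).
Qed.

Lemma straight_inj p q t t' : p <> q -> straight p q t = straight p q t' -> t = t'.
Proof.
move=> pq [e1 e2]; apply/eqP; rewrite -subr_eq0; apply/negPn/negP => tt.
apply: pq; apply: pt_eq.
  have : (t - t') * (q.1 - p.1) = 0 by move: e1; lra.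
  by move/eqP; rewrite mulf_eq0 (negPf tt) subr_eq0 => /eqP.
have : (t - t') * (q.2 - p.2) = 0 by move: e2; lra.
by move/eqP; rewrite mulf_eq0 (negPf tt) subr_eq0 => /eqP.
Qed.

Lemma straight0 p q : straight p q 0 = p.
Proof. by apply: pt_eq; rewrite /=; ring. Qed.

Lemma straight1 p q : straight p q 1 = q.
Proof. by apply: pt_eq; rewrite /=; ring. Qed.

(** Concatenation of the segment pq with [al], where [al 0 = q], as one formula: on each half of
    [0, 1] one of the two moving terms equals [q] and cancels, so continuity needs no gluing. *)
Definition arc_join (al : R -> pt) (p q : pt) (t : R) : pt :=
  al (Num.max (2 * t - 1) 0) + straight p q (Num.min (2 * t) 1) - q.

Lemma arc_join_continuous al p q : continuous al -> continuous (arc_join al p q).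
Proof.
move=> cal t.
have c2 : continuous (fun t : R => 2 * t).
  by move=> u; apply: cvgM; [exact: cvg_cst|exact: cvg_id].
have cmax : continuous (fun t : R => Num.max (2 * t - 1) 0).
  move=> u; apply: (@continuous_max R R (fun t : R => 2 * t - 1) (fun=> 0) u); last exact: cvg_cst.
  by apply: cvgB; [exact: c2|exact: cvg_cst].
have cmin : continuous (fun t : R => Num.min (2 * t) 1).
  by move=> u; apply: (@continuous_min R R (fun t : R => 2 * t) (fun=> 1) u); [exact: c2|exact: cvg_cst].
apply: cvgB; last exact: cvg_cst.
apply: cvgD.
  by apply: continuous_comp; [exact: cmax|exact: cal].
by apply: continuous_comp; [exact: cmin|exact: straight_continuous].
Qed.

Lemma arc_join_l al p q t : al 0 = q -> t <= 1 / 2 -> arc_join al p q t = straight p q (2 * t).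
Proof.
move=> al0 t2; rewrite /arc_join max_r ?min_l; [|lra|lra].
by rewrite al0 addrC addKr.
Qed.

Lemma arc_join_r al p q t : 1 / 2 <= t -> arc_join al p q t = al (2 * t - 1).
Proof.
move=> t2; rewrite /arc_join max_l ?min_r; [|lra|lra].
by rewrite straight1 addrK.
Qed.

(** Segments of a drawing meet only in common vertices, and on a path without repetition only
    consecutive segments share one; so the concatenation is injective. *)
Lemma chain_arc (X : finType) (G : rel X) (pos : X -> pt) (r : rel X) x0 s :
  sl_drawing G pos -> subrel r G -> path r x0 s -> uniq (x0 :: s) -> s != [::] ->
  exists al : R -> pt, [/\ continuous al,
    forall t t', 0 <= t <= 1 -> 0 <= t' <= 1 -> al t = al t' -> t = t',
    al 0 = pos x0, al 1 = pos (last x0 s) &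
    forall t, 0 <= t <= 1 -> exists a b,
      [/\ a \in x0 :: s, b \in x0 :: s, r a b & on_segment (pos a) (pos b) (al t)]].
Proof.
move=> dG rG; elim: s x0 => [//|x1 s IH] x0 /andP[r01 pth] un _.
have n01 := sl_neq dG (rG _ _ r01).
have [s0|sN] := eqVneq s [::].
  exists (straight (pos x0) (pos x1)); rewrite s0; split.
  - exact: straight_continuous.
  - by move=> t t' _ _; exact: straight_inj.
  - exact: straight0.
  - exact: straight1.
  - by move=> t t01; exists x0, x1; rewrite !inE !eqxx orbT; split=> //; exists t.
have /andP[x0s un1] := un.
have [al [cal ial al0 al1 sal]] := IH x1 pth un1 sN.
pose p := pos x0; pose q := pos x1.
have tl t : t <= 1 / 2 -> arc_join al p q t = straight p q (2 * t) by exact: arc_join_l.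
have tr t : 1 / 2 <= t -> arc_join al p q t = al (2 * t - 1) by exact: arc_join_r.
have meet t t' : 0 <= t <= 1 -> 0 <= t' <= 1 -> straight p q t = al t' -> t = 1 /\ t' = 0.
  move=> t01 t'01 e; have [a [b [aS bS rab zab]]] := sal t' t'01.
  have zpq : on_segment p q (al t') by rewrite -e; exists t.
  have x0a c : c \in x1 :: s -> c != x0 by apply: contraTneq => ->.
  suff zq : al t' = q.
    split; last by apply: ial => //; [rewrite lexx ler01|rewrite al0].
    by apply: (straight_inj n01); rewrite straight1 -/p -/q e zq.
  case: (sl_cross dG (rG _ _ r01) (rG _ _ rab) zpq zab) => [[[e' _]|[e' _]]|].
  - by have := x0a _ aS; rewrite -e' eqxx.
  - by have := x0a _ bS; rewrite -e' eqxx.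
  case=> n [[nx|nx] nab ->]; last by rewrite nx.
  by case: nab => e'; [have := x0a _ aS|have := x0a _ bS]; rewrite -e' nx eqxx.
exists (arc_join al p q); split.
- exact: arc_join_continuous.
- have wl t t' : 0 <= t <= 1 -> 0 <= t' <= 1 -> t <= t' ->
      arc_join al p q t = arc_join al p q t' -> t = t'.
    move=> t01 t'01 tt'; have [h|h] := lerP t' (1 / 2).
      rewrite tl ?tl //; last by lra.
      by move/(straight_inj n01); lra.
    have [k|k] := lerP t (1 / 2); last first.
      rewrite tr ?tr; [|lra|lra] => /ial e.
      by have : 2 * t - 1 = 2 * t' - 1 by [apply: e; lra]; lra.
    rewrite tl // tr; last by lra.
    case/meet; lra.
  move=> t t' t01 t'01 e; have [h|h] := lerP t t'; first exact: wl.
  by apply/esym; apply: wl => //; exact: ltW.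
- by rewrite tl ?mulr0 ?straight0 //; lra.
- have e1 : 2 * 1 - 1 = 1 :> R by lra.
  by rewrite tr; [rewrite e1 al1|lra].
- move=> t t01; have [h|h] := lerP t (1 / 2).
    exists x0, x1; rewrite !inE !eqxx orbT; split=> //.
    by rewrite tl //; exists (2 * t) => //; lra.
  rewrite tr; last by exact: ltW.
  have [|a [b [aS bS rab zab]]] := sal (2 * t - 1); first by lra.
  by exists a, b; split=> //; rewrite in_cons ?aS ?bS orbT.
Qed.

(** In a thin model a vertex on an edge is a point, and the arc of an edge runs through the branch
    set of that edge. Branch sets of different edges are disjoint, so arcs meet only in common ends.
    Vertices on no edge are put to the right of everything else. *)
Lemma grid_minor_planar (V : finType) (E : {set {set V}}) :
  (forall e, e \in E -> #|e| == 2) -> grid_minor E -> planar R E.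
Proof.
move=> E2 gm.
have [X [G [pos [lab [[dG con adj] thin]]]]] := @grid_minor_thin_model R V E E2 gm.
have Gsym := sl_sym dG.
pose S (e : {set V}) a := (lab a = Some (inr e)) \/ exists2 w, w \in e & lab a = Some (inl w).
pose rr (e : {set V}) a b := [&& G a b, (lab a == Some (inr e)) || (lab b == Some (inr e)),
  (if lab a is Some l then match l with inl w => w \in e | inr e' => e' == e end else false) &
  (if lab b is Some l then match l with inl w => w \in e | inr e' => e' == e end else false)].
have rrS e a b : rr e a b -> [/\ G a b, lab a = Some (inr e) \/ lab b = Some (inr e), S e a & S e b].
  case/and4P=> ab /orP lab' ha hb; split=> //; first by case: lab' => /eqP; auto.
    move: ha; rewrite /S; case: (lab a) => [[w|e']|] // h; last by left; rewrite (eqP h).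
    by right; exists w.
  move: hb; rewrite /S; case: (lab b) => [[w|e']|] // h; last by left; rewrite (eqP h).
  by right; exists w.
pose Arc (e : {set V}) (al : R -> pt) := exists u v n m, [/\ e = [set u; v],
   lab n = Some (inl u), lab m = Some (inl v) & [/\ continuous al,
    forall t t', 0 <= t <= 1 -> 0 <= t' <= 1 -> al t = al t' -> t = t',
    al 0 = pos n, al 1 = pos m &
    forall t, 0 <= t <= 1 -> exists a b, rr e a b /\ on_segment (pos a) (pos b) (al t)]].
have arcs e : e \in E -> exists al, Arc e al.
  move=> eE; have /cards2P[u [v [uv eE']]] := E2 e eE.
  have ue : u \in e by rewrite eE' !inE eqxx.
  have ve : v \in e by rewrite eE' !inE eqxx orbT.
  have [n [q [ln lq nq]]] := adj e u eE ue.
  have [m [q' [lm lq' mq']]] := adj e v eE ve.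
  have nm : n != m.
    by apply: contraNneq uv => enm; move: ln; rewrite enm lm => -[->].
  have : connect (rr e) n m.
    apply: (@connect_trans _ _ q); first by apply: connect1; rewrite /rr nq ln lq ue !eqxx orbT.
    apply: (@connect_trans _ _ q'); last first.
      by apply: connect1; rewrite /rr Gsym mq' lm lq' ve !eqxx.
    apply: connect_sub (con _ _ _ lq lq') => a b /and3P[ab la lb]; apply: connect1.
    by rewrite /rr ab la /= (eqP la) (eqP lb) eqxx.
  case/connectP=> s0 /shortenP[s ps us _] mE.
  have sN : s != [::] by apply: contraNneq nm => s0'; rewrite mE s0'.
  have rG : subrel (rr e) G by move=> a b /and4P[].
  have [al [cal ial al0 al1 sal]] := chain_arc dG rG ps us sN.
  exists al, u, v, n, m; split=> //; split=> //; first by rewrite mE.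
  by move=> t /sal[a [b [_ _ rab zab]]]; exists a, b.
have [alpha alphaP] : exists alpha : {set V} -> R -> pt, forall e, e \in E -> Arc e (alpha e).
  apply: (fin_all_exists (P := fun e al => e \in E -> Arc e al)) => e.
  have [/arcs[al]|_] := boolP (e \in E); first by exists al.
  by exists (fun=> 0).
pose M := \big[Num.max/0]_x (pos x).1.
have Mle x : (pos x).1 <= M by apply: (le_bigmax _ (fun x => (pos x).1) x).
pose cov v := [exists e in E, v \in e].
pose far (v : V) : pt := (M + 1 + (enum_rank v : nat)%:R, 0).
pose p v : pt := if cov v then if [pick x | lab x == Some (inl v)] is Some x then pos x else far v
  else far v.
have covP v : cov v -> exists n q e, [/\ e \in E, v \in e, lab n = Some (inl v),
    lab q = Some (inr e) & G n q /\ p v = pos n].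
  move=> cv; have /existsP[e /andP[eE ve]] := cv.
  have [n [q [ln lq nq]]] := adj e v eE ve.
  exists n, q, e; split=> //; split=> //; rewrite /p cv.
  by case: pickP => [x /eqP lx|/(_ n)]; [rewrite (thin v x n)|rewrite ln eqxx].
have farP v : ~~ cov v -> p v = far v by rewrite /p => /negPf ->.
have far_M v : M < (far v).1.
  by rewrite /far /= -addrA ltrDl ltr_pwDl.
have arc_M e t : e \in E -> 0 <= t <= 1 -> (alpha e t).1 <= M.
  move=> eE t01; have [u [v [n [m [_ _ _ [_ _ _ _ /(_ t t01)[a [b [_ [s s01 ->]]]]]]]]]] := alphaP e eE.
  by rewrite /=; have := Mle a; have := Mle b; nra.
have vertex_cross v n q e z a b : e \in E -> lab n = Some (inl v) -> G n q ->
    (exists e', lab q = Some (inr e')) -> rr e a b -> z = pos n ->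
    on_segment (pos a) (pos b) z -> v \in e \/ lab q = Some (inr e).
  move=> eE ln nq [e' lq] /rrS[ab le Sa Sb] zn zab.
  have znq : on_segment (pos n) (pos q) z by rewrite zn; exact: on_segment_l.
  have Sn c : S e c -> c = n -> v \in e.
    by move=> Sc cn; move: Sc; rewrite cn /S ln => -[//|[w we [->]]].
  have Sq c : S e c -> c = q -> lab q = Some (inr e).
    by move=> Sc cq; move: Sc; rewrite cq /S lq => -[//|[w we //]].
  case: (sl_cross dG nq ab znq zab) => [[[e1 e2]|[e1 e2]]|].
  - by left; apply: Sn (esym e1).
  - by left; apply: Sn (esym e1).
  - by case=> c [[cn|cq] [ca|cb] _]; [left; apply: Sn Sa _|left; apply: Sn Sb _|
      right; apply: Sq Sa _|right; apply: Sq Sb _]; congruence.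
have at_end e w c t : e \in E -> w \in e -> lab c = Some (inl w) -> 0 <= t <= 1 ->
    alpha e t = pos c -> t = 0 \/ t = 1.
  move=> eE we lc t01 ac.
  have [u [v [n [m [ee ln lm [_ inj a0 a1 _]]]]]] := alphaP e eE.
  have o01 : 0 <= (0 : R) <= 1 by rewrite lexx ler01.
  have l01 : 0 <= (1 : R) <= 1 by rewrite lexx ler01.
  move: we; rewrite ee !inE => /orP[] /eqP wE; rewrite wE in lc.
    by left; apply: inj => //; rewrite a0 ac (thin u c n).
  by right; apply: inj => //; rewrite a1 ac (thin v c m).
exists p, alpha; split.
- move=> v w; have [cv|cv] := boolP (cov v); have [cw|cw] := boolP (cov w); last 1 first.
  + by rewrite !farP // => -[] /addrI/eqP; rewrite eqr_nat => /eqP/val_inj/enum_rank_inj.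
  + have [n [q [e [eE ve ln lq [nq ->]]]]] := covP v cv.
    have [m [q' [e' [e'E we lm lq' [mq ->]]]]] := covP w cw.
    move=> pnm; have zm : on_segment (pos m) (pos q') (pos n) by rewrite pnm; exact: on_segment_l.
    have nm : n = m -> v = w by move=> nm; move: ln; rewrite nm lm => -[->].
    case: (sl_cross dG nq mq (on_segment_l _ _) zm) => [[[e1 _]|[e1 _]]|]; first exact: nm.
      by move: ln; rewrite e1 lq'.
    case=> c [[cn|cq] [cm|cq'] zc].
    * by apply: nm; rewrite -cn.
    * by move: ln; rewrite -cn cq' lq'.
    * by case: (sl_neq dG nq); rewrite zc cq.
    * by case: (sl_neq dG nq); rewrite zc cq.
  + have [n [q [e [eE ve ln lq [nq ->]]]]] := covP v cv; rewrite farP // => e1.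
    by have := Mle n; rewrite e1 leNgt far_M.
  + have [n [q [e [eE ve ln lq [nq ->]]]]] := covP w cw; rewrite farP // => e1.
    by have := Mle n; rewrite -e1 leNgt far_M.
- move=> e eE; have [u [v [n [m [_ _ _ [cal _ _ _ _]]]]]] := alphaP e eE.
  exact: continuous_subspaceT.
- move=> e eE s t s01 t01; have [u [v [n [m [_ _ _ [_ inj _ _ _]]]]]] := alphaP e eE.
  exact: inj.
- move=> e eE; have [u [v [n [m [ee ln lm [_ _ a0 a1 _]]]]]] := alphaP e eE.
  have pE w c : w \in e -> lab c = Some (inl w) -> p w = pos c.
    move=> we lc; have cw : cov w by apply/existsP; exists e; rewrite eE.
    have [c' [q [e' [_ _ lc' _ [_ ->]]]]] := covP w cw.
    by rewrite (thin w c c').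
  exists u, v; rewrite a0 a1 (pE u n) ?(pE v m) //; by rewrite ee !inE eqxx ?orbT.
- move=> e eE t v tlt; have t01 : 0 <= t <= 1 by lra.
  have [cv|cv] := boolP (cov v); last first.
    by rewrite farP // => e1; have := arc_M e t eE t01; rewrite e1 leNgt far_M.
  have [n [q [e' [e'E ve ln lq [nq ->]]]]] := covP v cv => ac.
  have [_ [_ [_ [_ [_ _ _ [_ _ _ _ /(_ t t01)[a [b [rab zab]]]]]]]]] := alphaP e eE.
  have ve' : v \in e.
    by case: (vertex_cross v n q e _ a b eE ln nq _ rab ac zab) => //; [exists e'|rewrite lq => -[<-]].
  by case: (at_end e v n t eE ve' ln t01 ac); lra.
- move=> e e' eE e'E ee' s t slt tlt st.
  have s01 : 0 <= s <= 1 by lra.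
  have t01 : 0 <= t <= 1 by lra.
  have [_ [_ [_ [_ [_ _ _ [_ _ _ _ /(_ s s01)[a [b [rab zab]]]]]]]]] := alphaP e eE.
  have [_ [_ [_ [_ [_ _ _ [_ _ _ _ /(_ t t01)[a' [b' [rab' zab']]]]]]]]] := alphaP e' e'E.
  rewrite -st in zab'.
  have [Gab leab Sa Sb] := rrS _ _ _ rab; have [Gab' _ Sa' Sb'] := rrS _ _ _ rab'.
  have Sdis c : S e' c -> lab c <> Some (inr e).
    by case=> [->|[w _ ->]] // -[e1]; rewrite e1 eqxx in ee'.
  case: (sl_cross dG Gab Gab' zab zab') => [[[e1 e2]|[e1 e2]]|].
  + by case: leab; [rewrite e1|rewrite e2]; exact: Sdis.
  + by case: leab; [rewrite e1|rewrite e2]; exact: Sdis.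
  case=> c [cab cab' zc].
  have Sc : S e c by case: cab => ->.
  have Sc' : S e' c by case: cab' => ->.
  case: Sc => [/Sdis -/(_ Sc') //|[w we lc]].
  by case: (at_end e w c s eE we lc s01 zc); lra.
Qed.

End Arcs.

(** * Discretisation of plane drawings *)

Definition gstep : rel cell := fun c d => (c == d) || gadj c d.

Lemma path_walk (P : pred cell) c s : path gstep c s -> all P (c :: s) -> walk P c (last c s).
Proof.
elim: s c => [|d s IH] c /=; first by move=> _ /andP[Pc _]; exact: walk_refl.
case/andP=> cd ds /and3P[Pc Pd Ps]; have w := IH d ds (introT andP (conj Pd Ps)).
by case/orP: cd => [/eqP -> //|cd]; exact: walk_step w.
Qed.

(* From the last visit of A before the first visit of B to that visit of B. *)
Lemma path_trim (T : eqType) (r : rel T) (A B : pred T) x0 s :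
  (forall x, A x -> ~~ B x) -> path r x0 s -> A x0 -> B (last x0 s) ->
  exists x m y, [/\ A x, B y, path r x (rcons m y), {subset m <= s} &
    all (fun z => ~~ A z && ~~ B z) m].
Proof.
move=> AB pth Ax0 Bl.
have main c t : path r c t -> ~~ B c -> B (last c t) ->
    (exists x m y, [/\ A x, B y, path r x (rcons m y), {subset m <= c :: t} &
      all (fun z => ~~ A z && ~~ B z) m]) \/
    (~~ A c /\ exists m y, [/\ B y, path r c (rcons m y), {subset m <= t} &
      all (fun z => ~~ A z && ~~ B z) m]).
  elim: t c => [|d t IH] c /=; first by move=> _ /negP.
  case/andP=> cd dt nBc Bl'; have [Bd|nBd] := boolP (B d).
    have [Ac|nAc] := boolP (A c).
      by left; exists c, [::], d; rewrite /= cd.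
    by right; split=> //; exists [::], d; rewrite /= cd.
  case: (IH d dt nBd Bl') => [[x [m [y [Ax By pm sm nm]]]]|[nAd [m [y [By pm sm nm]]]]].
    by left; exists x, m, y; split=> // z /sm zz; rewrite in_cons zz orbT.
  have sm' : {subset d :: m <= d :: t}.
    by move=> z; rewrite !inE => /orP[->//|/sm ->]; rewrite orbT.
  have [Ac|nAc] := boolP (A c).
    left; exists c, (d :: m), y; split=> //=; rewrite ?cd ?nAd ?nBd //.
    by move=> z /sm' zz; rewrite in_cons zz orbT.
  by right; split=> //; exists (d :: m), y; split=> //=; rewrite ?cd ?nAd ?nBd.
case: (main x0 s pth (AB _ Ax0) Bl) => [[x [m [y [Ax By pm sm nm]]]]|[]]; last by rewrite Ax0.
exists x, m, y; split=> // z zm; have := sm z zm; rewrite inE => /orP[/eqP zx|//].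
by have /allP/(_ z zm) := nm; rewrite zx Ax0.
Qed.

Lemma gstep_row a b k : [\/ a = b, a = b.+1 | b = a.+1] -> gstep (a, k) (b, k).
Proof. by case=> ->; rewrite /gstep /gadj /= ?xpair_eqE; lia. Qed.

Lemma gstep_col a b k : [\/ a = b, a = b.+1 | b = a.+1] -> gstep (k, a) (k, b).
Proof. by case=> ->; rewrite /gstep /gadj /= ?xpair_eqE; lia. Qed.

Lemma gadj_row i k : gadj (i, k) (i.+1, k).
Proof. by rewrite /gadj /= !eqxx orbT. Qed.

Lemma gadj_col i k : gadj (k, i) (k, i.+1).
Proof. by rewrite /gadj /= !eqxx. Qed.

Section Discretize.
Local Open Scope ring_scope.
Context (R : realType).
Notation pt := (R * R)%type.

Definition near_by (k : R) (z w : pt) : bool :=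
  [&& z.1 - w.1 <= k, w.1 - z.1 <= k, z.2 - w.2 <= k & w.2 - z.2 <= k].

Lemma near_by_le (k k' : R) z w : k <= k' -> near_by k z w -> near_by k' z w.
Proof. by move=> kk /and4P[? ? ? ?]; apply/and4P; split; lra. Qed.

Lemma near_by_trans (k k' : R) z w x : near_by k z w -> near_by k' w x -> near_by (k + k') z x.
Proof. by move=> /and4P[? ? ? ?] /and4P[? ? ? ?]; apply/and4P; split; lra. Qed.

Lemma near_byC (k : R) z w : near_by k z w -> near_by k w z.
Proof. by move=> /and4P[? ? ? ?]; apply/and4P; split; lra. Qed.

Definition point_of (c : cell) : pt := ((c.1)%:R, (c.2)%:R).
Definition cell_at (z : pt) : cell := (Num.truncn z.1, Num.truncn z.2).

Lemma cell_at_near z : 0 <= z.1 -> 0 <= z.2 -> near_by 1 (point_of (cell_at z)) z.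
Proof.
move=> /truncn_itv h1 /truncn_itv h2; rewrite /near_by /cell_at /point_of /=.
by move: h1 h2; rewrite -!natr1 => h1 h2; apply/and4P; split; lra.
Qed.

Lemma truncn_close (x y : R) : 0 <= x -> 0 <= y -> x - y <= 1 -> y - x <= 1 ->
  [\/ Num.truncn x = Num.truncn y, Num.truncn x = (Num.truncn y).+1 |
      Num.truncn y = (Num.truncn x).+1].
Proof.
move=> x0 y0 xy yx; have /andP[x1 x2] := truncn_itv x0; have /andP[y1 y2] := truncn_itv y0.
have h1 : (Num.truncn x < (Num.truncn y).+2)%N.
  by rewrite -(ltr_nat R) -natr1; apply: (le_lt_trans x1); lra.
have h2 : (Num.truncn y < (Num.truncn x).+2)%N.
  by rewrite -(ltr_nat R) -natr1; apply: (le_lt_trans y1); lra.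
case: (ltngtP (Num.truncn x) (Num.truncn y)) => h; last by constructor 1.
  by constructor 3; lia.
by constructor 2; lia.
Qed.

(** Rounding moves consecutive sample points by at most one in each coordinate; the cell [mid]
    splits a diagonal move in two. *)
Lemma sample_cells (T : pt -> Prop) z0 zs :
  path (near_by 1) z0 zs -> (forall z, z \in z0 :: zs -> T z /\ (0 <= z.1) /\ (0 <= z.2)) ->
  exists s, [/\ path gstep (cell_at z0) s, last (cell_at z0) s = cell_at (last z0 zs) &
    forall c, c \in cell_at z0 :: s -> exists2 z, T z & near_by 3 (point_of c) z].
Proof.
elim: zs z0 => [|z1 zs IH] z0 /=.
  move=> _ H; exists [::]; split=> // c; rewrite inE => /eqP ->.
  have [Tz [h1 h2]] := H z0 (mem_head _ _); exists z0 => //.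
  by apply: near_by_le (cell_at_near h1 h2); lra.
case/andP=> z01 pth H.
have [|s [ps ls Hs]] := IH z1 pth; first by move=> z zz; apply: H; rewrite in_cons zz orbT.
have [Tz0 [a1 a2]] := H z0 (mem_head _ _).
have [Tz1 [b1 b2]] : T z1 /\ (0 <= z1.1) /\ (0 <= z1.2) by apply: H; rewrite !inE eqxx orbT.
have /and4P[n1 n2 n3 n4] := z01.
have := cell_at_near a1 a2; rewrite /near_by => /and4P[m1 m2 m3 m4].
have := cell_at_near b1 b2; rewrite /near_by => /and4P[k1 k2 k3 k4].
pose mid : cell := ((cell_at z1).1, (cell_at z0).2).
exists (mid :: cell_at z1 :: s); split=> //=.
  rewrite ps andbT; apply/andP; split.
    by apply: gstep_row; exact: truncn_close.
  by rewrite /mid; apply: gstep_col; exact: truncn_close.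
move=> c; rewrite !inE => /or3P[/eqP ->|/eqP ->|cs].
- by exists z0 => //; apply: near_by_le (cell_at_near a1 a2); lra.
- exists z0 => //; apply/and4P; split; rewrite /mid /=;
    [move: n1 n2 k1 k2|move: n1 n2 k1 k2|move: m3 m4|move: m3 m4];
    rewrite /point_of /=; lra.
- by apply: Hs; rewrite inE.
Qed.

Context (V : finType) (E : {set {set V}}) (p : V -> pt) (T : {set V} -> pt -> Prop) (r M : R).
Context (r10 : 10 <= r).
Context (arc_ends : forall e, e \in E -> exists u v z0 zs, [/\ e = [set u; v], u != v,
  z0 = p u, last z0 zs = p v & path (near_by 1) z0 zs /\ forall z, z \in z0 :: zs -> T e z]).
Context (arc_far : forall e z v, e \in E -> T e z -> v \notin e -> ~~ near_by (8 * r) z (p v)).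
Context (arc_meet : forall e e' z z', e \in E -> e' \in E -> e != e' -> T e z -> T e' z' ->
  near_by 10 z z' -> exists v, near_by r z (p v)).
Context (vertex_far : forall v w, v != w -> ~~ near_by (8 * r) (p v) (p w)).
Context (vertex_range : forall v, [/\ 4 * r <= (p v).1, (p v).1 <= M, 4 * r <= (p v).2 & (p v).2 <= M]).
Context (arc_range : forall e z, e \in E -> T e z ->
  [/\ 4 * r <= z.1, z.1 <= M, 4 * r <= z.2 & z.2 <= M]).

Let inB v c := near_by (2 * r) (point_of c) (p v).

Lemma inB_inj v w c : inB v c -> inB w c -> v = w.
Proof.
have r_ge := r10.
move=> vc wc; apply/eqP; apply: contraT => /vertex_far/negP[].
by apply: near_by_le (near_by_trans (near_byC vc) wc); lra.
Qed.

(** The disc is a square of the maximum norm: follow a row, then a column. *)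
Lemma disc_walk v c d : inB v c -> inB v d -> walk (inB v) c d.
Proof.
have r_ge := r10.
case: c d => [i j] [i' j'] /and4P[c1 c2 c3 c4] /and4P[d1 d2 d3 d4].
rewrite /point_of /= in c1 c2 c3 c4 d1 d2 d3 d4.
have rowW m n k : (m <= n)%N -> m%:R - (p v).1 <= 2 * r -> (p v).1 - m%:R <= 2 * r ->
    n%:R - (p v).1 <= 2 * r -> k%:R - (p v).2 <= 2 * r -> (p v).2 - k%:R <= 2 * r ->
    walk (inB v) (m, k) (n, k).
  move=> mn; rewrite -(subnK mn); elim: (n - m)%N => [|l IH] m1 m2 n1 k1 k2.
    by apply: walk_refl; apply/and4P.
  have h : (l + m)%:R <= ((l.+1 + m)%:R : R) by rewrite ler_nat addSn leqnSn.
  have h' : m%:R <= ((l + m)%:R : R) by rewrite ler_nat leq_addl.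
  apply: walk_trans (IH _ _ _ _ _) _ => //; first by lra.
  apply: walk1; [| |exact: gadj_row]; apply/and4P; split; rewrite /=; lra.
have colW m n k : (m <= n)%N -> m%:R - (p v).2 <= 2 * r -> (p v).2 - m%:R <= 2 * r ->
    n%:R - (p v).2 <= 2 * r -> k%:R - (p v).1 <= 2 * r -> (p v).1 - k%:R <= 2 * r ->
    walk (inB v) (k, m) (k, n).
  move=> mn; rewrite -(subnK mn); elim: (n - m)%N => [|l IH] m1 m2 n1 k1 k2.
    by apply: walk_refl; apply/and4P.
  have h : (l + m)%:R <= ((l.+1 + m)%:R : R) by rewrite ler_nat addSn leqnSn.
  have h' : m%:R <= ((l + m)%:R : R) by rewrite ler_nat leq_addl.
  apply: walk_trans (IH _ _ _ _ _) _ => //; first by lra.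
  apply: walk1; [| |exact: gadj_col]; apply/and4P; split; rewrite /=; lra.
apply: (@walk_trans _ _ (i', j)).
  have [h|h] := leqP i i'; first exact: rowW.
  by apply: walk_sym; apply: rowW => //; exact: ltnW.
have [h|h] := leqP j j'; first exact: colW.
by apply: walk_sym; apply: colW => //; exact: ltnW.
Qed.

(** The branch set of a vertex consists of the cells within 2r of it and, for each edge that it
    owns, the rounded arc trimmed to run between the discs of its ends. Two trimmed arcs share no
    cell: sample points near a shared cell are within 10 of each other, hence one is within r of a
    vertex, and r + 3 <= 2r would put the cell into a disc. *)
Lemma discretize : grid_minor E.
Proof.
have r_ge := r10.
have pathP e : e \in E -> exists (d : V * V * cell * seq cell * cell),
    let: (u, v, x, m, y) := d in
    [/\ e = [set u; v], u != v, inB u x, inB v y &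
     [/\ path gstep x (rcons m y),
      (forall c, c \in m -> exists2 z, T e z & near_by 3 (point_of c) z) &
      forall c w, c \in m -> ~~ inB w c]].
  move=> eE; have [u [v [z0 [zs [ee uv z0E lE [pth Tz]]]]]] := arc_ends eE.
  have [|s [ps ls Hs]] := @sample_cells (T e) z0 zs pth.
    by move=> z /Tz tz; split=> //; have [? ? ? ?] := arc_range eE tz; split; lra.
  have atB w : inB w (cell_at (p w)).
    have [h1 _ h2 _] := vertex_range w; apply: near_by_le (cell_at_near _ _); lra.
  have AB x : inB u x -> ~~ inB v x.
    by move=> ux; apply: contraNN uv => vx; rewrite (inB_inj ux vx).
  have Bl : inB v (last (cell_at z0) s) by rewrite ls lE.
  have Az0 : inB u (cell_at z0) by rewrite z0E.
  have [x [m [y [ux vy pm sm nm]]]] := path_trim AB ps Az0 Bl.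
  have mT c : c \in m -> exists2 z, T e z & near_by 3 (point_of c) z.
    by move=> /sm cs; apply: Hs; rewrite inE cs orbT.
  exists (u, v, x, m, y); split=> //; split=> // c w cm.
  have /allP/(_ c cm)/andP[nu nv] := nm.
  have [->//|wu] := eqVneq w u; have [->//|wv] := eqVneq w v.
  have [z tz cz] := mT c cm; apply/negP => wc.
  have /negP[] : ~~ near_by (8 * r) z (p w).
    by apply: (arc_far eE tz); rewrite ee !inE negb_or wu wv.
  by apply: near_by_le (near_by_trans (near_byC cz) wc); lra.
have [E0|[e0 e0E]] : E = finset.set0 \/ exists e, e \in E.
  by have [->|/finset.set0Pn[e eE]] := eqVneq E finset.set0; [left|right; exists e].
  exists (fun=> None), 0%N; split=> // a b _; by rewrite E0 finset.inE.
have [d0 _] := pathP e0 e0E.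
have [D DP] : exists D : {set V} -> V * V * cell * seq cell * cell, forall e, e \in E ->
    let: (u, v, x, m, y) := D e in
    [/\ e = [set u; v], u != v, inB u x, inB v y &
     [/\ path gstep x (rcons m y),
      (forall c, c \in m -> exists2 z, T e z & near_by 3 (point_of c) z) &
      forall c w, c \in m -> ~~ inB w c]].
  apply: (fin_all_exists (P := fun e (D : V * V * cell * seq cell * cell) => e \in E ->
    let: (u, v, x, m, y) := D in
    [/\ e = [set u; v], u != v, inB u x, inB v y &
     [/\ path gstep x (rcons m y),
      (forall c, c \in m -> exists2 z, T e z & near_by 3 (point_of c) z) &
      forall c w, c \in m -> ~~ inB w c]])) => e.
  by have [/pathP[D DP]|_] := boolP (e \in E); [exists D|exists d0].
pose mid e := (D e).1.2; pose own e := (D e).1.1.1.1.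
pose f c : option V := if [pick v | inB v c] is Some v then Some v else
  if [pick e in E | c \in mid e] is Some e then Some (own e) else None.
have fB v c : inB v c -> f c = Some v.
  rewrite /f => vc; case: pickP => [w wc|/(_ v)]; last by rewrite vc.
  by rewrite (inB_inj vc wc).
have mid_uniq e e' c : e \in E -> e' \in E -> c \in mid e -> c \in mid e' -> e = e'.
  move=> eE e'E; have := DP e eE; have := DP e' e'E; rewrite /mid.
  case: (D e) => [[[[u v] x] m] y] /=; case: (D e') => [[[[u' v'] x'] m'] y'] /=.
  move=> [_ _ _ _ [_ mT' _]] [_ _ _ _ [_ mT nB]] cm cm'.
  apply/eqP; apply: contraT => ee.
  have [z tz cz] := mT c cm; have [z' tz' cz'] := mT' c cm'.
  have zz : near_by 10 z z' by apply: near_by_le (near_by_trans (near_byC cz) cz'); lra.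
  have [w zw] := arc_meet eE e'E ee tz tz' zz.
  have /negP[] := nB c w cm.
  by apply: near_by_le (near_by_trans cz zw); lra.
have fmid e c : e \in E -> c \in mid e -> f c = Some (own e).
  move=> eE cm; have := DP e eE; rewrite /f /mid in cm *.
  case: pickP => [w wc|_ _].
    case: (D e) cm => [[[[u v] x] m] y] /= cm [_ _ _ _ [_ _ nB]].
    by have := nB c w cm; rewrite wc.
  case: pickP => [e' /andP[e'E cm']|/(_ e)]; last by rewrite eE cm.
  by rewrite (mid_uniq e e' c).
have fP c a : f c = Some a -> inB a c \/ exists e, [/\ e \in E, c \in mid e & own e = a].
  rewrite /f; case: pickP => [w wc [<-]|_]; first by left.
  by case: pickP => [e /andP[eE cm] [<-]|//]; right; exists e.
have to_disc c a : f c = Some a -> exists2 x, inB a x & walk (fun c => f c == Some a) x c.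
  case/fP => [ac|[e [eE cm oe]]].
    by exists c => //; apply: walk_refl; rewrite (fB a).
  have fm d : d \in mid e -> f d = Some a by move=> dm; rewrite (fmid e) // oe.
  have := DP e eE; rewrite /mid /own in cm oe fm.
  case: (D e) cm oe fm => [[[[u v] x] m] y] /= cm ua fm [_ _ ux _ [pm _ _]].
  exists x; first by rewrite -ua.
  case/splitPr: cm pm fm => m1 m2; rewrite rcons_cat cat_path /= => /and3P[p1 p2 _] fm.
  have -> : c = last x (rcons m1 c) by rewrite last_rcons.
  apply: path_walk; first by rewrite rcons_path p1 p2.
  rewrite /= all_rcons (fB a) ?eqxx -?ua //= ua fm ?mem_cat ?mem_head ?orbT // eqxx /=.
  by apply/allP => d dm; rewrite fm // mem_cat dm.
pose N := (Num.truncn (M + 3 * r)).+1.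
have rM : 0 <= M + 3 * r.
  have [_ [v _]] : exists e : {set V}, exists v : V, v \in e.
    by exists e0; have [u [v [_ [_ [-> _ _ _ _]]]]] := arc_ends e0E; exists u; rewrite !inE eqxx.
  by have [h1 h2 _ _] := vertex_range v; lra.
exists f, N; split.
- move=> c; case fc : (f c) => [a|//] _.
  have [z [cz [z1 z2 z3 z4]]] : exists z, near_by (2 * r) (point_of c) z /\
      [/\ 4 * r <= z.1, z.1 <= M, 4 * r <= z.2 & z.2 <= M].
    case: (fP c a fc) => [ac|[e [eE cm _]]].
      by exists (p a); split=> //; exact: vertex_range.
    have := DP e eE; rewrite /mid in cm; case: (D e) cm => [[[[u v] x] m] y] /= cm.
    move=> [_ _ _ _ [_ mT _]]; have [z tz cz] := mT c cm; exists z; split.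
      by apply: near_by_le cz; lra.
    exact: arc_range tz.
  case/and4P: cz; rewrite /point_of /= => h1 h2 h3 h4.
  have pos (k : nat) : 0 < (k%:R : R) -> (0 < k)%N by rewrite ltr0n.
  have lt (k : nat) : (k%:R : R) <= M + 2 * r -> (k < N)%N.
    move=> kM; rewrite /N ltnS -(ler_nat R); have /andP[_] := truncn_itv rM.
    rewrite -natr1 => h; rewrite ler_nat.
    by rewrite truncn_ge_nat //; lra.
  by rewrite !pos ?lt //; lra.
- move=> a c d /to_disc[x ax wx] /to_disc[y ay wy].
  apply: walk_trans (walk_sym wx) (walk_trans _ wy).
  by apply: walk_sub (disc_walk ax ay) => q /fB ->.
- move=> a b ab abE; have := DP _ abE.
  have fm c : c \in mid [set a; b] -> f c = Some (own [set a; b]) by move=> ?; rewrite (fmid [set a; b]).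
  rewrite /mid /own in fm; case: (D [set a; b]) fm => [[[[u v] x] m] y] /= fm.
  move=> [ee uv ux vy [pm _ nB]].
  have [c [fc cy]] : exists c, f c = Some u /\ gadj c y.
    have ny c : f c = Some u -> gstep c y -> gadj c y.
      move=> fc /orP[/eqP cy|//]; move: fc; rewrite cy (fB v) // => -[vu].
      by rewrite vu eqxx in uv.
    move: pm; rewrite rcons_path => /andP[_ ly]; exists (last x m).
    suff fl : f (last x m) = Some u by split=> //; exact: ny.
    case: (lastP m) fm => [|m' z] fm /=; first exact: fB.
    by rewrite last_rcons; apply: fm; rewrite mem_rcons mem_head.
  case: (set2_inj ee) => -[-> ->]; first by exists c, y; split=> //; exact: fB.
  by exists y, c; split; [exact: fB| |rewrite gadjC].
Qed.

End Discretize.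

Lemma path_iota (T : Type) (r : rel T) (h : nat -> T) m n :
  (forall k, m <= k < m + n -> r (h k) (h k.+1)) -> path r (h m) (map h (iota m.+1 n)).
Proof.
elim: n m => [//|n IH] m H /=; rewrite H ?leqnn //=; last by lia.
by apply: IH => k hk; apply: H; lia.
Qed.

Lemma last_iota (T : Type) (h : nat -> T) m n : last (h m) (map h (iota m.+1 n)) = h (m + n).
Proof. by elim: n m => [|n IH] m /=; rewrite ?addn0 // IH addSnnS. Qed.

(** * Uniform estimates for arcs *)

Section Continuity.
Local Open Scope ring_scope.
Context (R : realType).
Notation pt := (R * R)%type.

(** Precomposition with it extends an arc from [0, 1] to a continuous map on the whole line. *)
Definition clamp (t : R) : R := Num.min (Num.max t 0) 1.

Lemma clamp01 t : 0 <= clamp t <= 1.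
Proof. by rewrite /clamp le_min ge_min le_max !lexx ler01 !orbT. Qed.

Lemma clamp_id t : 0 <= t <= 1 -> clamp t = t.
Proof. by move=> /andP[t0 t1]; rewrite /clamp max_l // min_l. Qed.

Lemma clamp_continuous : continuous clamp.
Proof.
move=> t; apply: (@continuous_min R R (fun t : R => Num.max t 0) (fun=> 1) t); last exact: cvg_cst.
by apply: (@continuous_max R R id (fun=> 0) t); [exact: cvg_id|exact: cvg_cst].
Qed.

Lemma extend_continuous (f : R -> pt) : {within `[0, 1], continuous f}%classic ->
  continuous (f \o clamp).
Proof.
move=> /subspace_continuousP fc t.
have c01 : (`[0, 1]%classic (clamp t)) by rewrite /= in_itv /= clamp01.
apply: (@cvg_comp _ _ _ clamp f (nbhs t) (within `[0, 1]%classic (nbhs (clamp t)))); last exact: fc.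
rewrite /within => A /(@clamp_continuous t); rewrite !nbhs_filterE.
rewrite /fmap /= => hA; apply: (filterS _ hA) => u /=; rewrite in_itv /= clamp01 => H; exact: H.
Qed.

Definition sub2 (z w : pt) : pt := (z.1 - w.1, z.2 - w.2).

Lemma l1_sub2_continuous (f g : pt -> pt) : continuous f -> continuous g ->
  continuous (fun z => l1 (sub2 (f z) (g z))).
Proof.
move=> cf cg z; rewrite /l1 /sub2 /=.
have c1 (h : pt -> pt) : continuous h -> continuous (fun z => (h z).1).
  by move=> ch u; apply: cvg_comp (ch u) _; exact: cvg_fst.
have c2 (h : pt -> pt) : continuous h -> continuous (fun z => (h z).2).
  by move=> ch u; apply: cvg_comp (ch u) _; exact: cvg_snd.
apply: cvgD.
  by apply: cvg_norm; apply: cvgB; [exact: (c1 f cf z)|exact: (c1 g cg z)].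
by apply: cvg_norm; apply: cvgB; [exact: (c2 f cf z)|exact: (c2 g cg z)].
Qed.

Lemma l1_sub2_eq0 z w : l1 (sub2 z w) = 0 -> z = w.
Proof.
move=> /eqP; rewrite /l1 paddr_eq0 // !normr_eq0 !subr_eq0 => /andP[/eqP h1 /eqP h2].
exact: pt_eq.
Qed.

Lemma l1_ge0 (z : pt) : 0 <= l1 z.
Proof. by rewrite addr_ge0. Qed.

Lemma uniform_step (f : R -> pt) (eps : R) : continuous f -> 0 < eps ->
  exists K : nat, (0 < K)%N /\ forall s t, 0 <= s <= 1 -> 0 <= t <= 1 ->
    `|s - t| <= K%:R^-1 -> l1 (sub2 (f s) (f t)) < eps.
Proof.
move=> cf eps0.
(* [F] is positive, on the diagonal by its second term and elsewhere by its first. When |s - t| is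
   below its minimum the second term cannot vanish, which is the claim. *)
pose F s t := `|s - t| + Num.max (eps - l1 (sub2 (f s) (f t))) 0.
have cF : continuous (fun z : pt => F z.1 z.2).
  move=> z; apply: cvgD.
    by apply: cvg_norm; apply: cvgB; [exact: cvg_fst|exact: cvg_snd].
  apply: (@continuous_max R pt (fun z => eps - l1 (sub2 (f z.1) (f z.2))) (fun=> 0) z);
    last exact: cvg_cst.
  apply: cvgB; first exact: cvg_cst.
  apply: (@l1_sub2_continuous (fun z => f z.1) (fun z => f z.2)) => u.
    by apply: (@continuous_comp _ _ _ (@fst R R) f u); [exact: cvg_fst|exact: cf].
  by apply: (@continuous_comp _ _ _ (@snd R R) f u); [exact: cvg_snd|exact: cf].
have [|m m0 mF] := square_lower_bound cF.
  move=> s t _ _; rewrite /F; have [->|st] := eqVneq s t.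
    rewrite subrr normr0 add0r lt_max; apply/orP; left.
    by rewrite /l1 /sub2 !subrr normr0 addr0 subr0.
  by rewrite ltr_pwDl ?normr_gt0 ?subr_eq0 // le_max lexx orbT.
pose K := (Num.truncn m^-1).+1.
have Km : K%:R^-1 < m.
  have := truncn_itv (ltW (_ : 0 < m^-1)); rewrite invr_gt0 => /(_ m0)/andP[_ h].
  by rewrite -[m]invrK ltf_pV2 ?posrE ?invr_gt0 ?ltr0n.
exists K; split=> // s t s01 t01 st.
have := mF s t s01 t01; rewrite /F => mle.
rewrite ltNge; apply/negP => le.
have : Num.max (eps - l1 (sub2 (f s) (f t))) 0 = 0 by apply: max_r; lra.
by move=> e; rewrite e addr0 in mle; have := le_trans mle st; rewrite leNgt Km.
Qed.

Lemma bounded_arc (f : R -> pt) : continuous f ->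
  exists C : R, forall t, 0 <= t <= 1 -> l1 (f t) <= C.
Proof.
move=> cf.
have cl : continuous (fun t => l1 (f t)).
  move=> t; rewrite /l1; apply: cvgD; apply: cvg_norm.
    by apply: cvg_comp (cf t) _; exact: cvg_fst.
  by apply: cvg_comp (cf t) _; exact: cvg_snd.
have [c _ H] := EVT_max (ler01 : 0 <= 1 :> R) (continuous_subspaceT cl).
by exists (l1 (f c)) => t t01; apply: H; rewrite in_itv.
Qed.

Lemma finite_bound (I : finType) (P : I -> R -> Prop) :
  (forall i C C', C <= C' -> P i C -> P i C') -> (forall i, exists C, P i C) ->
  exists C, 0 < C /\ forall i, P i C.
Proof.
move=> Pmon Pex.
have [C CP] : exists C : I -> R, forall i, P i (C i) by exact: fin_all_exists.
exists (\big[Num.max/1]_i C i); split.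
  by apply: (@lt_le_trans _ _ 1) => //; exact: bigmax_ge_id.
by move=> i; apply: Pmon (CP i); exact: le_bigmax.
Qed.

Lemma near_by_of_l1 k z w : l1 (sub2 z w) <= k -> near_by k z w.
Proof.
rewrite /l1 /sub2 /near_by /= => h.
have := ler_norm (z.1 - w.1); have := ler_norm (w.1 - z.1).
have := ler_norm (z.2 - w.2); have := ler_norm (w.2 - z.2).
rewrite (distrC w.1) (distrC w.2) => h1 h2 h3 h4.
have := normr_ge0 (z.1 - w.1); have := normr_ge0 (z.2 - w.2) => h5 h6.
by apply/and4P; split; lra.
Qed.

Lemma l1_of_near_by k z w : near_by k z w -> l1 (sub2 z w) <= k + k.
Proof.
case/and4P=> h1 h2 h3 h4; rewrite /l1 /sub2 /=.
by apply: lerD; rewrite ler_norml; apply/andP; split; lra.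
Qed.

Definition rescale (c d : R) (z : pt) : pt := ((z.1 + c) / d, (z.2 + c) / d).

Lemma near_by_rescale c d k z w : 0 < d ->
  near_by k (rescale c d z) (rescale c d w) = near_by (k * d) z w.
Proof.
move=> d0; have h (x y : R) : ((x + c) / d - (y + c) / d <= k) = (x - y <= k * d).
  by rewrite -mulrBl ler_pdivrMr // opprD addrACA subrr addr0.
by rewrite /near_by /rescale /= !h.
Qed.

(* Near its ends f is close to an end point, and away from them it stays at a *)
(* positive distance from g. *)
Lemma curve_gap (V : finType) (p : V -> pt) (f g : R -> pt) (rho : R) :
  continuous f -> continuous g -> 0 < rho -> (exists v, f 0 = p v) -> (exists v, f 1 = p v) ->
  (forall s t, 0 < s < 1 -> 0 <= t <= 1 -> f s <> g t) ->
  exists2 eta, 0 < eta & forall s t, 0 <= s <= 1 -> 0 <= t <= 1 ->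
    l1 (sub2 (f s) (g t)) < eta -> exists v, l1 (sub2 (f s) (p v)) < rho.
Proof.
move=> cf cg rho0 [u fu] [v fv] fg.
have [K [K0 KP]] := uniform_step cf rho0.
pose x : R := K%:R^-1; pose sg := x / 4.
have x0 : 0 < x by rewrite invr_gt0 ltr0n.
have x1 : x <= 1 by rewrite invf_le1 ?ltr0n // ler1n.
have sgx : sg = x / 4 by [].
have [sg0 sg1 sgle] : [/\ 0 < sg, sg <= 4^-1 & sg <= x] by split; lra.
pose F s t := l1 (sub2 (f (sg + (1 - 2 * sg) * s)) (g t)).
have cF : continuous (fun z : pt => F z.1 z.2).
  apply: (@l1_sub2_continuous (fun z => f (sg + (1 - 2 * sg) * z.1)) (fun z => g z.2)) => z.
    apply: (@continuous_comp _ _ _ (fun z : pt => sg + (1 - 2 * sg) * z.1) f z); last exact: cf.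
    apply: cvgD; first exact: cvg_cst.
    by apply: cvgM; [exact: cvg_cst|exact: cvg_fst].
  by apply: (@continuous_comp _ _ _ (@snd R R) g z); [exact: cvg_snd|exact: cg].
have [|eta eta0 etaP] := square_lower_bound cF.
  move=> s t /andP[s0 s1] t01; rewrite lt_neqAle l1_ge0 andbT eq_sym; apply/negP => /eqP/l1_sub2_eq0.
  apply: fg => //; have h1 : (1 - 2 * sg) * s <= 1 - 2 * sg by rewrite ler_piMr //; lra.
  have h2 : 0 <= (1 - 2 * sg) * s by rewrite mulr_ge0 //; lra.
  by apply/andP; split; lra.
exists eta => // s t s01 t01 lt; have /andP[s0 s1] := s01.
have [h|h] := lerP s sg.
  exists u; rewrite -fu; apply: KP => //; first by rewrite lexx ler01.
  by rewrite -/x subr0 ger0_norm //; lra.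
have [h'|h'] := lerP (1 - sg) s.
  exists v; rewrite -fv; apply: KP => //; first by rewrite lexx ler01.
  by rewrite -/x ler0_norm //; lra.
have d0 : 0 < 1 - 2 * sg by lra.
have s'01 : 0 <= (s - sg) / (1 - 2 * sg) <= 1.
  by rewrite ler_pdivrMr // mul1r; apply/andP; split; [apply: divr_ge0|]; lra.
have := etaP _ t s'01 t01; rewrite /F mulrCA divff ?gt_eqF // mulr1 subrKC.
by move/(lt_le_trans lt); rewrite ltxx.
Qed.

End Continuity.

(** * Planar graphs are minors of the grid *)

Section PlanarGridMinor.
Local Open Scope ring_scope.
Context (R : realType) (V : finType) (E : {set {set V}}).

(** By compactness, vertices are [rho] apart from each other and from foreign arcs, and where two
    arcs come closer than [eta] they are within rho / 32 of a vertex. Scaling by 1/d turns rho / 32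
    into [r], at least 10, and [eta] into at least 32, which gives the separations [discretize] asks
    for, with room for the change of norm. The shift [c] moves the drawing into the positive
    quadrant. *)
Lemma planar_grid_minor : pair_graph E -> planar R E -> grid_minor E.
Proof.
move=> pE [p [a [pinj acont ainj aends avert adisj]]].
pose b e := a e \o @clamp R.
have bcont e : e \in E -> continuous (b e) by move=> eE; apply: extend_continuous; exact: acont.
have bE e t : 0 <= t <= 1 -> b e t = a e t by move=> t01; rewrite /b /= clamp_id.
have i0 : 0 <= (0 : R) <= 1 by rewrite lexx ler01.
have i1 : 0 <= (1 : R) <= 1 by rewrite lexx ler01.
have bends e : e \in E -> exists u v, [/\ e = [set u; v], u != v, b e 0 = p u & b e 1 = p v].
  move=> eE; have [u [v [ee h0 h1]]] := aends e eE; exists u, v; rewrite !bE //; split=> //.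
  by have := pE e eE; rewrite ee cards2; case: (u != v).
have split01 (t : R) : 0 <= t <= 1 -> [\/ t = 0, t = 1 | 0 < t < 1].
  move=> /andP[t0 t1]; have [->|tn0] := eqVneq t 0; first by constructor 1.
  have [->|tn1] := eqVneq t 1; first by constructor 2.
  by constructor 3; rewrite !lt_neqAle t0 t1 tn1 eq_sym tn0.
have bvert e v t : e \in E -> v \notin e -> 0 <= t <= 1 -> b e t <> p v.
  move=> eE ve t01; rewrite bE //; have [u [w [ee _ bu bw]]] := bends e eE.
  rewrite ee !inE negb_or in ve; case/andP: ve => vu vw.
  case: (split01 t t01) => [->|->|]; last exact: avert.
    by rewrite -bE // bu => /pinj e'; rewrite e' eqxx in vu.
  by rewrite -bE // bw => /pinj e'; rewrite e' eqxx in vw.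
have [r1 r10 r1P] : exists2 r1 : R, 0 < r1 & forall z : V * V, z.1 != z.2 ->
    r1 <= l1 (sub2 (p z.1) (p z.2)).
  apply: (@finite_eps R _ (fun z e => z.1 != z.2 -> e <= l1 (sub2 (p z.1) (p z.2)))).
    by move=> z e e' /andP[_ ee] h /h; exact: le_trans.
  move=> z; have [zz|zz] := eqVneq z.1 z.2; first by exists 1.
  exists (l1 (sub2 (p z.1) (p z.2))) => //.
  rewrite lt_neqAle l1_ge0 andbT eq_sym; apply/negP => /eqP/l1_sub2_eq0/pinj h.
  by rewrite h eqxx in zz.
have [r2 r20 r2P] : exists2 r2 : R, 0 < r2 & forall z : {set V} * V,
    z.1 \in E -> z.2 \notin z.1 -> forall t, 0 <= t <= 1 -> r2 <= l1 (sub2 (b z.1 t) (p z.2)).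
  apply: (@finite_eps R _ (fun z e => z.1 \in E -> z.2 \notin z.1 ->
    forall t, 0 <= t <= 1 -> e <= l1 (sub2 (b z.1 t) (p z.2)))).
    by move=> z e e' /andP[_ ee] h h1 h2 t t01; apply: le_trans ee (h h1 h2 t t01).
  move=> [e v] /=; have [eE|] := boolP (e \in E); last by exists 1.
  have [|ve] := boolP (v \in e); first by exists 1.
  have [||eps eps0 H] := @square_lower_bound R (fun s t => l1 (sub2 (b e s) (p v))).
  - apply: (@l1_sub2_continuous _ (fun z => b e z.1) (fun=> p v)) => z; last exact: cvg_cst.
    by apply: (@continuous_comp _ _ _ (@fst R R) (b e) z); [exact: cvg_fst|exact: bcont].
  - move=> s t s01 _; rewrite lt_neqAle l1_ge0 andbT eq_sym; apply/negP => /eqP/l1_sub2_eq0.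
    exact: bvert.
  by exists eps => // _ _ t t01; exact: (H t 0).
pose rho := Num.min r1 r2.
have rho0 : 0 < rho by rewrite lt_min r10.
have rho1 : rho <= r1 by rewrite ge_min lexx.
have rho2 : rho <= r2 by rewrite ge_min lexx orbT.
have [eta eta0 etaP] : exists2 eta : R, 0 < eta & forall z : {set V} * {set V},
    z.1 \in E -> z.2 \in E -> z.1 != z.2 -> forall s t, 0 <= s <= 1 -> 0 <= t <= 1 ->
    l1 (sub2 (b z.1 s) (b z.2 t)) < eta -> exists v, l1 (sub2 (b z.1 s) (p v)) < rho / 32.
  apply: (@finite_eps R _ (fun z eta => z.1 \in E -> z.2 \in E -> z.1 != z.2 ->
    forall s t, 0 <= s <= 1 -> 0 <= t <= 1 -> l1 (sub2 (b z.1 s) (b z.2 t)) < eta ->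
    exists v, l1 (sub2 (b z.1 s) (p v)) < rho / 32)).
    move=> z e e' /andP[_ ee] h h1 h2 h3 s t s01 t01 lt.
    by apply: (h h1 h2 h3 s t s01 t01); exact: lt_le_trans lt ee.
  move=> [e e'] /=; have [eE|] := boolP (e \in E); last by exists 1.
  have [e'E|] := boolP (e' \in E); last by exists 1.
  have [ee|ee] := eqVneq e e'; first by exists 1.
  have [u [v [_ _ bu bv]]] := bends e eE.
  have [||||||eta eta0 H] := @curve_gap R V p (b e) (b e') (rho / 32).
  - exact: bcont.
  - exact: bcont.
  - by rewrite divr_gt0.
  - by exists u.
  - by exists v.
  - move=> s t s01 t01; have s01' : 0 <= s <= 1 by case/andP: s01 => /ltW -> /ltW ->.
    rewrite !bE //; have [u' [v' [_ _ bu' bv']]] := bends e' e'E.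
    case: (split01 t t01) => [->|->|t01']; last exact: adisj.
      by rewrite -[a e' 0]bE // bu'; exact: avert.
    by rewrite -[a e' 1]bE // bv'; exact: avert.
  by exists eta => // _ _ _; exact: H.
have [C [C0 CP]] : exists C : R, 0 < C /\ forall e, e \in E -> forall t, 0 <= t <= 1 -> l1 (b e t) <= C.
  apply: (@finite_bound R _ (fun e C => e \in E -> forall t, 0 <= t <= 1 -> l1 (b e t) <= C)).
    by move=> e C C' CC h eE t t01; apply: le_trans (h eE t t01) CC.
  move=> e; have [eE|] := boolP (e \in E); last by exists 1.
  by have [C CP] := bounded_arc (bcont e eE); exists C.
have [C' [C'0 C'P]] : exists C : R, 0 < C /\ forall v, l1 (p v) <= C.
  apply: (@finite_bound R _ (fun v C => l1 (p v) <= C)); first by move=> v C1 C2 ? ?; lra.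
  by move=> v; exists (l1 (p v)).
pose c0 := C + C'; pose c := c0 + rho.
pose d := Num.min (rho / 320) (eta / 32).
have d0 : 0 < d by rewrite lt_min !divr_gt0.
have d1 : d <= rho / 320 by rewrite ge_min lexx.
have d2 : d <= eta / 32 by rewrite ge_min lexx orbT.
pose r := rho / 32 / d.
have rd : r * d = rho / 32 by rewrite /r divfK // gt_eqF.
pose M := (c0 + c) / d.
have range z : l1 z <= c0 -> [/\ 4 * r <= (rescale c d z).1, (rescale c d z).1 <= M,
    4 * r <= (rescale c d z).2 & (rescale c d z).2 <= M].
  rewrite /l1 => zc; have := normr_ge0 z.1; have := normr_ge0 z.2 => n2 n1.
  have : `|z.1| <= c0 by lra.
  have : `|z.2| <= c0 by lra.
  rewrite !ler_norml => /andP[h1 h2] /andP[h3 h4].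
  have lo x : - c0 <= x -> 4 * r <= (x + c) / d.
    by move=> h; rewrite ler_pdivlMr // -mulrA rd /c; lra.
  have hi x : x <= c0 -> (x + c) / d <= M by move=> h; rewrite ler_pM2r ?invr_gt0 //; lra.
  by split; [exact: lo|exact: hi|exact: lo|exact: hi].
pose T (e : {set V}) (z : R * R) := exists2 t : R, 0 <= t <= 1 & z = rescale c d (b e t).
apply: (@discretize R V E (fun v => rescale c d (p v)) T r M).
- by rewrite /r ler_pdivlMr //; lra.
- move=> e eE; have [u [v [ee uv bu bv]]] := bends e eE.
  have [K [K0 KP]] := uniform_step (bcont e eE) d0.
  pose h k := rescale c d (b e (k%:R / K%:R)).
  have K0' : 0 < (K%:R : R) by rewrite ltr0n.
  have k01 k : (k <= K)%N -> 0 <= (k%:R / K%:R : R) <= 1.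
    by move=> kK; rewrite divr_ge0 ?ler0n //= ler_pdivrMr // mul1r ler_nat.
  exists u, v, (h 0%N), (map h (iota 1 K)); split=> //.
  + by rewrite /h mul0r bu.
  + by rewrite last_iota add0n /h divff ?gt_eqF // bv.
  + split.
      apply: path_iota => k /andP[_ kK]; rewrite /h near_by_rescale // mul1r.
      apply: near_by_of_l1; apply: ltW; apply: KP; [exact: (k01 k (ltnW kK))|exact: (k01 k.+1 kK)|].
      by rewrite -mulrBl -natr1 opprD addNKr normrM normrN1 mul1r ger0_norm ?invr_ge0 ?ler0n.
    move=> z; rewrite in_cons => /orP[/eqP ->|/mapP[k kK ->]].
      by exists (0%:R / K%:R) => //; exact: k01.
    by exists (k%:R / K%:R) => //; apply: k01; move: kK; rewrite mem_iota add1n ltnS => /andP[].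
- move=> e z v eE [t t01 ->] ve; rewrite near_by_rescale // -mulrA rd; apply/negP => /l1_of_near_by.
  by have := r2P (e, v) eE ve t t01; rewrite /=; lra.
- move=> e e' z z' eE e'E ee [s s01 ->] [t t01 ->]; rewrite near_by_rescale // => /l1_of_near_by h.
  have [|v hv] := etaP (e, e') eE e'E ee s t s01 t01; first by rewrite /=; lra.
  by exists v; rewrite near_by_rescale // rd; apply: near_by_of_l1; exact: ltW.
- move=> v w vw; rewrite near_by_rescale // -mulrA rd; apply/negP => /l1_of_near_by.
  by have := r1P (v, w) vw; rewrite /=; lra.
- by move=> v; apply: range; have := C'P v; rewrite /c0; lra.
- by move=> e z eE [t t01 ->]; apply: range; have := CP e eE t t01; rewrite /c0; lra.
Qed.

End PlanarGridMinor.

(** * The probability bound *)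

Local Open Scope ring_scope.

Lemma simple_pair_graph (T : finType) (G : {set {set T}}) : simple_graph G <-> pair_graph G.
Proof.
split=> [/forallP H e eG|H]; first by have := H e; rewrite eG.
by apply/forall_inP.
Qed.

Lemma mem_planar_graphs (R : realType) n m (G : {set {set 'I_n}}) :
  (G \in planar_graphs R n m) = drawable G && (#|G| == m).
Proof.
rewrite inE; apply/and3P/andP => [[/simple_pair_graph pG -> /asboolP plG]|[/drawableP[pG gG] ->]].
  by split=> //; apply/drawableP; split=> //; exact: planar_grid_minor plG.
by split=> //; [exact/simple_pair_graph|apply/asboolP; exact: grid_minor_planar].
Qed.

Lemma size_thresholds N s m n : (0 < s -> s * m + n <= 3 * s * n -> N + 6 * s + 4 <= n ->
  [/\ N <= n, 4 <= n & m + 6 <= 3 * n])%N.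
Proof. by move=> *; split; nia. Qed.

Unset Implicit Arguments.
Set Printing Implicit Defensive.

Theorem theorem3p2 (R : realType) (V : finType) (H : {set {set V}}) (c B : R)
    (H_simple : simple_graph H) (H_connected : connected_graph H)
    (H_planar : planar R H) (H_edges : (#|H| <= #|V|)%N)
    (c_gt0 : 0 < c) (B_lt3 : B < 3) :
  exists (eps : R) (N : nat), 0 < eps /\
    forall m : nat -> nat,
      (forall n : nat, c * n%:R <= (m n)%:R <= B * n%:R) ->
      forall n : nat, (N <= n)%N ->
        eps <= uniform_probability R (planar_graphs R n (m n))
                 (fun G => has_component_iso H G).
Proof.
have pH : pair_graph H by exact/simple_pair_graph.
have gH : grid_minor H by exact: planar_grid_minor H_planar.
(* Integers with 1/q <= c and 1/s <= 3 - B, so that cn <= m <= Bn gives n <= qm and sm + n <=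
   3sn. *)
pose q := (Num.truncn c^-1).+1; pose s := (Num.truncn (3 - B)^-1).+1.
have B0 : 0 < 3 - B by lra.
have qc : 1 <= q%:R * c.
  have /andP[_ h] := truncn_itv (ltW (etrans (invr_gt0 c) c_gt0)).
  by rewrite -ler_pdivrMr // div1r; exact: ltW.
have sB : 1 <= s%:R * (3 - B).
  have /andP[_ h] := truncn_itv (ltW (etrans (invr_gt0 (3 - B)) B0)).
  by rewrite -ler_pdivrMr // div1r; exact: ltW.
have [K [N KN]] := without_copy_rate (q := q) (s := s) pH H_connected gH H_edges (ltn0Sn _) (ltn0Sn _).
(* There are at most [K] graphs without the component for each one with it. The summands 6s and 4
   give m + 6 <= 3n and n >= 4, so planar graphs with m edges exist and the quotient is a genuine
   one. *)
exists (K.+1%:R^-1), (N + 6 * s + 4)%N; split; first by rewrite invr_gt0.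
move=> m mB n nN; have /andP[mc mB'] := mB n.
have n0 : 0 <= n%:R :> R by rewrite ler0n.
have nq : (n <= q * m n)%N.
  rewrite -(ler_nat R) natrM; apply: (@le_trans _ _ (q%:R * (c * n%:R))).
    by rewrite mulrA ler_peMl.
  by rewrite ler_wpM2l // ler0n.
have sm : (s * m n + n <= 3 * s * n)%N.
  rewrite -(ler_nat R) natrD !natrM.
  have h1 : s%:R * (m n)%:R <= s%:R * (B * n%:R) by rewrite ler_wpM2l // ler0n.
  have h2 : n%:R <= s%:R * (3 - B) * n%:R by rewrite ler_peMl.
  by lra.
have [nN' n4 mn6] := size_thresholds (s := s) (ltn0Sn _) sm nN.
set P := planar_graphs R n (m n).
have [G0 [dG0 cG0]] : exists G : {set {set 'I_n}}, drawable G /\ #|G| = m n.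
  by apply: exists_drawable; rewrite card_ord.
have P0 : (0 < #|P|)%N by apply/card_gt0P; exists G0; rewrite mem_planar_graphs dG0 cG0 eqxx.
have good : [set G in P | has_component_iso H G] = with_copy 'I_n H (m n) (m n).
  by apply/setP => G; rewrite inE mem_planar_graphs [RHS]inE -eqn_leq [m n == _]eq_sym andbAC -andbA.
have bad : P :\: [set G in P | has_component_iso H G] = without_copy 'I_n H (m n).
  apply/setP => G; rewrite finset.in_setD [G \in [set _ in _ | _]]inE [RHS]inE mem_planar_graphs.
  by case: (drawable G) (#|G| == m n) (has_component_iso H G) => [] [] [].
rewrite /uniform_probability -/P ler_pdivlMr ?ltr0n // ler_pdivrMl ?ltr0n // -natrM ler_nat.
have := KN 'I_n (m n); rewrite card_ord => /(_ _ nq sm); rewrite -bad -good => le.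
rewrite -(cardsID [set G in P | has_component_iso H G] P) mulSn leq_add //.
  by apply: subset_leq_card; exact: subsetIr.
exact: le.
Qed.
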